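(* The following two mixing-time bounds hold for CHAR (Coordinate Hit-and-Run). (Warm start.) Let $K \subseteq \mathbb{R}^n$ be a convex body containing a unit ball, let $R^2$ be the expected squared (Euclidean) distance of a uniformly random point of $K$ from the centroid of $K$, and let $\pi$ denote the uniform distribution on $K$. Let $\nu_0$ denote the density, with respect to $\pi$, of the initial distribution, and suppose $\|\nu_0\|_\infty < M$. Let $\varepsilon > 0$. Then the number of steps $T_{\mathrm{warm}}$ needed for CHAR on $K$ to achieve a density $\nu_T$ satisfying $\|\nu_T - 1_K\|_{L^2(\pi)} < \varepsilon$ obeys $$T_{\mathrm{warm}} \le O\left(\frac{M^2 R^2 n^8}{\varepsilon^2} \log\left(\frac{2M}{\varepsilon}\right)\right).$$ (Cold start.) Let $K \subseteq \mathbb{R}^n$ be a convex body such that $r \cdot B_\infty \subseteq K \subseteq R \cdot B_\infty$ for positive reals $r, R$, and let $\pi$ denote the uniform distribution on $K$. Let $\nu_0$ denote the density, with respect to $\pi$, of the initial distribution, and suppose $\|\nu_0\|_\infty < M$. Let $\varepsilon > 0$. Then the number of steps $T_{\mathrm{cold}}$ needed for CHAR on $K$ to achieve a density $\nu_T$ satisfying $\|\nu_T - 1_K\|_{L^2(\pi)} < \varepsilon$ obeys $$T_{\mathrm{cold}} \le O\left(\frac{n^8}{(r/R)^2} \log\left(\frac{M}{\varepsilon}\right)\right).$$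
   Context: Coordinate Hit-and-Run (CHAR, also called Gibbs sampling) on a convex body $K \subseteq \mathbb{R}^n$ is the Markov chain on $K$ with the following transition: from the current point $x \in K$, pick a uniformly random coordinate direction $e_i$, $i \in \{1,\dots,n\}$, and resample the $i$th coordinate of $x$ according to the one-dimensional distribution induced by fixing all other coordinates, i.e. move to a uniformly random point of the segment $K \cap \{x + t e_i : t \in \mathbb{R}\}$. Here $\nu_T$ denotes the density, with respect to $\pi$, of the distribution of the chain after $T$ steps started from density $\nu_0$; $1_K$ is the indicator function of $K$; and $B_\infty = [-1,1]^n$ is the unit ball of the $\ell_\infty$ norm. $B = O(A)$ means $B < CA$ for some absolute constant $C$.
   Formalization: The logarithms log(2M/ε) and log(M/ε) are replaced by their positive parts max(0, log), since for ε > 2M (resp. ε > M) the stated bound on the number of steps would be negative; there the theorem says that no step is needed. *)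

(* Defs.v *)
From HB Require Import structures.
From mathcomp Require Import all_boot all_order all_algebra.
From mathcomp Require Import all_classical all_reals all_analysis.
From mathcomp Require Import measurable_realfun.

Set Implicit Arguments.
Unset Strict Implicit.
Unset Printing Implicit Defensive.

Import Order.TTheory GRing.Theory Num.Theory.
Import numFieldNormedType.Exports.

Local Open Scope classical_set_scope.
Local Open Scope ring_scope.

(* ['rV[R]_n] carries the product sigma-algebra, as [n.-tuple R] does in the
   library; [open_measurable_rV] below shows that it contains the Borel sets. *)
Definition measure_rV_display : measure_display.
Proof. exact. Qed.

Section measurable_rV.
Context {R : realType} (n : nat).

Let coors : 'I_n -> 'rV[R]_n -> R := fun i x => x 0 i.

Let rV_set0 : g_sigma_preimage coors set0.
Proof. exact: sigma_algebra0. Qed.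

Let rV_setC A : g_sigma_preimage coors A -> g_sigma_preimage coors (~` A).
Proof. exact: sigma_algebraC. Qed.

Let rV_bigcup (F : _^nat) : (forall i, g_sigma_preimage coors (F i)) ->
  g_sigma_preimage coors (\bigcup_i (F i)).
Proof. exact: sigma_algebra_bigcup. Qed.

HB.instance Definition _ := @isMeasurable.Build measure_rV_display
  'rV[R]_n (g_sigma_preimage coors) rV_set0 rV_setC rV_bigcup.

Lemma measurable_coord (i : 'I_n) :
  measurable_fun [set: 'rV[R]_n] (fun x : 'rV[R]_n => x 0 i).
Proof.
move=> _ Y mY; rewrite setTI; apply: sub_sigma_algebra => /=.
rewrite -bigcup_seq/=; exists i => /=; first by rewrite mem_index_enum.
by exists Y => //; rewrite setTI.
Qed.

Lemma measurable_fun_rVP d (T : measurableType d) (f : T -> 'rV[R]_n) :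
  (forall i, measurable_fun [set: T] (fun x => f x 0 i)) ->
  measurable_fun [set: T] f.
Proof.
move=> mf.
have : g_sigma_preimage (fun i x => f x 0 i) `<=` (measurable : set (set T)).
  apply: smallest_sub; first exact: sigma_algebra_measurable.
  move=> A; rewrite -bigcup_seq/= => -[i _ [B mB <-]].
  by rewrite setTI -[X in measurable X]setTI; exact: mf.
rewrite (_ : (fun i x => _) = (fun i => coors i \o f))//.
rewrite g_sigma_preimage_comp => sub _ A mA; apply: sub.
by exists A.
Qed.

End measurable_rV.

Section open_measurable_rV.
Context {R : realType} (n : nat).

Lemma ball_measurable_rV (x : 'rV[R]_n) (e : R) : 0 < e ->
  measurable (ball x e).
Proof.
move=> e0.
have -> : ball x e = \bigcap_(i in [set: 'I_n])
    ((fun y : 'rV[R]_n => y 0 i) @^-1` ball (x 0 i) e).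
  apply/seteqP; split => y.
    by move=> [_ xy] i _ /=; exact: xy.
  by move=> xy; split => // i j; rewrite ord1; exact: xy.
apply: fin_bigcap_measurable => // i _.
rewrite -[X in measurable X]setTI; apply: measurable_coord => //.
by apply: open_measurable; exact: ball_open.
Qed.

Lemma open_measurable_rV (A : set 'rV[R]_n) : open A -> measurable A.
Proof.
move=> oA.
pose c (p : 'rV[rat]_n * nat) : set 'rV[R]_n :=
  ball (map_mx ratr p.1 : 'rV[R]_n) p.2.+1%:R^-1.
have -> : A = \bigcup_(p in [set p | c p `<=` A]) c p.
  apply/seteqP; split; last by move=> x [p pA]; exact: pA.
  move=> x Ax.
  have [e /= e0 xeA] : exists2 e : R, 0 < e & ball x e `<=` A.
    by apply/nbhs_ballP; exact: open_nbhs_nbhs.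
  have [k ke] : exists k : nat, k.+1%:R^-1 < e / 2.
    have e20 : 0 < e / 2 by rewrite divr_gt0.
    have [k _ ke] := near_infty_natSinv_lt (PosNum e20).
    by exists k; apply: ke => /=.
  have q_ i : exists q : rat, ball (x 0 i) k.+1%:R^-1 (ratr q : R).
    have [|//|r [xr [q _ qr]]] := @dense_rat R (ball (x 0 i) k.+1%:R^-1).
    - by exists (x 0 i); apply: ballxx; rewrite invr_gt0.
    - by apply: ball_open; rewrite invr_gt0.
    - by exists q; rewrite qr.
  have [q qP] := choice q_.
  have xc : c (\row_i q i, k) x.
    split; first by rewrite invr_gt0.
    by move=> i j; rewrite ord1 !mxE; exact/ball_sym/qP.
  exists (\row_i q i, k) => // y cy; apply: xeA.
  apply: (@le_ball _ _ _ (k.+1%:R^-1 + k.+1%:R^-1)).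
    by rewrite [leRHS]splitr lerD// ltW.
  exact: ball_triangle (ball_sym xc) cy.
rewrite bigcup_mkcond; apply: countable_bigcupT_measurable.
  exact: countableP.
by move=> p; case: ifPn => // _; apply: ball_measurable_rV; rewrite invr_gt0.
Qed.

Lemma compact_measurable_rV (A : set 'rV[R]_n) : compact A -> measurable A.
Proof.
move=> /compact_closed cA; rewrite -(setCK A); apply: measurableC.
by apply: open_measurable_rV; apply: closed_openC; apply: cA; exact: norm_hausdorff.
Qed.

End open_measurable_rV.

(* Lebesgue measure on [R^n], by induction on [n]: the product of the
   one-dimensional Lebesgue measure with the Lebesgue measure on [R^n.-1]. *)
Section lebesgue_rV_step.
Context {R : realType} (n : nat).

Definition row_cons (p : R * 'rV[R]_n) : 'rV[R]_n.+1 :=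
  \row_j oapp (fun i => p.2 0 i) p.1 (unlift ord0 j).

Definition row_uncons (x : 'rV[R]_n.+1) : R * 'rV[R]_n :=
  (x 0 ord0, \row_i x 0 (lift ord0 i)).

Lemma row_consK : cancel row_cons row_uncons.
Proof.
move=> [a v]; rewrite /row_uncons mxE unlift_none/=; congr (_, _).
by apply/rowP => i; rewrite !mxE liftK.
Qed.

Lemma row_unconsK : cancel row_uncons row_cons.
Proof. by move=> x; apply/rowP => i; rewrite mxE; case: unliftP => [j|] ->; rewrite /= ?mxE. Qed.

Lemma measurable_row_cons : measurable_fun [set: R * 'rV[R]_n] row_cons.
Proof.
apply: measurable_fun_rVP => i.
under eq_fun do rewrite mxE.
case: unlift => [j|] /=; last exact: measurable_fst.
by apply: (measurableT_comp (measurable_coord j)); exact: measurable_snd.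
Qed.

Lemma measurable_row_uncons : measurable_fun [set: 'rV[R]_n.+1] row_uncons.
Proof.
apply/measurable_fun_pairP; split; first exact: measurable_coord.
apply: measurable_fun_rVP => i /=.
by under eq_fun do rewrite mxE; exact: measurable_coord.
Qed.

Variable m : {sigma_finite_measure set 'rV[R]_n -> \bar R}.

Definition lebesgue_cons : set 'rV[R]_n.+1 -> \bar R :=
  pushforward (@lebesgue_measure R \x m)%E row_cons.

Let lebesgue_cons0 : lebesgue_cons set0 = 0%E.
Proof. by rewrite /lebesgue_cons /pushforward preimage_set0 measure0. Qed.

Let lebesgue_cons_ge0 A : (0 <= lebesgue_cons A)%E.
Proof. by rewrite /lebesgue_cons /pushforward measure_ge0. Qed.

Let lebesgue_cons_sigma_additive : semi_sigma_additive lebesgue_cons.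
Proof.
rewrite /lebesgue_cons => F mF tF mUF; rewrite /pushforward preimage_bigcup.
apply: measure_semi_sigma_additive.
- by move=> n0; rewrite -[X in measurable X]setTI; exact: measurable_row_cons.
- apply/trivIsetP => /= i j _ _ ij; rewrite -preimage_setI.
  by move/trivIsetP : tF => /(_ _ _ _ _ ij) ->//; rewrite preimage_set0.
- rewrite -preimage_bigcup -[X in measurable X]setTI.
  exact: measurable_row_cons.
Qed.

HB.instance Definition _ := isMeasure.Build _ _ _ lebesgue_cons
  lebesgue_cons0 lebesgue_cons_ge0 lebesgue_cons_sigma_additive.

Let lebesgue_cons_sigma_finite : sigma_finite setT lebesgue_cons.
Proof.
have /sigma_finiteP[F [TF ndF Foo]] := sigma_finiteT (@lebesgue_measure R).
have /sigma_finiteP[G [TG ndG Goo]] := sigma_finiteT m.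
exists (fun k => row_uncons @^-1` (F k `*` G k)).
  rewrite -preimage_bigcup (_ : \bigcup_k _ = setT) ?preimage_setT//.
  apply/seteqP; split=> // -[a v] _.
  have [k _ Fka] : (\bigcup_k F k) a by rewrite -TF.
  have [l _ Glv] : (\bigcup_k G k) v by rewrite -TG.
  exists (maxn k l) => //; split => /=.
    by move: a Fka; exact/subsetPset/ndF/leq_maxl.
  by move: v Glv; exact/subsetPset/ndG/leq_maxr.
move=> k; have [mF Fk] := Foo k; have [mG Gk] := Goo k.
have mFG : measurable (F k `*` G k : set (R * 'rV[R]_n)) by exact: measurableX.
split; first by rewrite -[X in measurable X]setTI; exact: measurable_row_uncons.
rewrite /lebesgue_cons /pushforward -comp_preimage.
rewrite (_ : row_uncons \o row_cons = id); last first.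
  by apply/funext => p; exact: row_consK.
by rewrite product_measure1E// lte_mul_pinfty// ge0_fin_numE.
Qed.

HB.instance Definition _ := Measure_isSigmaFinite.Build _ _ _ lebesgue_cons
  lebesgue_cons_sigma_finite.

End lebesgue_rV_step.

Fixpoint lebesgue_rV {R : realType} (n : nat) :
    {sigma_finite_measure set 'rV[R]_n -> \bar R} :=
  match n with
  | 0 => \d_(0 : 'rV[R]_0)
  | n.+1 => lebesgue_cons (lebesgue_rV n)
  end.

Lemma lebesgue_rV_box {R : realType} (n : nat) (A : 'I_n -> set R) :
  (forall i, measurable (A i)) ->
  lebesgue_rV n [set x | forall i, A i (x 0 i)] =
  (\prod_(i < n) lebesgue_measure (A i))%E.
Proof.
elim: n A => [|n IH] A mA.
  rewrite big_ord0 /= diracE mem_set// => -[]//.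
rewrite big_ord_recl -IH; last by move=> i; exact: mA.
have mB : measurable [set y : 'rV[R]_n | forall i, A (lift ord0 i) (y 0 i)].
  rewrite (_ : mkset _ = \bigcap_(i in [set: 'I_n])
      ((fun y : 'rV[R]_n => y 0 i) @^-1` A (lift ord0 i))); last first.
    by apply/seteqP; split => [x xA i _|x xA i]; [exact: xA|exact: (xA i I)].
  apply: fin_bigcap_measurable => // i _.
  by rewrite -[X in measurable X]setTI; exact: measurable_coord.
rewrite /= /lebesgue_cons /pushforward.
rewrite -[RHS]product_measure1E//; last exact: mA.
congr (_ _); apply/seteqP; split => [[a v] /= avA|[a v] [/= aA vA] i].
  split; first by have := avA ord0; rewrite mxE unlift_none.
  by move=> i; have := avA (lift ord0 i); rewrite mxE liftK.
by rewrite mxE; case: unliftP => [j|] ->.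
Qed.

Record convex_body (R : realType) (n : nat) := ConvexBody {
  convex_body_set :> set 'rV[R]_n;
  convex_body_convex : @convex_set R 'rV[R]_n convex_body_set;
  convex_body_compact : compact convex_body_set;
  convex_body_interior : convex_body_set° !=set0 }.

Lemma mnormalizeE d (T : measurableType d) (R : realType)
    (mu : {measure set T -> \bar R}) (P : probability T R) (U : set T) :
  mnormalize mu P U =
  if (mu setT == 0%E) || (mu setT == +oo%E) then P U
  else (mu U * (fine (mu setT))^-1%:E)%E.
Proof. by rewrite /mnormalize; case: ifP. Qed.

Section uniform_on_convex_body.
Context {R : realType} {n : nat} (K : convex_body R n).

Lemma measurable_convex_body : measurable (K : set 'rV[R]_n).
Proof. by apply: compact_measurable_rV; exact: convex_body_compact. Qed.

Lemma lebesgue_rV_ball (x : 'rV[R]_n) (e : R) : 0 < e ->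
  lebesgue_rV n (ball x e) = ((e *+ 2) ^+ n)%:E.
Proof.
move=> e0.
have -> : ball x e = [set y | forall i, ball (x 0 i) e (y 0 i)].
  apply/seteqP; split => y; first by move=> [_ xy] i; exact: xy.
  by move=> xy; split => // i j; rewrite ord1; exact: xy.
rewrite (lebesgue_rV_box (A := fun i => ball (x 0 i) e)); last first.
  by move=> i; apply: open_measurable; exact: ball_open.
under eq_bigr do rewrite lebesgue_measure_ball ?(ltW e0)//.
by rewrite prodEFin prodr_const card_ord.
Qed.

Lemma lebesgue_rV_convex_body_gt0 : (0 < lebesgue_rV n K)%E.
Proof.
have [x /nbhs_ballP[e /= e0 xeK]] := convex_body_interior K.
apply: (@lt_le_trans _ _ (lebesgue_rV n (ball x e))).
  by rewrite lebesgue_rV_ball// lte_fin exprn_gt0// pmulrn_lgt0.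
apply: le_measure => //; rewrite inE; last exact: measurable_convex_body.
exact: ball_measurable_rV.
Qed.

Lemma lebesgue_rV_convex_body_lty : (lebesgue_rV n K < +oo)%E.
Proof.
have [N [_ KN]] := compact_bounded (@convex_body_compact _ _ K).
have /KN{}KN : N < `|N| + 1 by rewrite (le_lt_trans (ler_norm _))// ltrDl.
have N0 : 0 < `|N| + 2 by rewrite ltr_wpDl.
apply: (@le_lt_trans _ _ (lebesgue_rV n (ball (0 : 'rV[R]_n) (`|N| + 2)))).
  apply: le_measure; rewrite ?inE; first exact: measurable_convex_body.
    exact: ball_measurable_rV.
  move=> x /KN xN; rewrite -ball_normE /ball_/= sub0r normrN.
  by rewrite (le_lt_trans xN)// ltrD2l ltr1n.
by rewrite lebesgue_rV_ball// ltry.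
Qed.

Definition unif : probability 'rV[R]_n R :=
  mnormalize (mrestr (lebesgue_rV n) measurable_convex_body)
    \d_(0 : 'rV[R]_n).

Lemma unifE (A : set 'rV[R]_n) :
  unif A = (lebesgue_rV n (A `&` K) * (fine (lebesgue_rV n K))^-1%:E)%E.
Proof.
have -> : unif A =
    if (lebesgue_rV n (setT `&` K) == 0%E) || (lebesgue_rV n (setT `&` K) == +oo%E)
    then \d_(0 : 'rV[R]_n) A
    else (lebesgue_rV n (A `&` K) * (fine (lebesgue_rV n (setT `&` K)))^-1%:E)%E.
  exact: mnormalizeE.
rewrite setTI.
by rewrite gt_eqF ?lebesgue_rV_convex_body_gt0// lt_eqF// lebesgue_rV_convex_body_lty.
Qed.

Definition centroid : 'rV[R]_n := \row_i \int[unif]_x x 0 i.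

Definition mean_sqr_dist_centroid : R :=
  \int[unif]_x \sum_(i < n) (x 0 i - centroid 0 i) ^+ 2.

End uniform_on_convex_body.

Definition euclidean_ball {R : realType} {n : nat} (c : 'rV[R]_n) (r : R) :
    set 'rV[R]_n :=
  [set x | Num.sqrt (\sum_(i < n) (x 0 i - c 0 i) ^+ 2) <= r].

Definition B_infty {R : realType} {n : nat} : set 'rV[R]_n :=
  [set x | forall i, `|x 0 i| <= 1].

Section CHAR.
Context {R : realType} {n : nat}.
Implicit Types (x : 'rV[R]_n) (i : 'I_n) (t : R).

Definition set_coord x i t : 'rV[R]_n := \row_j if j == i then t else x 0 j.

Lemma set_coord_id x i : set_coord x i (x 0 i) = x.
Proof. by apply/rowP => j; rewrite mxE; case: eqP => // ->. Qed.

Lemma measurable_set_coord2 i :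
  measurable_fun [set: 'rV[R]_n * R] (fun xt => set_coord xt.1 i xt.2).
Proof.
apply: measurable_fun_rVP => j; under eq_fun do rewrite mxE.
case: (j == i); first exact: measurable_snd.
by apply: (measurableT_comp (measurable_coord j)); exact: measurable_fst.
Qed.

Lemma measurable_set_coord x i : measurable_fun [set: R] (set_coord x i).
Proof.
apply: measurable_fun_rVP => j; under eq_fun do rewrite mxE.
by case: (j == i); [exact: measurable_id|exact: measurable_cst].
Qed.

Variable K : convex_body R n.

(* The line through [x] in direction [e_i] intersected with [K], parametrized
   by the value of the [i]-th coordinate. *)
Definition fiber x i : set R := set_coord x i @^-1` K.

Lemma measurable_fiber x i : measurable (fiber x i).
Proof.
rewrite -[X in measurable X]setTI.
by apply: measurable_set_coord => //; exact: measurable_convex_body.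
Qed.

(* Uniform distribution on the fiber; when the fiber has length 0 (a single
   point, for [x \in K]) the [i]-th coordinate of [x] is kept. *)
Definition unif_fiber x i : probability (measurableTypeR R) R :=
  mnormalize (mrestr lebesgue_measure (measurable_fiber x i))
    \d_(x 0 i : measurableTypeR R).

Definition char_prob x (A : set 'rV[R]_n) : \bar R :=
  ((n%:R^-1)%:E * \sum_(i < n) unif_fiber x i (set_coord x i @^-1` A))%E.

Let char_prob0 x : char_prob x set0 = 0%E.
Proof.
by rewrite /char_prob big1 ?mule0// => i _; rewrite preimage_set0 measure0.
Qed.

Let char_prob_ge0 x A : (0 <= char_prob x A)%E.
Proof. by rewrite mule_ge0 ?sume_ge0// lee_fin invr_ge0. Qed.

Let char_prob_sigma_additive x : semi_sigma_additive (char_prob x).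
Proof.
move=> F mF tF mUF; rewrite /char_prob.
under eq_fun => m.
  rewrite -ge0_sume_distrr; last by move=> k _; exact: sume_ge0.
  rewrite exchange_big; over.
apply: cvgeZl => //.
apply: cvg_nnesum => [i _|i _].
  by apply: nearW => m; exact: sume_ge0.
rewrite preimage_bigcup; apply: measure_semi_sigma_additive.
- by move=> k; rewrite -[X in measurable X]setTI; exact: measurable_set_coord.
- apply/trivIsetP => /= a b _ _ ab; rewrite -preimage_setI.
  by move/trivIsetP : tF => /(_ _ _ _ _ ab) ->//; rewrite preimage_set0.
- rewrite -preimage_bigcup -[X in measurable X]setTI.
  exact: measurable_set_coord.
Qed.

HB.instance Definition _ x := isMeasure.Build _ _ _ (char_prob x)
  (char_prob0 x) (char_prob_ge0 x) (@char_prob_sigma_additive x).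

Let measurable_length i A : measurable A ->
  measurable_fun [set: 'rV[R]_n]
    (fun x => lebesgue_measure (set_coord x i @^-1` A : set (measurableTypeR R))).
Proof.
move=> mA.
pose B := (fun xt : 'rV[R]_n * measurableTypeR R => set_coord xt.1 i xt.2) @^-1` A.
have mB : measurable B.
  by rewrite -[X in measurable X]setTI; exact: measurable_set_coord2.
rewrite (_ : (fun x => _) = @lebesgue_measure R \o xsection B).
  exact: measurable_fun_xsection.
apply/funext => x /=; congr (lebesgue_measure _).
by apply/seteqP; split => t; rewrite /xsection/= inE.
Qed.

Let measurable_unif_fiber i A : measurable A ->
  measurable_fun [set: 'rV[R]_n]
    (fun x => unif_fiber x i (set_coord x i @^-1` A)).
Proof.
move=> mA.
pose L x := lebesgue_measure (fiber x i : set (measurableTypeR R)).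
have mL : measurable_fun setT L.
  exact: (measurable_length i (measurable_convex_body K)).
rewrite (_ : (fun x => _) = (fun x =>
    if (L x == 0%E) || (L x == +oo%E) then (\1_A x)%:E
    else (lebesgue_measure (set_coord x i @^-1` (A `&` K) : set (measurableTypeR R)) *
          (fine (L x))^-1%:E)%E)); last first.
  apply/funext => x.
  have -> : \1_A x = \1_(set_coord x i @^-1` A) (x 0 i) :> R.
    by rewrite !indicE; congr (nat_of_bool _)%:R;
      apply/idP/idP; rewrite !inE /preimage/= set_coord_id.
  have <- : lebesgue_measure (setT `&` fiber x i : set (measurableTypeR R)) = L x.
    by rewrite setTI.
  exact: mnormalizeE.
apply: measurable_fun_ifT => //.
- apply: (measurable_fun_bool true); rewrite setTI.
  rewrite (_ : _ @^-1` _ = L @^-1` [set 0%E] `|` L @^-1` [set +oo%E]); last first.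
    by apply/seteqP; split=> x /= => [/orP[]/eqP|[]/eqP ->]; [left|right| |rewrite orbT].
  by apply: measurableU; rewrite -[X in measurable X]setTI; exact: mL.
- by apply/measurable_EFinP; exact: measurable_indic.
- apply: emeasurable_funM.
    by apply: measurable_length; apply: measurableI => //; exact: measurable_convex_body.
  apply/measurable_EFinP.
  rewrite (_ : (fun x => _) = (fun x => powR (fine (L x)) (-1))); last first.
    by apply/funext => x; rewrite powR_inv1// fine_ge0.
  apply: (measurableT_comp (measurable_powR _)).
  exact: measurableT_comp.
Qed.

Definition char_kernel x : {measure set 'rV[R]_n -> \bar R} := char_prob x.

Lemma measurable_char_kernel (A : set 'rV[R]_n) : measurable A ->
  measurable_fun [set: 'rV[R]_n] (char_kernel ^~ A).
Proof.
move=> mA; apply: measurable_funeM; apply: emeasurable_sum => i.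
exact: measurable_unif_fiber.
Qed.

HB.instance Definition _ :=
  isKernel.Build _ _ _ _ R char_kernel measurable_char_kernel.

Lemma char_kernel_setT x : (0 < n)%N -> char_kernel x setT = 1%E.
Proof.
move=> n0; rewrite /char_kernel/= /char_prob.
under eq_bigr => i _.
  rewrite preimage_setT.
  have -> : unif_fiber x i setT = 1%E by exact: (@probability_setT _ _ _ (unif_fiber x i)).
  over.
by rewrite sumEFin sumr_const card_ord -EFinM mulVf// pnatr_eq0 -lt0n.
Qed.

(* Law of the next state of the chain when the current state has law [mu]. *)
Definition char_step (mu : {measure set 'rV[R]_n -> \bar R})
  (A : set 'rV[R]_n) : \bar R := (\int[mu]_x char_kernel x A)%E.

Section char_step.
Variable mu : {measure set 'rV[R]_n -> \bar R}.

Let char_step0 : char_step mu set0 = 0%E.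
Proof. by rewrite /char_step integral0_eq. Qed.

Let char_step_ge0 A : (0 <= char_step mu A)%E.
Proof. by apply: integral_ge0 => x _; exact: measure_ge0. Qed.

Let char_step_sigma_additive : semi_sigma_additive (char_step mu).
Proof.
move=> F mF tF mUF; rewrite [X in _ --> X](_ : _ =
    (\int[mu]_x \sum_(0 <= k <oo) char_kernel x (F k))%E); last first.
  apply: eq_integral => x _; apply/esym/cvg_lim => //.
  exact: measure_semi_sigma_additive.
rewrite integral_nneseries//; last by move=> k; exact: measurable_char_kernel.
by apply: is_cvg_nneseries => k _ _; exact: char_step_ge0.
Qed.

HB.instance Definition _ := isMeasure.Build _ _ _ (char_step mu)
  char_step0 char_step_ge0 char_step_sigma_additive.

End char_step.

(* Law of the state of the chain after [t] steps, started from [mu0]. *)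
Fixpoint char_law (mu0 : {measure set 'rV[R]_n -> \bar R}) (t : nat) :
    {measure set 'rV[R]_n -> \bar R} :=
  match t with
  | 0 => mu0
  | t.+1 => char_step (char_law mu0 t)
  end.

End CHAR.

Definition is_density {d} {T : measurableType d} {R : realType}
    (pi mu : {measure set T -> \bar R}) (f : T -> R) : Prop :=
  [/\ measurable_fun [set: T] f, forall x, 0 <= f x &
      forall A, measurable A -> mu A = (\int[pi]_(x in A) (f x)%:E)%E].

Section mixing.
Context {R : realType} {n : nat} (K : convex_body R n).
Context (mu0 : probability 'rV[R]_n R) (eps : R).

Definition L2_close (t : nat) : Prop :=
  exists2 nu : 'rV[R]_n -> R, is_density (unif K) (char_law K mu0 t) nu &
    ('N[unif K]_2%:E[EFin \o (nu \- \1_K)%R] < eps%:E)%E.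

(* [T] steps suffice, and the chain stays [eps]-close from step [T] on. *)
Definition mixed_after (T : nat) : Prop := forall t, (T <= t)%N -> L2_close t.

End mixing.

(* Main.v *)
Require Import Defs.
From mathcomp Require Import all_boot all_order all_algebra.
From mathcomp Require Import all_classical all_reals all_analysis.
From mathcomp Require Import measurable_realfun fingroup perm ring lra ess_sup_inf.

Set Implicit Arguments.
Unset Strict Implicit.
Unset Printing Implicit Defensive.

Import Order.TTheory GRing.Theory Num.Theory.
Import numFieldNormedType.Exports.

Local Open Scope classical_set_scope.
Local Open Scope ring_scope.

(* Let [pi] be the uniform distribution on [K]. The chain averages the density
   over a random chord, which preserves its expectation and decreases its
   chi-square distance to [1] by at least [1/n] times the Dirichlet form, the sum
   over the directions of the mean square deviation from the chord average.

   The Dirichlet form is bounded below by a Cheeger argument from an isoperimetric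
   inequality: if for all points [x] in [S] and [y] outside [S] of [K] on a line
   parallel to [e_i] one of them is in [G_i], then
   [min (pi S) (pi (~S)) <= A * sum_i pi (G_i) + s].
   Suppose that [K] contains the cube of radius [r] around [x0] and is contained
   in the cube of radius [n * rho] around [x0], and let [s] bound the mass of the
   points at sup-distance more than [rho] from some point [g]; then the
   inequality holds with [A] of order [n^2 * rho / r] and [3 s] for [s]:
   - Near the boundary, consider the shells between homothetic copies of [K],
     of geometrically decreasing width. Each shell is sent by two contractions
     to disjoint parts of the next shell inside, and these contractions can be
     decomposed into short moves along coordinate lines, so the mass of [S] in the
     shells is controlled by its mass in the inner part of [K].
   - In the inner part, the mass of [S] in a small cube is a Lipschitz function of
     its center. The region where the cube meets both [S] and its complement
     substantially has mass at most of order [sum_i pi (G_i)], again by moving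
     along coordinate lines, while by the Brunn-Minkowski inequality its mass is
     at least a fraction of order [r / (n^2 * rho)] of the smaller of the two
     regions that it separates.

   For the cold start, [x0 = g = 0] and [s = 0]. For the warm start, [r = 1 / n],
   [g] is the centroid, [K] lies within distance [O(n)] standard deviations of
   it, [rho] is a multiple of [M / eps] standard deviations and [s] comes from
   Markov's inequality. *)

(** * Lebesgue measure on [R^n] *)

(** Moving along coordinate lines is the obstacle: a short move in another direction is replaced by
    [n] moves along the axes, and the intermediate corners have to stay in [K]. In the sup norm
    every corner is as close to the start as the end is, so a margin to the boundary suffices; near
    the boundary, the moves must shrink with the depth. There, contractions shrink volumes, by a
    factor that stays above [3 / 4] at depths of order [1 / n], and the two disjoint images outweigh
    this loss.

    Cheeger's inequality costs a factor of order [n * A ^ 2], and picking the direction at random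
    another [n], whence [(n * A) ^ 2] steps up to the logarithm. With [A] of order [n ^ 2 * rho / r]
    this is [n ^ 6 * (rho / r) ^ 2], and [r = 1 / n] leads to [n ^ 8].

    The exceptional mass [s] adds a multiple of [s * M ^ 2] to the chi-square distance. Hence [s]
    must be of order [(eps / M) ^ 2], which through Markov's inequality dictates [rho] and produces
    the factor [M ^ 2 / eps ^ 2] of the warm start. *)

Lemma measure_le d (T : measurableType d) (R : realType)
    (m : {measure set T -> \bar R}) (A B : set T) :
  measurable A -> measurable B -> A `<=` B -> (m A <= m B)%E.
Proof. by move=> mA mB AB; apply: le_measure; rewrite ?in_setE. Qed.

Lemma lebesgue_measure_affine (R : realType) (a b : R) (A : set R) : 0 < a ->
  measurable A ->
  lebesgue_measure A =
  (a%:E * lebesgue_measure ((fun x => a * x + b)%R @^-1` A))%E.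
Proof.
move=> a0 mA.
pose f : measurableTypeR R -> measurableTypeR R := fun x => a * x + b.
have mf : measurable_fun setT f.
  by apply: measurable_funD => //; exact: measurable_funM.
pose m_ : {measure set (measurableTypeR R) -> \bar R} :=
  mscale (NngNum (ltW a0)) (pushforward (@lebesgue_measure R) f).
pose m := m_ mf.
suff: forall B, measurable B -> lebesgue_measure B = m B by move=> /(_ A mA).
apply: lebesgue_measure_unique => _ [[u v] _ <-].
have fE : f @^-1` `]u, v] = `](u - b) / a, (v - b) / a]%classic.
  apply/seteqP; split => x /=; rewrite !in_itv/= /f ltr_pdivrMr// ler_pdivlMr//;
    by rewrite ltrBlDr lerBrDr mulrC.
have -> : m `]u, v]%classic = (a%:E * lebesgue_measure (f @^-1` `]u, v]))%E by [].
rewrite fE.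
rewrite !lebesgue_measure_itv/= !lte_fin.
rewrite ltr_pM2r ?invr_gt0// ltrD2r.
case: ifPn => _; last by rewrite mule0.
by rewrite -EFinB -EFinM; congr EFin; field; rewrite gt_eqF.
Qed.

Lemma coord_ler_norm (R : realType) n (x : 'rV[R]_n) i : `|x 0 i| <= `|x|.
Proof. by rewrite [leRHS]mx_normrE; exact: (le_bigmax _ _ (0, i)). Qed.

Lemma rV_norm_ler (R : realType) n (x : 'rV[R]_n) r : 0 <= r ->
  (forall i, `|x 0 i| <= r) -> `|x| <= r.
Proof.
move=> r0 xr; rewrite [leLHS]mx_normrE; apply: bigmax_le => // -[i j] _ /=.
by rewrite ord1.
Qed.

Lemma rV_norm_const (R : realType) n (a : R) : (0 < n)%N -> 0 <= a ->
  `|const_mx a : 'rV[R]_n| = a.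
Proof.
move=> n0 a0; apply/eqP; rewrite eq_le; apply/andP; split.
  by apply: rV_norm_ler => // i; rewrite mxE ger0_norm.
by have := coord_ler_norm (const_mx a : 'rV[R]_n) (Ordinal n0); rewrite mxE ger0_norm.
Qed.

Section box_unique.
Context {R : realType} (n : nat).
Local Notation mu := (@lebesgue_measure R).

Definition rV_box (A : 'I_n -> set R) : set 'rV[R]_n :=
  [set x | forall i, A i (x 0 i)].

Lemma rV_box_bigcap (A : 'I_n -> set R) :
  rV_box A = \bigcap_(i in [set: 'I_n]) ((fun x : 'rV[R]_n => x 0 i) @^-1` A i).
Proof. by apply/seteqP; split => [x xA i _|x xA i]; [exact: xA|exact: (xA i I)]. Qed.

Lemma measurable_rV_box (A : 'I_n -> set R) :
  (forall i, measurable (A i)) -> measurable (rV_box A).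
Proof.
move=> mA; rewrite rV_box_bigcap; apply: fin_bigcap_measurable => // i _.
by rewrite -[X in measurable X]setTI; exact: measurable_coord.
Qed.

(** Measurable boxes form a pi-system generating the sigma-algebra, and the growing cubes [g k] have
    finite measure. Each change of variables below thus reduces to one-dimensional factors. *)
Lemma lebesgue_rV_unique (m : {measure set 'rV[R]_n -> \bar R}) :
  (forall A, (forall i, measurable (A i)) ->
    m (rV_box A) = (\prod_(i < n) lebesgue_measure (A i))%E) ->
  forall A, measurable A -> lebesgue_rV n A = m A.
Proof.
move=> mbox.
pose G := [set rV_box A | A in [set A : 'I_n -> set R | forall i, measurable (A i)]].
pose g k := rV_box (fun _ : 'I_n => ball (0 : R) k.+1%:R).
have mball k : measurable (ball (0 : R) k.+1%:R).
  by apply: open_measurable; exact: ball_open.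
apply: (measure_unique G g).
- apply/seteqP; split.
    apply: smallest_sub; first exact: smallest_sigma_algebra.
    move=> A; rewrite -bigcup_seq /= => -[i _ [B mB <-]].
    apply: sub_sigma_algebra.
    exists (fun j => if j == i then B else setT).
      by move=> j /=; case: ifP.
    rewrite setTI; apply/seteqP; split => x /=.
      by move=> /(_ i); rewrite eqxx.
    by move=> xB j; case: ifPn => // /eqP ->.
  apply: smallest_sub; first exact: sigma_algebra_measurable.
  by move=> _ [A mA <-]; exact: measurable_rV_box.
- move=> _ _ [A mA <-] [B mB <-]; exists (fun i => A i `&` B i).
    by move=> i; exact: measurableI.
  by apply/seteqP; split => x /=; [move=> AB; split => i; have [] := AB i
    |move=> [xA xB] i; split].
- by move=> k; exists (fun _ => ball (0 : R) k.+1%:R).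
- apply/seteqP; split => // x _.
  exists (Num.truncn `|x|) => // i; rewrite /ball/= sub0r normrN.
  by rewrite (le_lt_trans (coord_ler_norm x i))// truncnS_gt.
- by move=> _ [A mA <-]; rewrite mbox//; exact: lebesgue_rV_box.
- move=> k; rewrite [X in (X < _)%E](_ : _ = (\prod_(i < n) mu (ball (0 : R)%R k.+1%:R))%E).
    by under eq_bigr do rewrite lebesgue_measure_ball//; rewrite prodEFin ltry.
  exact: lebesgue_rV_box.
Qed.

End box_unique.

Section change_of_variables.
Context {R : realType} (n : nat).

(** Each coordinate has its own factor and shift because replacing some coordinates of one homothety
    or translation by those of another gives a map of this kind again. *)
Definition diag_affine (d c : 'I_n -> R) (x : 'rV[R]_n) : 'rV[R]_n :=
  \row_j (d j * x 0 j + c j).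

Lemma measurable_diag_affine d c : measurable_fun setT (diag_affine d c).
Proof.
apply: measurable_fun_rVP => i; under eq_fun do rewrite mxE.
by apply: measurable_funD => //; apply: measurable_funM => //; exact: measurable_coord.
Qed.

Lemma lebesgue_rV_diag_affine d c (A : set 'rV[R]_n) : (forall j, 0 < d j) ->
  measurable A ->
  lebesgue_rV n A =
  ((\prod_j d j)%:E * lebesgue_rV n (diag_affine d c @^-1` A))%E.
Proof.
move=> d0 mA.
have p0 : 0 <= \prod_j d j by apply: prodr_ge0 => j _; exact: ltW.
pose m_ : {measure set 'rV[R]_n -> \bar R} :=
  mscale (NngNum p0) (pushforward (lebesgue_rV n) (diag_affine d c)).
pose m := m_ (measurable_diag_affine d c).
suff: forall B, measurable B -> lebesgue_rV n B = m B by move=> /(_ A mA).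
apply: lebesgue_rV_unique => B mB.
have -> : m (rV_box B) =
    ((\prod_j d j)%:E * lebesgue_rV n (diag_affine d c @^-1` rV_box B))%E by [].
have -> : diag_affine d c @^-1` rV_box B =
    rV_box (fun j => (fun x => d j * x + c j) @^-1` B j).
  by apply/seteqP; split => x /= Bx i; have := Bx i; rewrite mxE.
rewrite [X in (_ * X)%E]lebesgue_rV_box; last first.
  move=> i; rewrite -[X in measurable X]setTI.
  suff : measurable_fun setT (fun x => d i * x + c i) by exact.
  by apply: measurable_funD => //; exact: measurable_funM.
rewrite -prodEFin -big_split/=; apply: eq_bigr => j _.
by rewrite -lebesgue_measure_affine.
Qed.

Lemma lebesgue_rV_translate (v : 'rV[R]_n) (A : set 'rV[R]_n) : measurable A ->
  lebesgue_rV n [set x | A (x + v)] = lebesgue_rV n A.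
Proof.
move=> mA; rewrite [RHS](lebesgue_rV_diag_affine (d := fun=> 1) (fun j => v 0 j))//.
rewrite big1// mul1e; congr (lebesgue_rV n _); apply/seteqP.
have E x : diag_affine (fun=> 1) (fun j => v 0 j) x = x + v.
  by apply/rowP => j; rewrite !mxE mul1r.
by split => x /=; rewrite E.
Qed.

Lemma lebesgue_rV_perm (s : 'S_n) (A : set 'rV[R]_n) : measurable A ->
  lebesgue_rV n (col_perm s @^-1` A) = lebesgue_rV n A.
Proof.
move=> mA.
have mp : measurable_fun setT (@col_perm R 1 n s).
  by apply: measurable_fun_rVP => i; under eq_fun do rewrite mxE; exact: measurable_coord.
pose m_ : {measure set 'rV[R]_n -> \bar R} :=
  pushforward (lebesgue_rV n) (@col_perm R 1 n s).
pose m := m_ mp.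
suff: forall B, measurable B -> lebesgue_rV n B = m B by move=> /(_ A mA).
apply: lebesgue_rV_unique => B mB.
have -> : m (rV_box B) = lebesgue_rV n (col_perm s @^-1` rV_box B) by [].
have -> : col_perm s @^-1` rV_box B = rV_box (fun j => B (s^-1%g j)).
  apply/seteqP; split => x /= Bx i; last by have := Bx (s i); rewrite permK mxE.
  by have := Bx (s^-1%g i); rewrite mxE permKV.
rewrite lebesgue_rV_box//.
by rewrite (reindex_inj (@perm_inj _ s)) /=; apply: eq_bigr => i _; rewrite permK.
Qed.

End change_of_variables.

Section swap_coordinate.
Context {R : realType} (n : nat).
Local Notation mu := (@lebesgue_measure R).

Definition swap_coord (i : 'I_n) (tx : measurableTypeR R * 'rV[R]_n) :
  measurableTypeR R * 'rV[R]_n := (tx.2 0 i, set_coord tx.2 i tx.1).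

Lemma measurable_swap_coord i : measurable_fun setT (swap_coord i).
Proof.
apply/measurable_fun_pairP; split => /=.
  by apply: (measurableT_comp (measurable_coord i)); exact: measurable_snd.
apply: measurable_fun_rVP => j; under eq_fun do rewrite mxE.
case: (j == i); first exact: measurable_fst.
by apply: (measurableT_comp (measurable_coord j)); exact: measurable_snd.
Qed.

(* Through [row_cons], [swap_coord i] is the transposition of the coordinates
   [0] and [i + 1] of [R^n.+1]. *)
Lemma swap_coord_preserves i (A : set (measurableTypeR R * 'rV[R]_n)) :
  measurable A ->
  (mu \x lebesgue_rV n)%E (swap_coord i @^-1` A) = (mu \x lebesgue_rV n)%E A.
Proof.
move=> mA.
pose B := (@row_uncons R n) @^-1` A.
have mB : measurable B.
  by rewrite -[X in measurable X]setTI; exact: measurable_row_uncons.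
have consE (X : set (measurableTypeR R * 'rV[R]_n)) :
    (mu \x lebesgue_rV n)%E X = lebesgue_rV n.+1 (@row_uncons R n @^-1` X).
  rewrite /= /lebesgue_cons /pushforward -comp_preimage.
  rewrite (_ : _ \o _ = id)//; apply/funext => p; exact: row_consK.
pose s := tperm (@ord0 n) (lift ord0 i).
have swapE : @swap_coord i \o @row_uncons R n = @row_uncons R n \o @col_perm R 1 n.+1 s.
  apply/funext => x /=; rewrite /swap_coord /row_uncons /= !mxE tpermL.
  congr (_, _); apply/rowP => j; rewrite !mxE.
  have [->|ji] := eqVneq j i; first by rewrite tpermR.
  by rewrite tpermD// (inj_eq lift_inj) eq_sym.
have preE : @row_uncons R n @^-1` (swap_coord i @^-1` A) = @col_perm R 1 n.+1 s @^-1` B.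
  by rewrite /B -[LHS]/((swap_coord i \o row_uncons (n := n)) @^-1` A) swapE.
transitivity (lebesgue_rV n.+1 (@col_perm R 1 n.+1 s @^-1` B)).
  by rewrite -preE; exact: consE.
transitivity (lebesgue_rV n.+1 B); first exact: lebesgue_rV_perm.
by apply/esym; exact: consE.
Qed.

Lemma ge0_integral_swap_coord i (f : measurableTypeR R * 'rV[R]_n -> \bar R) :
  measurable_fun setT f -> (forall x, 0 <= f x)%E ->
  (\int[lebesgue_rV n]_x \int[mu]_t f (t, x) =
   \int[lebesgue_rV n]_x \int[mu]_t f (x 0%R i, set_coord x i t))%E.
Proof.
move=> mf f0.
have mfs : measurable_fun setT (f \o swap_coord i).
  by apply: (measurableT_comp mf); exact: measurable_swap_coord.
transitivity (\int[mu \x lebesgue_rV n]_z f z)%E.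
  by apply/esym; exact: fubini_tonelli2.
transitivity (\int[mu \x lebesgue_rV n]_z (f \o swap_coord i) z)%E; last first.
  by apply: (fubini_tonelli2 (f \o swap_coord i)) => // x; exact: f0.
transitivity (\int[pushforward (mu \x lebesgue_rV n)%E (swap_coord i)]_z f z)%E.
  apply: eq_measure_integral; first exact: measurable_swap_coord.
  by move=> mswap A mA _; apply/esym; exact: swap_coord_preserves.
rewrite ge0_integral_pushforward//.
exact: measurable_swap_coord.
Qed.

End swap_coordinate.

Lemma measurable_ltr_set d (T : measurableType d) (R : realType) (f g : T -> R) :
  measurable_fun setT f -> measurable_fun setT g -> measurable [set x | f x < g x].
Proof.
move=> mf mg.
have := measurable_fun_ltr mf mg => /(_ measurableT [set true] I).
by rewrite setTI; congr measurable; apply/seteqP; split => x.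
Qed.

Lemma measurable_ler_set d (T : measurableType d) (R : realType) (f g : T -> R) :
  measurable_fun setT f -> measurable_fun setT g -> measurable [set x | f x <= g x].
Proof.
move=> mf mg.
have := measurable_fun_ler mf mg => /(_ measurableT [set true] I).
by rewrite setTI; congr measurable; apply/seteqP; split => x.
Qed.

(** * Integrals as integrals over levels *)

Section layer_cake.
Context {R : realType} d (T : measurableType d).
Variable m : {sigma_finite_measure set T -> \bar R}.
Local Notation mu := (@lebesgue_measure R).

Lemma integral_xsection_ysection d' (T' : measurableType d')
    (m' : {sigma_finite_measure set T' -> \bar R}) (Z : set (T * T')) :
  measurable Z ->
  (\int[m]_x m' (xsection Z x) = \int[m']_s m (ysection Z s))%E.
Proof.
move=> mZ; have := indic_fubini_tonelli m m' mZ.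
by rewrite indic_fubini_tonelli_FE// indic_fubini_tonelli_GE.
Qed.

Lemma layer_cake (f : T -> R) : measurable_fun setT f -> (forall x, 0 <= f x) ->
  (\int[m]_x (f x)%:E = \int[mu]_(s in `[0%R, +oo[) m [set x | (s < f x)%R])%E.
Proof.
move=> mf f0.
pose Z := [set p : T * measurableTypeR R | 0 <= p.2] `&`
          [set p : T * measurableTypeR R | p.2 < f p.1].
have mZ : measurable Z.
  apply: measurableI.
    by apply: measurable_ler_set => //; exact: measurable_snd.
  apply: measurable_ltr_set; first exact: measurable_snd.
  by apply: (measurableT_comp mf); exact: measurable_fst.
transitivity (\int[m]_x mu (xsection Z x))%E.
  apply: eq_integral => x _.
  have -> : xsection Z x = `[0, f x[%classic.
    apply/seteqP; split => s.
      by rewrite /xsection /mkset in_setE => -[? ?]; rewrite /= in_itv/=; apply/andP.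
    by rewrite /= in_itv /= => /andP[? ?]; rewrite /xsection /mkset in_setE.
  rewrite lebesgue_measure_itv/= lte_fin sube0.
  by case: ltP => // fx0; congr EFin; apply/esym/eqP; rewrite eq_le fx0 f0.
rewrite (integral_xsection_ysection _ mZ) [RHS]integral_mkcond.
apply: eq_integral => s _; rewrite patchE.
case: ifPn => [|s0]; last first.
  rewrite (_ : ysection Z s = set0) ?measure0//; apply/seteqP; split => // x.
  rewrite /ysection /mkset in_setE /Z/= => -[s0' _]; move/negP: s0; apply.
  by rewrite in_setE /= in_itv/= s0'.
rewrite in_setE/= in_itv/= andbT => s0; congr (m _).
apply/seteqP; split => x; rewrite /ysection /mkset in_setE /Z/=; first by case.
by move=> ?.
Qed.

(** For fixed [x], the levels [s] exceeded by exactly one of [f x] and [g x] fill the interval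
    between the two values. Exchanging the integrals gives the coarea formula behind Cheeger's
    inequality. *)
Lemma integral_dist_level (f g : T -> R) :
  measurable_fun setT f -> measurable_fun setT g ->
  (\int[m]_x `|f x - g x|%:E =
   \int[mu]_s m ([set x | (g x <= s)%R && (s < f x)%R] `|`
                 [set x | (f x <= s)%R && (s < g x)%R]))%E.
Proof.
move=> mf mg.
pose U (f g : T -> R) := [set p : T * measurableTypeR R | g p.1 <= p.2] `&`
          [set p : T * measurableTypeR R | p.2 < f p.1].
have mU u v : measurable_fun setT u -> measurable_fun setT v -> measurable (U u v).
  move=> mu_ mv; apply: measurableI.
    apply: measurable_ler_set; last exact: measurable_snd.
    by apply: (measurableT_comp mv); exact: measurable_fst.
  apply: measurable_ltr_set; first exact: measurable_snd.
  by apply: (measurableT_comp mu_); exact: measurable_fst.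
pose Z := U f g `|` U g f.
have mZ : measurable Z by apply: measurableU; exact: mU.
transitivity (\int[m]_x mu (xsection Z x))%E.
  apply: eq_integral => x _.
  have -> : xsection Z x = `[Num.min (f x) (g x), Num.max (f x) (g x)[%classic.
    apply/seteqP; split => s.
      rewrite /xsection /mkset in_setE => -[] -[/= sl sr];
        by rewrite in_itv/= ge_min lt_max sl sr ?orbT.
    rewrite /xsection /mkset in_setE /= in_itv /=.
    by rewrite ge_min lt_max; have [fg|fg] := leP (f x) (g x) => /andP[/orP[]s1/orP[]s2];
      [right|right|right|right|left|left|left|left]; split => //; lra.
  rewrite lebesgue_measure_itv/= lte_fin.
  have [fg|fg] := leP (f x) (g x).
    rewrite ler0_norm ?subr_le0// opprB -EFinB.
    by case: ltP => // gf; congr EFin; lra.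
  by rewrite fg gtr0_norm ?subr_gt0// -EFinB.
rewrite (integral_xsection_ysection _ mZ).
apply: eq_integral => s _; congr (m _).
apply/seteqP; split => x; rewrite /ysection /mkset in_setE /Z/U/=.
  by case=> -[a b]; [left|right]; apply/andP.
by case=> /andP[a b]; [left|right].
Qed.

End layer_cake.

(** * The Brunn-Minkowski inequality *)

Section brunn_minkowski_1d.
Context {R : realType}.
Local Notation mu := (@lebesgue_measure R).
Variables (t : R) (t0 : 0 < t) (t1 : t < 1).

(* Cutting [X] just below its supremum and [Y] just above its infimum, the
   sets [(1 - t) X + t y] and [(1 - t) x + t Y] lie on both sides of
   [(1 - t) x + t y], so that no compactness is needed. *)
Lemma brunn_minkowski_1d (X Y Z : set R) : measurable X -> measurable Y ->
  measurable Z -> has_sup X -> has_inf Y ->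
  (forall x y, X x -> Y y -> Z ((1 - t) * x + t * y)) ->
  ((1 - t)%:E * mu X + t%:E * mu Y <= mu Z)%E.
Proof.
move=> mX mY mZ sX iY XYZ.
have t1' : 0 < 1 - t by rewrite subr_gt0.
apply/lee_addgt0Pr => e e0.
have [x Xx xs] := sup_adherent e0 sX.
have [y Yy ys] := inf_adherent e0 iY.
pose X1 := X `&` `]-oo, x[; pose Y1 := Y `&` `]y, +oo[.
have mX1 : measurable X1 by exact: measurableI.
have mY1 : measurable Y1 by exact: measurableI.
have muX : (mu X <= mu X1 + e%:E)%E.
  apply: (@le_trans _ _ (mu X1 + mu `[x, sup X])%E); last first.
    rewrite leeD2l// lebesgue_measure_itv/= lte_fin; case: ifPn => _.
      by rewrite -EFinB lee_fin; lra.
    by rewrite lee_fin ltW.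
  have mI : measurable (`[x, sup X]%classic : set (measurableTypeR R)) by exact: measurable_itv.
  apply: le_trans (measureU2 mu mX1 mI).
  apply: measure_le => //; first exact: (measurableU _ _ mX1 mI).
  move=> u Xu; have [ux|xu] := ltP u x; first by left; split => //=; rewrite in_itv.
  by right; rewrite /= in_itv/= xu/= ub_le_sup//; case: sX.
have muY : (mu Y <= mu Y1 + e%:E)%E.
  apply: (@le_trans _ _ (mu Y1 + mu `[inf Y, y])%E); last first.
    rewrite leeD2l// lebesgue_measure_itv/= lte_fin; case: ifPn => _.
      by rewrite -EFinB lee_fin; lra.
    by rewrite lee_fin ltW.
  have mI : measurable (`[inf Y, y]%classic : set (measurableTypeR R)) by exact: measurable_itv.
  apply: le_trans (measureU2 mu mY1 mI).
  apply: measure_le => //; first exact: (measurableU _ _ mY1 mI).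
  move=> u Yu; have [ux|xu] := ltP y u; first by left; split => //=; rewrite in_itv/= ux.
  by right; rewrite /= in_itv/= xu/= andbT ge_inf//; case: iY.
pose c := (1 - t) * x + t * y.
have mZ1 : measurable (Z `&` `]-oo, c[) by exact: measurableI.
have mZ2 : measurable (Z `&` `]c, +oo[) by exact: measurableI.
have maff (a b : R) (A : set R) : measurable A -> measurable ((fun z => a * z + b) @^-1` A : set R).
  move=> mA; rewrite -[X in measurable X]setTI.
  suff : measurable_fun setT (fun z : R => a * z + b) by exact.
  by apply: measurable_funD => //; exact: measurable_funM.
have X1Z : ((1 - t)%:E * mu X1 <= mu (Z `&` `]-oo, c[))%E.
  rewrite [leRHS](lebesgue_measure_affine (t * y) t1')// lee_pmul2l//=.
  apply: measure_le => //; first exact: maff.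
  move=> u [Xu]; rewrite /= !in_itv/= => ux; split; first exact: XYZ.
  by rewrite /c ltrD2r ltr_pM2l.
have Y1Z : (t%:E * mu Y1 <= mu (Z `&` `]c, +oo[))%E.
  rewrite [leRHS](lebesgue_measure_affine ((1 - t) * x) t0)// lee_pmul2l//=.
  apply: measure_le => //; first exact: maff.
  move=> u [Yu]; rewrite /= !in_itv/= !andbT => ux; split; first by rewrite addrC; exact: XYZ.
  by rewrite /c addrC ltrD2r ltr_pM2l.
have Zle : (mu (Z `&` `]-oo, c[) + mu (Z `&` `]c, +oo[) <= mu Z)%E.
  rewrite -measureU//; last first.
    apply/seteqP; split => // u [[_]]/= + [_]/=.
    by rewrite !in_itv/= andbT => uc cu; have := lt_trans uc cu; rewrite ltxx.
  by apply: measure_le => //; [exact: (measurableU _ _ mZ1 mZ2)|move=> u [[]|[]]].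
(* The two losses [e] carry the weights [1 - t] and [t], so that they add up to exactly [e]. *)
apply: (@le_trans _ _ ((1 - t)%:E * (mu X1 + e%:E) + t%:E * (mu Y1 + e%:E)))%E.
  by apply: leeD; rewrite lee_pmul2l.
rewrite !muleDr//; try by rewrite ge0_adde_def// inE ?measure_ge0 ?lee_fin ?ltW.
rewrite addeACA -!EFinM -EFinD -mulrDl subrK mul1r leeD2r//.
by apply: le_trans Zle; exact: leeD.
Qed.

(** Suprema equal to 1 make the superlevel sets of [f] and [g] nonempty at the same levels [s < 1].
    Since [s] equals [s ^ (1 - t) * s ^ t], their combinations lie in the superlevel set of [h]; the
    one-dimensional Brunn-Minkowski inequality is then integrated over [s]. *)
Lemma prekopa_leindler_1d_normalized (f g h : R -> R) :
  measurable_fun setT f -> measurable_fun setT g -> measurable_fun setT h ->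
  (forall x, 0 <= f x <= 1) -> (forall x, 0 <= g x <= 1) -> (forall x, 0 <= h x) ->
  (forall s, s < 1 -> exists x, s < f x) -> (forall s, s < 1 -> exists x, s < g x) ->
  (exists b, forall x, b < `|x| -> f x = 0 /\ g x = 0) ->
  (forall x y, f x `^ (1 - t) * g y `^ t <= h ((1 - t) * x + t * y)) ->
  ((1 - t)%:E * \int[mu]_x (f x)%:E + t%:E * \int[mu]_x (g x)%:E
    <= \int[mu]_x (h x)%:E)%E.
Proof.
move=> mf mg mh f01 g01 h0 f1 g1 [b fg0] fgh.
have t1' : 0 < 1 - t by rewrite subr_gt0.
have f0 x : 0 <= f x by have /andP[] := f01 x.
have g0 x : 0 <= g x by have /andP[] := g01 x.
have mlev (u : R -> R) s : measurable_fun setT u -> measurable [set x | s < u x].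
  by move=> mu_; exact: measurable_ltr_set.
have mlevel (u : R -> R) : measurable_fun setT u ->
    measurable_fun setT (fun s : R => mu [set x : R | s < u x]).
  move=> mu_.
  pose Z := [set p : measurableTypeR R * measurableTypeR R | p.2 < u p.1].
  have mZ : measurable Z.
    apply: measurable_ltr_set; first exact: measurable_snd.
    by apply: (measurableT_comp mu_); exact: measurable_fst.
  rewrite (_ : (fun s => _) = mu \o ysection Z); first exact: measurable_fun_ysection.
  apply/funext => s /=; congr (mu _); apply/seteqP.
  by split => x; rewrite /ysection /mkset in_setE.
rewrite !layer_cake//.
rewrite -!ge0_integralZl//; try (by exact: measurable_funTS (mlevel _ _));
  try by rewrite lee_fin ltW.
rewrite -ge0_integralD//; last 4 first.
- by move=> s _; rewrite mule_ge0// lee_fin ltW.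
- by apply: measurable_funeM; exact: measurable_funTS (mlevel _ _).
- by move=> s _; rewrite mule_ge0// lee_fin ltW.
- by apply: measurable_funeM; exact: measurable_funTS (mlevel _ _).
apply: ge0_le_integral => //.
- by move=> s _; rewrite adde_ge0// mule_ge0// lee_fin ltW.
- by apply: emeasurable_funD; apply: measurable_funeM; exact: measurable_funTS (mlevel _ _).
- exact: measurable_funTS (mlevel _ _).
move=> s /=; rewrite in_itv/= andbT => s0.
have [s1|s1] := ltP s 1; last first.
  have sub (u : R -> R) : (forall x, 0 <= u x <= 1) -> [set x | s < u x] = set0.
    move=> u01; apply/seteqP; split => // x /= sux.
    by have /andP[_] := u01 x; rewrite leNgt (le_lt_trans s1 sux).
  by rewrite (sub f)// (sub g)// !measure0 !mule0 adde0 measure_ge0.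
have bd (u : R -> R) : (forall x, b < `|x| -> u x = 0) ->
    forall x, s < u x -> `|x| <= b.
  by move=> ub x; apply: contraTT; rewrite -ltNge => /ub ->; rewrite -leNgt.
apply: brunn_minkowski_1d; [exact: mlev|exact: mlev|exact: mlev| | |].
- have [x sx] := f1 _ s1; split; first by exists x.
  exists b => y /= sy; apply: le_trans (ler_norm _) _.
  by apply: (bd f) sy => z /fg0[].
- have [x sx] := g1 _ s1; split; first by exists x.
  exists (- b) => y /= sy; rewrite lerNl; apply: le_trans (ler_norm _) _.
  by rewrite normrN; apply: (bd g) sy => z /fg0[].
move=> x y /= sx sy; apply: lt_le_trans (fgh x y).
have -> : s = s `^ (1 - t) * s `^ t.
  by rewrite -powRD ?subrK ?oner_eq0// powRr1.
apply: ltr_pM; rewrite ?powR_ge0//.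
  by rewrite gt0_ltr_powR// nnegrE// (le_trans s0)// ltW.
by rewrite gt0_ltr_powR// nnegrE// (le_trans s0)// ltW.
Qed.

End brunn_minkowski_1d.

Section tame.
Context {R : realType} d (T : measurableType d).
Variables (m : {measure set T -> \bar R}) (N : T -> R).

(** One constant bounds both the height and the support. Integrals are then finite, so that [fine]
    does not turn an infinite one into 0. *)
Definition tame (b : R) (f : T -> R) : Prop :=
  measurable_fun setT f /\
  forall x, 0 <= f x <= b /\ (b < N x -> f x = 0).

Lemma integral_tame_le b f (B : set T) (V : R) : tame b f -> measurable B ->
  (forall x, N x <= b -> B x) -> m B = V%:E ->
  (\int[m]_x (f x)%:E <= (b * V)%:E)%E.
Proof.
move=> [mf fb] mB NB mBV.
have b0 : 0 <= b by have [/andP[f0 fb0] _] := fb point; exact: le_trans fb0.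
apply: (@le_trans _ _ (\int[m]_x (b * \1_B x)%:E)%E).
  apply: ge0_le_integral => //.
  - by move=> x _; rewrite lee_fin; have [/andP[]] := fb x.
  - exact/measurable_EFinP.
  - by apply/measurable_EFinP; apply: measurable_funM => //; exact: measurable_indic.
  move=> x _; rewrite lee_fin; have [/andP[f0 fxb] fN] := fb x.
  have [Nx|/fN ->] := leP (N x) b; last by rewrite mulr_ge0.
  by rewrite indicE mem_set ?mulr1//; exact: NB.
under eq_integral do rewrite EFinM.
rewrite ge0_integralZl//; last by apply/measurable_EFinP; exact: measurable_indic.
by rewrite integral_indic// setIT mBV -EFinM.
Qed.

End tame.

(** * The Prekopa-Leindler inequality *)

Section prekopa_leindler.
Context {R : realType}.
Local Notation mu := (@lebesgue_measure R).
Local Notation normr1 := (fun x : R => `|x|).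
Variables (t : R) (t0 : 0 < t) (t1 : t < 1).

Let t1' : 0 < 1 - t. Proof. by rewrite subr_gt0. Qed.

Lemma powRV (a r : R) : 0 <= a -> a^-1 `^ r = (a `^ r)^-1.
Proof. by move=> a0; rewrite -powR_inv1// -powRrM mulN1r powRN. Qed.

(** Young's inequality for the conjugate exponents [(1 - t)^-1] and [t^-1]. *)
Lemma weighted_amgm (u v : R) : 0 <= u -> 0 <= v ->
  u `^ (1 - t) * v `^ t <= (1 - t) * u + t * v.
Proof.
move=> u0 v0.
have := @conjugate_powR R (u `^ (1 - t)) (v `^ t) (1 - t)^-1 t^-1.
rewrite !powR_ge0 !invr_gt0 !invrK subrK t1' t0 -!powRrM !mulfV ?gt_eqF// !powRr1//.
by rewrite mulrC [t * v]mulrC [(1 - t) * u]mulrC [v `^ t * _]mulrC; apply.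
Qed.

Lemma integral_tame1_le b (f : R -> R) : tame normr1 b f ->
  (\int[mu]_x (f x)%:E <= (b * (b + b))%:E)%E.
Proof.
move=> tf; have b0 : 0 <= b.
  by have [_ /(_ 0)[/andP[f0 fb0] _]] := tf; exact: le_trans fb0.
apply: (@integral_tame_le _ _ _ mu _ _ _ `[- b, b]%classic _ tf).
- exact: measurable_itv.
- by move=> x; rewrite ler_norml /= in_itv.
rewrite -[LHS]/(mu `[- b, b]%classic) lebesgue_measure_itv/= lte_fin; case: ifPn => [_|].
  by rewrite -EFinB opprK.
by rewrite -leNgt => bb; congr EFin; apply/eqP; rewrite eq_le; lra.
Qed.

(** Dividing [f] and [g] by their suprema and [h] by [c] reduces this to the normalized case, and
    [weighted_amgm] passes from the arithmetic to the geometric mean. If a supremum is 0, so is the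
    left-hand side. *)
Lemma prekopa_leindler_1d b (f g h : R -> R) :
  tame normr1 b f -> tame normr1 b g -> tame normr1 b h ->
  (forall x y, f x `^ (1 - t) * g y `^ t <= h ((1 - t) * x + t * y)) ->
  ((fine (\int[mu]_x (f x)%:E) `^ (1 - t) * fine (\int[mu]_x (g x)%:E) `^ t)%:E
    <= \int[mu]_x (h x)%:E)%E.
Proof.
move=> tf tg th fgh.
have ge0 u : tame normr1 b u -> forall x, 0 <= u x.
  by move=> [_ ub] x; have [/andP[]] := ub x.
have ih0 : (0 <= \int[mu]_x (h x)%:E)%E.
  by apply: integral_ge0 => x _; rewrite lee_fin (ge0 h).
pose S (u : R -> R) := sup (range u).
have supP u : tame normr1 b u -> has_sup (range u).
  move=> [_ ub]; split; first by exists (u 0), 0.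
  by exists b => _ [x _ <-]; have [/andP[]] := ub x.
have leS u x : tame normr1 b u -> u x <= S u.
  by move=> /supP[_ bu]; apply: ub_le_sup => //; exists x.
have S0 u : tame normr1 b u -> 0 <= S u.
  by move=> tu; apply: le_trans (leS _ 0 tu); exact: ge0.
have null u : tame normr1 b u -> S u = 0 -> fine (\int[mu]_x (u x)%:E) = 0.
  move=> tu Su; rewrite integral0_eq// => x _; congr EFin.
  by apply/eqP; rewrite eq_le (ge0 _ tu) andbT -Su leS.
have [Sf|Sf] := eqVneq (S f) 0.
  by rewrite (null f)// powR0 ?mul0r// gt_eqF.
have [Sg|Sg] := eqVneq (S g) 0.
  by rewrite (null g)// powR0 ?mulr0// gt_eqF.
have {}Sf : 0 < S f by rewrite lt_neqAle eq_sym Sf S0.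
have {}Sg : 0 < S g by rewrite lt_neqAle eq_sym Sg S0.
pose c := S f `^ (1 - t) * S g `^ t.
have c0 : 0 < c by rewrite mulr_gt0// powR_gt0.
have nrm u s : tame normr1 b u -> 0 < S u -> s < 1 -> exists x, s < u x / S u.
  move=> tu Su s1; have : 0 < S u * (1 - s) by rewrite mulr_gt0// subr_gt0.
  move/sup_adherent => /(_ _ (supP _ tu))[_ [x _ <-] sx]; exists x.
  by rewrite ltr_pdivlMr//; move: sx; rewrite -/(S u) mulrBr mulr1 opprB addrCA subrr addr0 mulrC.
have mdiv u a : tame normr1 b u -> measurable_fun setT (fun x => u x / a).
  by move=> [mu_ _]; apply: measurable_funM.
have int u a : 0 < a -> tame normr1 b u ->
    (\int[mu]_x (u x / a)%:E = (fine (\int[mu]_x (u x)%:E) / a)%:E)%E.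
  move=> a0 tu; under eq_integral do rewrite mulrC EFinM.
  rewrite ge0_integralZl//.
  - rewrite [in RHS]mulrC EFinM fineK// ge0_fin_numE.
      exact: le_lt_trans (integral_tame1_le tu) (ltry _).
    by apply: integral_ge0 => x _; rewrite lee_fin ge0.
  - by apply/measurable_EFinP; case: tu.
  - by move=> x _; rewrite lee_fin ge0.
  - by rewrite lee_fin invr_ge0 ltW.
have /= := @prekopa_leindler_1d_normalized R t t0 t1
  (fun x => f x / S f) (fun x => g x / S g) (fun x => h x / c).
rewrite !int// -!EFinM -EFinD lee_fin => PL.
rewrite -[leRHS]fineK; last first.
  by rewrite ge0_fin_numE// (le_lt_trans (integral_tame1_le th))// ltry.
rewrite lee_fin.
have : fine (\int[mu]_x (f x)%:E) `^ (1 - t) * fine (\int[mu]_x (g x)%:E) `^ t / c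
    <= fine (\int[mu]_x (h x)%:E) / c.
  apply: le_trans (PL _ _ _ _ _ _ _ _ _ _); [|exact: mdiv|exact: mdiv|exact: mdiv| | | | | | |].
  - have fin0 u : tame normr1 b u -> 0 <= fine (\int[mu]_x (u x)%:E).
      by move=> tu; apply: fine_ge0; apply: integral_ge0 => x _; rewrite lee_fin ge0.
    apply: le_trans (weighted_amgm _ _).
    + rewrite !powRM ?invr_ge0 ?fin0 ?(ltW Sf) ?(ltW Sg)//.
      by rewrite !powRV ?(ltW Sf) ?(ltW Sg)// mulrACA /c invfM.
    + by rewrite divr_ge0 ?fin0// ltW.
    + by rewrite divr_ge0 ?fin0// ltW.
  - move=> x; apply/andP; split; first by rewrite divr_ge0 ?(ge0 f)// ltW.
    by rewrite ler_pdivrMr// mul1r leS.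
  - move=> x; apply/andP; split; first by rewrite divr_ge0 ?(ge0 g)// ltW.
    by rewrite ler_pdivrMr// mul1r leS.
  - by move=> x; rewrite divr_ge0 ?(ge0 h)// ltW.
  - by move=> s s1; exact: nrm.
  - by move=> s s1; exact: nrm.
  - exists b => x bx; have [_ /(_ x)[_ ->//]] := tf; have [_ /(_ x)[_ ->//]] := tg.
    by rewrite !mul0r.
  - move=> x y.
    rewrite !powRM ?invr_ge0 ?(ge0 _ tf) ?(ge0 _ tg) ?(ltW Sf) ?(ltW Sg)//.
    rewrite !powRV ?(ltW Sf) ?(ltW Sg)// mulrACA -invfM.
    by rewrite ler_pM2r ?invr_gt0.
by rewrite ler_pM2r ?invr_gt0.
Qed.

Lemma integral_tame_rV_le n b (f : 'rV[R]_n -> R) :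
  tame (fun x : 'rV[R]_n => `|x|) b f ->
  (\int[lebesgue_rV n]_x (f x)%:E <= (b * ((b + 1) *+ 2) ^+ n)%:E)%E.
Proof.
move=> tf; have b0 : 0 <= b.
  by have [_ /(_ 0)[/andP[f0 fb0] _]] := tf; exact: le_trans fb0.
have b1 : 0 < b + 1 by rewrite ltr_wpDl.
apply: (@integral_tame_le _ _ _ (lebesgue_rV n) _ _ _ (ball 0 (b + 1)) _ tf).
- exact: ball_measurable_rV.
- by move=> x xb; rewrite -ball_normE /ball_/= sub0r normrN (le_lt_trans xb)// ltrDl.
- exact: lebesgue_rV_ball.
Qed.

Lemma integral_row_cons n (f : 'rV[R]_n.+1 -> \bar R) :
  measurable_fun setT f -> (forall x, 0 <= f x)%E ->
  (\int[lebesgue_rV n.+1]_x f x =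
   \int[mu]_a \int[lebesgue_rV n]_v f (row_cons (a, v)))%E.
Proof.
move=> mf f0.
have mfc : measurable_fun setT
    (f \o (@row_cons R n : measurableTypeR R * 'rV[R]_n -> 'rV[R]_n.+1)).
  by apply: (measurableT_comp mf); exact: measurable_row_cons.
transitivity (\int[mu \x lebesgue_rV n]_z
    (f \o (@row_cons R n : measurableTypeR R * 'rV[R]_n -> 'rV[R]_n.+1)) z)%E.
  transitivity (\int[pushforward (mu \x lebesgue_rV n)%E
      (@row_cons R n : measurableTypeR R * 'rV[R]_n -> 'rV[R]_n.+1)]_z f z)%E.
    by apply: eq_measure_integral => //; exact: measurable_row_cons.
  by rewrite ge0_integral_pushforward//; exact: measurable_row_cons.
by apply: fubini_tonelli1 => // x; exact: f0.
Qed.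

Lemma norm_row_cons n (a : R) (v : 'rV[R]_n) :
  `|a| <= `|row_cons (a, v)| /\ `|v| <= `|row_cons (a, v)|.
Proof.
split.
  by have := coord_ler_norm (row_cons (a, v)) ord0; rewrite mxE unlift_none.
apply: rV_norm_ler => // i.
by have := coord_ler_norm (row_cons (a, v)) (lift ord0 i); rewrite mxE liftK.
Qed.

(** Induction on the dimension: for fixed first coordinates [a1] and [a2], the induction hypothesis
    for the slices is the one-dimensional hypothesis for the slice integrals [F f], [F g] and
    [F h]. *)
Lemma prekopa_leindler n b (f g h : 'rV[R]_n -> R) :
  tame (fun x : 'rV[R]_n => `|x|) b f -> tame (fun x : 'rV[R]_n => `|x|) b g ->
  tame (fun x : 'rV[R]_n => `|x|) b h ->
  (forall x y, f x `^ (1 - t) * g y `^ t <= h ((1 - t) *: x + t *: y)) ->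
  ((fine (\int[lebesgue_rV n]_x (f x)%:E) `^ (1 - t) *
    fine (\int[lebesgue_rV n]_x (g x)%:E) `^ t)%:E
    <= \int[lebesgue_rV n]_x (h x)%:E)%E.
Proof.
elim: n b f g h => [|n IH] b f g h tf tg th fgh.
  have int0 u : tame (fun x : 'rV[R]_0 => `|x|) b u ->
      (\int[lebesgue_rV 0]_x (u x)%:E = (u 0)%:E)%E.
    move=> [mu_ _]; rewrite [LHS]integral_dirac//; last exact/measurable_EFinP.
    by rewrite diracT mul1e.
  rewrite !int0// lee_fin /=.
  by have := fgh 0 0; rewrite !scaler0 addr0.
pose N1 := fun x : 'rV[R]_n.+1 => `|x|; pose N0 := fun x : 'rV[R]_n => `|x|.
pose F (u : 'rV[R]_n.+1 -> R) (a : R) :=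
  fine (\int[lebesgue_rV n]_v (u (row_cons (a, v)))%:E).
have slice u a : tame N1 b u -> tame N0 b (fun v => u (row_cons (a, v))).
  move=> [mu_ ub]; split.
    apply: (measurableT_comp mu_).
    apply: (measurableT_comp (@measurable_row_cons R n)).
    exact: pair1_measurable.
  move=> v; have [u0b uN] := ub (row_cons (a, v)); split => // bv.
  by apply: uN; apply: lt_le_trans bv _; have [] := norm_row_cons a v.
(* A slice integral vanishes beyond [b] and is at most [b] times the volume of a cube of radius
   [b + 1]. *)
pose B := Num.max b (b * ((b + 1) *+ 2) ^+ n).
have u0 u x : tame N1 b u -> 0 <= u x by move=> [_ /(_ x)[/andP[]]].
have FE u a : tame N1 b u ->
    (\int[lebesgue_rV n]_v (u (row_cons (a, v)))%:E = (F u a)%:E)%E.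
  move=> tu; rewrite /F fineK// ge0_fin_numE.
    by apply: le_lt_trans (integral_tame_rV_le (slice u a tu)) (ltry _).
  by apply: integral_ge0 => v _; rewrite lee_fin u0.
have tF u : tame N1 b u -> tame normr1 B (F u).
  move=> tu; split.
    apply: (measurableT_comp (fine_measurable _)) => //.
    apply: (measurable_fun_fubini_tonelli_F
      (fun z : measurableTypeR R * 'rV[R]_n => (u (row_cons z))%:E)).
      apply/measurable_EFinP; case: tu => mu_ _.
      by apply: (measurableT_comp mu_); exact: measurable_row_cons.
    by move=> z; rewrite lee_fin u0.
  move=> a; split.
    rewrite -!lee_fin -FE// integral_ge0//=; last by move=> v _; rewrite lee_fin u0.
    apply: le_trans (integral_tame_rV_le (slice u a tu)) _.
    by rewrite lee_fin /B le_max lexx orbT.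
  move=> Ba; rewrite /F integral0_eq// => v _; congr EFin.
  have [_ /(_ (row_cons (a, v)))[_]] := tu; apply.
  apply: lt_le_trans (norm_row_cons a v).1; apply: le_lt_trans Ba.
  by rewrite /B le_max lexx.
have intF u : tame N1 b u ->
    (\int[lebesgue_rV n.+1]_x (u x)%:E = \int[mu]_a (F u a)%:E)%E.
  move=> tu; rewrite integral_row_cons.
  - by apply: eq_integral => a _; exact: FE.
  - by apply/measurable_EFinP; case: tu.
  - by move=> x; rewrite lee_fin u0.
rewrite !intF//; apply: (@prekopa_leindler_1d B); [exact: tF|exact: tF|exact: tF|].
move=> a1 a2; rewrite -lee_fin -FE//.
apply: (IH b); [exact: slice|exact: slice|exact: slice|].
move=> v1 v2; apply: le_trans (fgh _ _) _; rewrite le_eqVlt; apply/orP; left.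
apply/eqP; congr h; apply/rowP => j; rewrite !mxE.
by case: unliftP => [k _|_] /=; rewrite ?mxE.
Qed.

(** This is the case of indicator functions. The multiplicative form is free of the dimension: no
    [n]-th roots appear, and neither will they in the expansion estimate. *)
Lemma brunn_minkowski n (A B C : set 'rV[R]_n) (b : R) :
  measurable A -> measurable B -> measurable C ->
  (forall x, (A `|` B `|` C) x -> `|x| <= b) ->
  (forall x y, A x -> B y -> C ((1 - t) *: x + t *: y)) ->
  ((fine (lebesgue_rV n A) `^ (1 - t) * fine (lebesgue_rV n B) `^ t)%:E
    <= lebesgue_rV n C)%E.
Proof.
move=> mA mB mC bd ABC.
pose c := Num.max b 1.
have tI (X : set 'rV[R]_n) : measurable X -> (forall x, X x -> `|x| <= b) ->
    tame (fun x : 'rV[R]_n => `|x|) c (\1_X).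
  move=> mX Xb; split; first exact: measurable_indic.
  move=> x; rewrite indicE ler0n /c le_max lern1 leq_b1 orbT; split => //.
  rewrite gt_max => /andP[bx _]; rewrite memNset// => /Xb.
  by rewrite leNgt bx.
have := @prekopa_leindler n c (\1_A) (\1_B) (\1_C).
rewrite !integral_indic// !setIT; apply.
- by apply: tI => // x Ax; apply: bd; left; left.
- by apply: tI => // x Ax; apply: bd; left; right.
- by apply: tI => // x Ax; apply: bd; right.
move=> x y; rewrite !indicE.
have [|xA] := boolP (x \in A); last by rewrite powR0 ?mul0r ?ler0n// gt_eqF.
have [|yB] := boolP (y \in B); last by rewrite powR0 ?mulr0 ?ler0n// gt_eqF.
rewrite !in_setE => By Ax; rewrite mem_set ?powR1 ?mulr1//; exact: ABC.
Qed.

End prekopa_leindler.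

(** * The uniform distribution on a convex body *)

Section real_probability.
Context {R : realType} d (T : measurableType d) (P : probability T R).

Definition rprob (A : set T) : R := fine (P A).

Lemma rprobE A : measurable A -> P A = (rprob A)%:E.
Proof. by move=> mA; rewrite /rprob fineK// fin_num_measure. Qed.

Lemma rprob_ge0 A : 0 <= rprob A.
Proof. by apply: fine_ge0. Qed.

Lemma rprob_le A B : measurable A -> measurable B -> A `<=` B -> rprob A <= rprob B.
Proof. by move=> mA mB AB; rewrite -lee_fin -!rprobE//; exact: measure_le. Qed.

Lemma rprobT : rprob setT = 1.
Proof. by rewrite /rprob probability_setT. Qed.

Lemma rprob_le1 A : measurable A -> rprob A <= 1.
Proof. by move=> mA; rewrite -rprobT; apply: rprob_le. Qed.

Lemma rprobDI A B : measurable A -> measurable B ->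
  rprob A = rprob (A `&` B) + rprob (A `\` B).
Proof.
move=> mA mB; apply: EFin_inj; rewrite EFinD -!rprobE//.
- by rewrite addeC; exact: measureDI.
- exact: measurableD.
- exact: measurableI.
Qed.

Lemma rprobU_le A B : measurable A -> measurable B ->
  rprob (A `|` B) <= rprob A + rprob B.
Proof.
move=> mA mB; rewrite -lee_fin EFinD -!rprobE//; last exact: measurableU.
exact: measureU2.
Qed.

Lemma rprobU A B : measurable A -> measurable B -> A `&` B = set0 ->
  rprob (A `|` B) = rprob A + rprob B.
Proof.
move=> mA mB AB; apply: EFin_inj; rewrite EFinD -!rprobE//; last exact: measurableU.
exact: measureU.
Qed.

Lemma rprob_cover_le A B C : measurable A -> measurable B -> measurable C ->
  A `<=` B `|` C -> rprob A <= rprob B + rprob C.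
Proof.
move=> mA mB mC ABC; apply: le_trans (rprobU_le mB mC).
by apply: rprob_le => //; exact: measurableU.
Qed.

Lemma rprob_cover_sum_le n (A : set T) (B : 'I_n -> set T) : measurable A ->
  (forall i, measurable (B i)) -> (forall x, A x -> exists i, B i x) ->
  rprob A <= \sum_i rprob (B i).
Proof.
elim: n A B => [|n IH] A B mA mB AB.
  rewrite big_ord0 (_ : A = set0) ?/rprob ?measure0//.
  by apply/seteqP; split => // x /AB[[]].
rewrite big_ord_recl.
have mD : measurable (A `\` B ord0) by exact: measurableD.
apply: le_trans (rprob_cover_le mA (mB ord0) mD _) _.
  by move=> x Ax; have [|] := pselect (B ord0 x); [left|right].
rewrite lerD2l; apply: IH => // x [Ax nB0].
have [i] := AB _ Ax; case: (unliftP ord0 i) => [j ->|->//] Bj.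
by exists j.
Qed.

End real_probability.

Section convex_body_geometry.
Context {R : realType} (n : nat) (K : convex_body R n).
Local Notation KK := (convex_body_set K).
Local Notation pr := (rprob (unif K)).

Lemma convex_body_conv (x y : 'rV[R]_n) (t : R) : 0 <= t <= 1 ->
  KK x -> KK y -> KK ((1 - t) *: x + t *: y).
Proof.
move=> /andP[t0 t1] Kx Ky.
have := @convex_body_convex _ _ K y x (Itv01 t0 t1).
rewrite !in_setE => /(_ Ky Kx).
by rewrite addrC.
Qed.

Definition vol : R := fine (lebesgue_rV n KK).

Lemma lebesgue_rV_convex_bodyE : lebesgue_rV n KK = vol%:E.
Proof.
rewrite /vol fineK// ge0_fin_numE//.
exact: lebesgue_rV_convex_body_lty.
Qed.

Lemma vol_gt0 : 0 < vol.
Proof. by rewrite -lte_fin -lebesgue_rV_convex_bodyE; exact: lebesgue_rV_convex_body_gt0. Qed.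

Lemma lebesgue_rprob (A : set 'rV[R]_n) : measurable A ->
  lebesgue_rV n (A `&` KK) = (pr A * vol)%:E.
Proof.
move=> mA; rewrite EFinM -rprobE//; rewrite [X in (X * _)%E]unifE -/vol -muleA -EFinM.
by rewrite mulVf ?mule1// gt_eqF// vol_gt0.
Qed.

Lemma rprob_convex_body : pr KK = 1.
Proof.
have := lebesgue_rprob (measurable_convex_body K).
rewrite setIid lebesgue_rV_convex_bodyE => -[/eqP]; rewrite eq_sym.
by rewrite -subr_eq0 -{2}[vol]mul1r -mulrBl mulf_eq0 subr_eq0 (gt_eqF vol_gt0) orbF => /eqP.
Qed.

Lemma rprob_setI_body (A : set 'rV[R]_n) : measurable A -> pr (A `&` KK) = pr A.
Proof.
move=> mA; have mAK := measurableI _ _ mA (measurable_convex_body K).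
have := lebesgue_rprob mAK; rewrite -setIA setIid lebesgue_rprob// => -[/eqP].
by rewrite -subr_eq0 -mulrBl mulf_eq0 subr_eq0 (gt_eqF vol_gt0) orbF => /eqP.
Qed.

(** The map sends the points of [U] in [K] into [K] and has Jacobian [\prod_j d j], which is at
    least [q ^ n]. This transports mass estimates along contractions, translations and their
    hybrids. *)
Lemma rprob_affine_le (d c : 'I_n -> R) (q : R) (U A : set 'rV[R]_n) :
  0 < q -> (forall j, q <= d j) ->
  measurable U -> measurable A -> (forall x, U x -> KK x -> KK (diag_affine d c x)) ->
  pr (U `&` diag_affine d c @^-1` A) <= q ^- n * pr A.
Proof.
move=> q0 qd mU mA UK.
have d0 j : 0 < d j by exact: lt_le_trans (qd j).
have mAK := measurableI _ _ mA (measurable_convex_body K).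
have mpre B : measurable B -> measurable (diag_affine d c @^-1` B).
  by move=> mB; rewrite -[X in measurable X]setTI; exact: measurable_diag_affine.
have mUA : measurable (U `&` diag_affine d c @^-1` A).
  by apply: measurableI => //; exact: mpre.
have le1 : (lebesgue_rV n (U `&` diag_affine d c @^-1` A `&` KK) <=
    lebesgue_rV n (diag_affine d c @^-1` (A `&` KK)))%E.
  apply: measure_le; [|exact: mpre|].
    by apply: measurableI => //; exact: measurable_convex_body.
  by move=> x [[Ux Ax] Kx]; split => //; exact: UK.
have AE := etrans (esym (lebesgue_rprob mA)) (lebesgue_rV_diag_affine c d0 mAK).
have p0 : 0 < \prod_j d j by exact: prodr_gt0.
have qn : q ^+ n <= \prod_j d j.
  rewrite -[X in q ^+ X]card_ord -prodr_const; apply: ler_prod => j _.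
  by rewrite (ltW q0)/=.
move: le1 AE; rewrite (lebesgue_rprob mUA).
case: (lebesgue_rV n (diag_affine d c @^-1` (A `&` KK))) => [l| |] //; last first.
  by rewrite gt0_muley ?lte_fin.
rewrite -EFinM lee_fin => le1 [AE].
rewrite mulrC ler_pdivlMr ?exprn_gt0// -(ler_pM2r vol_gt0) AE.
rewrite mulrAC mulrC; apply: ler_pM => //.
- by rewrite exprn_ge0// ltW.
- by rewrite mulr_ge0 ?rprob_ge0// ltW// vol_gt0.
Qed.

End convex_body_geometry.

(** * Homothetic copies of the body *)

Section homothetic_copies.
Context {R : realType} (n : nat) (K : convex_body R n).
Local Notation KK := (convex_body_set K).
Local Notation pr := (rprob (unif K)).
Variables (x0 : 'rV[R]_n) (r : R).
Hypothesis r0 : 0 < r.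
Hypothesis ballK : forall w : 'rV[R]_n, `|w| <= r -> KK (x0 + w).

Definition homothety (s : R) (x : 'rV[R]_n) : 'rV[R]_n := x0 + s *: (x - x0).

(** The copy of [K] scaled by [s] around [x0], as a preimage: membership then concerns a single
    point of [K], and measurability is inherited. *)
Definition homothetic (s : R) : set 'rV[R]_n := homothety s^-1 @^-1` KK.

Lemma homothetyM s s' x : homothety s (homothety s' x) = homothety (s * s') x.
Proof. by rewrite /homothety addrAC subrr add0r scalerA. Qed.

Lemma homothety1 x : homothety 1 x = x.
Proof. by rewrite /homothety scale1r addrC subrK. Qed.

Lemma homothetyE s x : homothety s x =
  diag_affine (fun=> s) (fun j => ((1 - s) *: x0) 0 j) x.
Proof.
by apply/rowP => j; rewrite !mxE; ring.
Qed.

Lemma measurable_homothetic s : measurable (homothetic s).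
Proof.
rewrite -[X in measurable X]setTI.
rewrite /homothetic (_ : homothety _ = diag_affine (fun=> s^-1)
  (fun j => ((1 - s^-1) *: x0) 0 j)); last by apply/funext => x; exact: homothetyE.
by apply: measurable_diag_affine => //; exact: measurable_convex_body.
Qed.

Lemma homothetic1 : homothetic 1 = KK.
Proof. by apply/seteqP; split => x; rewrite /homothetic /= invr1 homothety1. Qed.

Lemma homothetic_homothety s a x : 0 < a ->
  homothetic s (homothety a x) = homothetic (s / a) x.
Proof. by move=> a0; rewrite /homothetic /= homothetyM invf_div mulrC. Qed.

(* [x + w] is, seen from [x0], a convex combination of a point of [K] and of a
   point of the cube of radius [r], rescaled by [s + a]. *)
Lemma homothetic_add s a x w : 0 < s -> 0 < a -> homothetic s x -> `|w| <= a * r ->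
  homothetic (s + a) (x + w).
Proof.
move=> s0 a0 sx wa; have sa0 : 0 < s + a by rewrite addr_gt0.
rewrite /homothetic /=.
have Kw : KK (x0 + a^-1 *: w).
  by apply: ballK; rewrite normrZ gtr0_norm ?invr_gt0// ler_pdivrMl.
have t01 : 0 <= a / (s + a) <= 1.
  by apply/andP; split; [rewrite divr_ge0// ltW|rewrite ler_pdivrMr// mul1r lerDr ltW].
have := convex_body_conv t01 sx Kw.
congr KK; apply/rowP => j; rewrite /homothety !mxE.
by field; rewrite !gt_eqF.
Qed.

Lemma homothetic_le s s' x : 0 < s -> s <= s' -> homothetic s x -> homothetic s' x.
Proof.
move=> s0; rewrite le_eqVlt => /predU1P[->//|ss'] sx.
have s's : 0 < s' - s by rewrite subr_gt0.
have w0 : `|0 : 'rV[R]_n| <= (s' - s) * r by rewrite normr0 mulr_ge0// ltW.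
by have := homothetic_add s0 s's sx w0; rewrite addr0 addrCA subrr addr0.
Qed.

Lemma homothetic_sub s x : 0 < s -> s <= 1 -> homothetic s x -> KK x.
Proof. by move=> s0 s1 /(homothetic_le s0 s1); rewrite homothetic1. Qed.

Lemma rprob_homothetic s : 0 < s -> s <= 1 -> pr (homothetic s) = s ^+ n.
Proof.
move=> s0 s1.
have := lebesgue_rV_diag_affine (d := fun=> s^-1) (fun j => ((1 - s^-1) *: x0) 0 j) _ (measurable_convex_body K).
rewrite invr_gt0 => /(_ (fun=> s0)).
rewrite (_ : diag_affine _ _ = homothety s^-1); last first.
  by apply/funext => x; rewrite homothetyE.
rewrite -/(homothetic s) prodr_const card_ord lebesgue_rV_convex_bodyE.
have -> : homothetic s = homothetic s `&` KK.
  by apply/seteqP; split => x; [move=> sx; split => //; exact: homothetic_sub sx|case].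
rewrite lebesgue_rprob; last exact: measurable_homothetic.
rewrite rprob_setI_body; last exact: measurable_homothetic.
rewrite -EFinM => -[]; rewrite mulrA => /eqP.
rewrite -{1}[vol K]mul1r -subr_eq0 -mulrBl mulf_eq0 (gt_eqF (vol_gt0 K)) orbF subr_eq0.
move=> /eqP H; rewrite -[RHS]mulr1 H mulrA exprVn mulfV ?mul1r//.
by rewrite gt_eqF// exprn_gt0.
Qed.

(** Bernoulli's inequality for the mass [(1 - u) ^ n] of the inner copy. *)
Lemma rprob_boundary_le u : 0 < u -> u < 1 -> pr (~` homothetic (1 - u)) <= n%:R * u.
Proof.
move=> u0 u1; have mh := measurable_homothetic (1 - u).
have mhC : measurable (~` homothetic (1 - u)) by exact: measurableC.
have : pr (homothetic (1 - u) `|` ~` homothetic (1 - u)) = 1.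
  by rewrite setUv rprobT.
rewrite rprobU ?setICr// rprob_homothetic ?subr_gt0//; last by rewrite lerBlDl lerDr ltW.
have bern : 1 - n%:R * u <= (1 - u) ^+ n.
  elim: (n) => [|k IH]; first by rewrite mul0r subr0 expr0.
  rewrite exprS; apply: le_trans (_ : (1 - u) * (1 - k%:R * u) <= _); last first.
    by rewrite ler_pM2l ?subr_gt0.
  rewrite -natr1 mulrBl mulrBr !mul1r.
  have : 0 <= k%:R * u * u by rewrite !mulr_ge0// ltW.
  lra.
lra.
Qed.

End homothetic_copies.

Lemma bernoulli_le (R : realDomainType) n (u : R) : 0 <= u <= 1 ->
  1 - n%:R * u <= (1 - u) ^+ n.
Proof.
move=> /andP[u0 u1]; elim: n => [|k IH]; first by rewrite mul0r subr0 expr0.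
rewrite exprS; apply: (@le_trans _ _ ((1 - u) * (1 - k%:R * u))); last first.
  by rewrite ler_wpM2l// subr_ge0.
rewrite -natr1 mulrBl mulrBr !mul1r mulrDl mul1r.
have : 0 <= k%:R * u * u by rewrite !mulr_ge0.
lra.
Qed.

(** * Isoperimetry along coordinate lines *)

Section line_separated.
Context {R : realType} (n : nat) (K : convex_body R n).
Local Notation KK := (convex_body_set K).
Local Notation pr := (rprob (unif K)).

Definition line_separated (S : set 'rV[R]_n) (G : 'I_n -> set 'rV[R]_n) :=
  forall i (x y : 'rV[R]_n), KK x -> KK y -> (forall j, j != i -> x 0 j = y 0 j) ->
    S x -> ~ S y -> G i x \/ G i y.

Lemma line_separatedC S G : line_separated S G -> line_separated (~` S) G.
Proof.
move=> sep i x y Kx Ky xy nSx /contrapT Sy.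
by have [j ji||] := sep i y x Ky Kx _ Sy nSx; [rewrite xy|right|left].
Qed.

(** The [k]-th corner of the path from [a] to [b] that changes one coordinate at a time: the corners
    [k] and [k + 1] differ at most in coordinate [k]. *)
Definition hybrid (k : nat) (a b : 'rV[R]_n) : 'rV[R]_n :=
  \row_j if (j < k)%N then b 0 j else a 0 j.

Lemma hybrid0 a b : hybrid 0 a b = a.
Proof. by apply/rowP => j; rewrite mxE ltn0. Qed.

Lemma hybridn a b : hybrid n a b = b.
Proof. by apply/rowP => j; rewrite mxE ltn_ord. Qed.

Lemma hybridB_norm k a b : `|hybrid k a b - a| <= `|b - a|.
Proof.
apply: rV_norm_ler => // j; rewrite !mxE; case: ifP => _; last by rewrite subrr normr0.
by have := coord_ler_norm (b - a) j; rewrite !mxE.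
Qed.

Lemma hybrid_diag_affine k d c d' c' (x : 'rV[R]_n) :
  hybrid k (diag_affine d c x) (diag_affine d' c' x) =
  diag_affine (fun j : 'I_n => if (j < k)%N then d' j else d j)
    (fun j : 'I_n => if (j < k)%N then c' j else c j) x.
Proof. by apply/rowP => j; rewrite !mxE; case: ifP. Qed.

(** A discrete intermediate value argument: a path that starts in [S] and ends outside leaves [S] in
    one of its steps. *)
Lemma hybrid_separated S G a b : line_separated S G ->
  (forall k, (k <= n)%N -> KK (hybrid k a b)) -> S a -> ~ S b ->
  exists i : 'I_n, G i (hybrid i a b) \/ G i (hybrid i.+1 a b).
Proof.
move=> sep Kh Sa nSb; apply: contrapT => nG.
have Sh k : (k <= n)%N -> S (hybrid k a b).
  elim: k => [_|k IH kn]; first by rewrite hybrid0.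
  apply: contrapT => nS; apply: nG; exists (Ordinal kn).
  apply: sep (IH (ltnW kn)) nS; [exact: Kh (ltnW kn)|exact: Kh kn|].
  move=> j; rewrite -val_eqE /= => jk; rewrite !mxE ltnS [in RHS]leq_eqVlt.
  by rewrite (negbTE jk).
by apply: nSb; rewrite -(hybridn a b); exact: Sh.
Qed.

Lemma measurable_preimage_diag_affine d c (A : set 'rV[R]_n) :
  measurable A -> measurable (diag_affine d c @^-1` A).
Proof.
by move=> mA; rewrite -[X in measurable X]setTI; exact: measurable_diag_affine.
Qed.

Variables (S : set 'rV[R]_n) (G : 'I_n -> set 'rV[R]_n).
Hypotheses (mS : measurable S) (mG : forall i, measurable (G i)).
Hypothesis sepS : line_separated S G.

(* Replacing the coordinates of one affine image of [x] by those of the other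
   one at a time, some step along a coordinate line crosses the boundary of [S]. *)
Lemma rprob_affine_separated (d c d' c' : 'I_n -> R) (q : R) (U V : set 'rV[R]_n) :
  0 < q -> (forall j, q <= d j) -> (forall j, q <= d' j) ->
  measurable U -> measurable V ->
  (forall x k, KK x -> U x -> (k <= n)%N ->
    (KK `&` V) (hybrid k (diag_affine d c x) (diag_affine d' c' x))) ->
  pr (U `&` [set x | S (diag_affine d c x) /\ ~ S (diag_affine d' c' x)])
    <= 2 * q ^- n * \sum_i pr (G i `&` V).
Proof.
move=> q0 qd qd' mU mV UV.
pose dd k (j : 'I_n) := if (j < k)%N then d' j else d j.
pose cc k (j : 'I_n) := if (j < k)%N then c' j else c j.
pose B k i := (U `&` KK) `&` diag_affine (dd k) (cc k) @^-1` (G i `&` V).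
have mK := measurable_convex_body K.
have mGV i : measurable (G i `&` V) by exact: measurableI.
have mB k i : measurable (B k i).
  apply: measurableI; first exact: measurableI.
  exact: measurable_preimage_diag_affine.
have prB k i : (k <= n)%N -> pr (B k i) <= q ^- n * pr (G i `&` V).
  move=> kn; apply: rprob_affine_le => //.
  - by move=> j; rewrite /dd; case: ifP.
  - exact: measurableI.
  - by move=> x [Ux Kx] _; have [] := UV x k Kx Ux kn; rewrite hybrid_diag_affine.
have mX : measurable (U `&` [set x | S (diag_affine d c x) /\ ~ S (diag_affine d' c' x)]).
  apply: measurableI => //.
  have -> : [set x | S (diag_affine d c x) /\ ~ S (diag_affine d' c' x)] =
      diag_affine d c @^-1` S `&` diag_affine d' c' @^-1` (~` S) by [].
  by apply: measurableI; apply: measurable_preimage_diag_affine => //; exact: measurableC.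
rewrite -rprob_setI_body//.
(* Step [i] runs from corner [i] to corner [i + 1], and either end may be the one in [G i]: hence
   the factor 2. *)
apply: (@le_trans _ _ (\sum_(i < n) pr (B i i `|` B i.+1 i))); last first.
  rewrite mulr_sumr; apply: ler_sum => i _; apply: le_trans (rprobU_le _ _ _) _ => //.
  rewrite -mulrA mulr_natl mulr2n; apply: lerD; apply: prB => //.
  exact: ltnW.
apply: rprob_cover_sum_le.
- exact: measurableI.
- by move=> i; exact: measurableU.
- move=> x [[Ux [Sa Sb]] Kx].
  have [k kn|i] := hybrid_separated sepS _ Sa Sb; first by have [] := UV x k Kx Ux kn.
  move=> Gi; exists i; case: Gi => Gi.
    left; split; first by [].
    have [_ Vi] := UV x i Kx Ux (ltnW (ltn_ord i)).
    by split; rewrite /= -hybrid_diag_affine.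
  right; split; first by [].
  have [_ Vi] := UV x i.+1 Kx Ux (ltn_ord i).
  by split; rewrite /= -hybrid_diag_affine.
Qed.

End line_separated.

(** * Shells near the boundary *)

Section radial.
Context {R : realType} (n : nat) (K : convex_body R n).
Local Notation KK := (convex_body_set K).
Local Notation pr := (rprob (unif K)).
Hypothesis n0 : (0 < n)%N.
Variables (x0 : 'rV[R]_n) (r rho : R).
Hypothesis r0 : 0 < r.
Hypothesis ballK : forall w : 'rV[R]_n, `|w| <= r -> KK (x0 + w).
Hypothesis distK : forall x, KK x -> `|x - x0| <= n%:R * rho.
Variables (S : set 'rV[R]_n) (G : 'I_n -> set 'rV[R]_n).
Hypotheses (mS : measurable S) (mG : forall i, measurable (G i)).
Hypothesis sepS : line_separated K S G.
Variable m : nat.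
Hypothesis mr : 16 * (n%:R * rho) <= m%:R * r.

Local Notation H := (homothetic K x0).
Local Notation D := (homothety x0).

Let mH s : measurable (H s). Proof. exact: measurable_homothetic. Qed.

Let nR0 : 0 < n%:R :> R. Proof. by rewrite ltr0n. Qed.

Let m0 : 0 < m%:R :> R.
Proof.
have nr0 : 0 <= n%:R * rho.
  apply: le_trans (distK (_ : KK x0)); first exact: normr_ge0.
  by rewrite -[x0]addr0; apply: ballK; rewrite normr0 ltW.
(* With [m = 0] the hypothesis [mr] gives [n * rho <= 0], so [K] would be a point, although it
   contains a cube of radius [r]. *)
rewrite ltr0n lt0n; apply/negP => /eqP mz.
have K0 (w : 'rV[R]_n) : `|w| <= r -> `|w| <= 0.
  move=> /ballK/distK; rewrite [x0 + w]addrC addrK.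
  by move: mr; rewrite mz mul0r; lra.
have nE : `|const_mx r : 'rV[R]_n| = r by apply: rV_norm_const => //; exact: ltW.
have := K0 (const_mx r); rewrite nE lexx => /(_ isT).
by rewrite leNgt r0.
Qed.

(** With the ratio 4, the shells of [u] and [4 * u] are adjacent, and the latter, between depths
    [4 * u] and [16 * u], has room for two disjoint images of the former. *)
Definition shell (u : R) : set 'rV[R]_n := H (1 - u) `\` H (1 - 4 * u).

(** A contraction by a factor between [1 - 8 * u] and 1 takes the shell into [H (1 - u)] and outside
    [H (1 - 12 * u)]; the rest is the margin for the corners of the coordinate paths. *)
Definition wide_shell (u : R) : set 'rV[R]_n := H (1 - u / 2) `\` H (1 - 13 * u).

Lemma measurable_shell u : measurable (shell u).
Proof. exact: measurableD. Qed.

Lemma measurable_wide_shell u : measurable (wide_shell u).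
Proof. exact: measurableD. Qed.

Section one_shell.
Variable u : R.
Hypotheses (u0 : 0 < u) (un : 32 * n%:R * u <= 1).

Let u32 : 32 * u <= 1.
Proof.
apply: le_trans un; rewrite ler_pM2r//.
by have : 1 <= n%:R :> R; [rewrite ler1n|lra].
Qed.

(** The condition [32 * n * u <= 1] makes the Jacobian at least [1 - 8 * n * u >= 3 / 4]. That
    [4 / 3] is less than 2 is what lets two disjoint images win. *)
Lemma shrink_factor : (1 - 8 * u) ^- n <= 4 / 3.
Proof.
have b : 1 - n%:R * (8 * u) <= (1 - 8 * u) ^+ n by apply: bernoulli_le; have := u0; have := u32; lra.
have q : 3 / 4 <= (1 - 8 * u) ^+ n by apply: le_trans b; have := un; lra.
have q0 : 0 < (1 - 8 * u) ^+ n by apply: lt_le_trans q; lra.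
by rewrite -[leRHS]invrK lef_pV2 ?posrE//; apply: le_trans q; lra.
Qed.

Lemma shell_step x a w : shell u x -> 0 <= a <= 8 * u -> `|w| <= u / 2 * r ->
  (KK `&` wide_shell u) (D (1 - a) x + w).
Proof.
move=> [xu x4u] /andP[a0 a8] wu; have := u32; have := u0 => u0' u32'.
have ap : 0 < 1 - a by lra.
have wide : H (1 - u / 2) (D (1 - a) x + w).
  have -> : 1 - u / 2 = (1 - u) + u / 2 by field.
  apply: (homothetic_add ballK) => //; [lra|lra|].
  rewrite homothetic_homothety//; apply: (homothetic_le r0 ballK) xu; first lra.
  by rewrite ler_pdivlMr//; nra.
split.
  by apply: (homothetic_sub r0 ballK) wide; lra.
split=> // bad; apply: x4u.
have : H (1 - 12 * u) (D (1 - a) x).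
  have := homothetic_add ballK _ (_ : 0 < u / 2) bad (w := - w).
  rewrite normrN addrK => /(_ _ _ wu) h.
  by apply: (homothetic_le r0 ballK) (h _ _); lra.
rewrite homothetic_homothety//; apply: (homothetic_le r0 ballK).
  by rewrite divr_gt0//; lra.
by rewrite ler_pdivrMr//; nra.
Qed.

(** The contraction may move a point by [8 * u * (n * rho)], while the margin at this depth is only
    of order [u * r]. It is therefore cut into [m] contractions, each moving points by at most
    [u / 2 * r] by the choice of [m]; one of them crosses the boundary of [S]. The constant is
    [2 * (4 / 3)]. *)
Lemma radial_chain theta : 0 < theta <= 8 * u ->
  pr (shell u `&` [set x | S x /\ ~ S (D (1 - theta) x)]) <=
  m%:R * (8 / 3 * \sum_i pr (G i `&` wide_shell u)).
Proof.
move=> /andP[th0 th8].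
have mgt0 : (0 < m)%N by move: m0; rewrite ltr0n.
pose a (k : nat) := theta * (k%:R / m%:R).
have a0 : a 0 = 0 by rewrite /a mul0r mulr0.
have am : a m = theta by rewrite /a divff ?mulr1// gt_eqF.
have ab k : (k <= m)%N -> 0 <= a k <= 8 * u.
  move=> km; have : 0 <= (k%:R / m%:R : R) <= 1.
    by apply/andP; split; [rewrite divr_ge0|rewrite ler_pdivrMr// mul1r ler_nat].
  by rewrite /a => /andP[? ?]; apply/andP; split; nra.
pose B (k : 'I_m) := shell u `&` [set x | S (D (1 - a k) x) /\ ~ S (D (1 - a k.+1) x)].
have DE s : D s = diag_affine (fun=> s) (fun j => ((1 - s) *: x0) 0 j).
  by apply/funext => x; exact: homothetyE.
have mD s A : measurable A -> measurable (D s @^-1` A).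
  by move=> mA; rewrite DE; exact: measurable_preimage_diag_affine.
have m2 s s' : measurable [set x | S (D s x) /\ ~ S (D s' x)].
  have -> : [set x | S (D s x) /\ ~ S (D s' x)] = D s @^-1` S `&` D s' @^-1` (~` S) by [].
  by apply: measurableI; apply: mD => //; exact: measurableC.
have mB k : measurable (B k) by apply: measurableI => //; exact: measurable_shell.
apply: (@le_trans _ _ (\sum_(k < m) pr (B k))).
  apply: rprob_cover_sum_le => //.
    apply: measurableI; first exact: measurable_shell.
    have := m2 1 (1 - theta); congr measurable; apply/seteqP.
    by split => x /=; rewrite homothety1.
  move=> x [Ux [Sx nSx]]; apply: contrapT => nB.
  have Sk k : (k <= m)%N -> S (D (1 - a k) x).
    elim: k => [_|k IH km]; first by rewrite a0 subr0 homothety1.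
    apply: contrapT => nS; apply: nB; exists (Ordinal km).
    by split => //=; split => //; apply: IH; exact: ltnW.
  by apply: nSx; rewrite -am; exact: Sk.
rewrite [leRHS]mulrC mulr_natr -[X in _ *+ X]card_ord -sumr_const.
apply: ler_sum => k _; rewrite /B !DE.
apply: le_trans (_ : 2 * (1 - 8 * u) ^- n * \sum_i pr (G i `&` wide_shell u) <= _); last first.
  apply: ler_wpM2r; last by have := shrink_factor; lra.
  by apply: sumr_ge0 => i _; exact: rprob_ge0.
have /andP[ak0 ak8] := ab k (ltnW (ltn_ord k)).
have /andP[ak0' ak8'] := ab k.+1 (ltn_ord k).
apply: rprob_affine_separated => //.
- by have := u32; have := u0; lra.
- by move=> _; lra.
- by move=> _; lra.
- exact: measurable_shell.
- exact: measurable_wide_shell.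
move=> x l Kx Ux ln; rewrite -!homothetyE -[hybrid _ _ _](subrK (D (1 - a k) x)) addrC.
apply: shell_step => //; first exact/andP.
apply: le_trans (hybridB_norm _ _ _) _.
have -> : D (1 - a k.+1) x - D (1 - a k) x = (a k - a k.+1) *: (x - x0).
  by apply/rowP => j; rewrite /homothety !mxE; ring.
have -> : a k - a k.+1 = - (theta / m%:R) by rewrite /a -natr1; field; rewrite gt_eqF.
rewrite normrZ normrN gtr0_norm ?divr_gt0//.
have := distK Kx; have := normr_ge0 (x - x0) => d0 dle.
rewrite mulrAC ler_pdivrMr//.
have := mr; have := u0 => u0' mr'.
have : theta * `|x - x0| <= 8 * u * (n%:R * rho) by apply: ler_pM => //; exact: ltW.
nra.
Qed.

(* The contractions by [1 - 4u] and [1 - 8u] send the shell to two disjoint parts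
   of the next shell inside, whence the factor [2/3 = (4/3)/2]. *)
Lemma radial_shell :
  pr (S `&` shell u) <= 2 / 3 * pr (S `&` shell (4 * u)) +
    3 * m%:R * \sum_i pr (G i `&` wide_shell u).
Proof.
have := u32; have := u0 => u0' u32'.
set W := \sum_i _.
have W0 : 0 <= W by apply: sumr_ge0 => i _; exact: rprob_ge0.
pose W1 := H (1 - 4 * u) `\` H (1 - 8 * u).
pose W2 := H (1 - 8 * u) `\` H (1 - 16 * u).
have mW1 : measurable W1 by exact: measurableD.
have mW2 : measurable W2 by exact: measurableD.
have mU := measurable_shell u.
have DE s : D s = diag_affine (fun=> s) (fun j => ((1 - s) *: x0) 0 j).
  by apply/funext => x; exact: homothetyE.
(* Either the contraction takes the point out of [S], which [radial_chain] bounds, or the image is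
   in [S] and in [A], and volumes shrink by no less than [3 / 4]. *)
have main theta A : measurable A -> 0 < theta <= 8 * u ->
    (forall x, shell u x -> A (D (1 - theta) x)) ->
    pr (S `&` shell u) <= m%:R * (8 / 3 * W) + 4 / 3 * pr (S `&` A).
  move=> mA th UA; have /andP[th0 th8] := th.
  have mSA : measurable (S `&` A) by exact: measurableI.
  have mD B : measurable B -> measurable (D (1 - theta) @^-1` B).
    by move=> mB; rewrite DE; exact: measurable_preimage_diag_affine.
  pose B1 := shell u `&` [set x | S x /\ ~ S (D (1 - theta) x)].
  pose C1 := shell u `&` D (1 - theta) @^-1` (S `&` A).
  have mB1 : measurable B1.
    have -> : B1 = shell u `&` (S `&` D (1 - theta) @^-1` (~` S)) by [].
    by apply: measurableI => //; apply: measurableI => //; apply: mD; exact: measurableC.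
  have mC1 : measurable C1 by apply: measurableI => //; exact: mD.
  apply: (@le_trans _ _ (pr B1 + pr C1)).
    apply: rprob_cover_le => //; first exact: measurableI.
    move=> x [Sx Ux]; have [SD|nSD] := pselect (S (D (1 - theta) x)); last by left.
    by right; split => //; split => //; exact: UA.
  apply: lerD; first exact: radial_chain.
  apply: (@le_trans _ _ ((1 - 8 * u) ^- n * pr (S `&` A))); last first.
    by apply: ler_wpM2r; [exact: rprob_ge0|exact: shrink_factor].
  rewrite /C1 DE; apply: rprob_affine_le => //; first lra.
  - by move=> _; lra.
  - move=> x Ux Kx; rewrite -homothetyE -[D _ _]addr0.
    have [] := @shell_step x theta 0 Ux _ _ => //.
      by apply/andP; split => //; exact: ltW.
    by rewrite normr0 mulr_ge0 ?divr_ge0// ltW.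
have h1 : pr (S `&` shell u) <= m%:R * (8 / 3 * W) + 4 / 3 * pr (S `&` W1).
  apply: (main (4 * u)) => //; first by apply/andP; split; lra.
  move=> x [xu x4u]; split.
    rewrite homothetic_homothety; last lra.
    apply: (homothetic_le r0 ballK) xu; first lra.
    by rewrite ler_pdivlMr; [nra|lra].
  rewrite homothetic_homothety; last lra.
  move=> bad; apply: x4u; apply: (homothetic_le r0 ballK) bad.
    by rewrite divr_gt0; lra.
  by rewrite ler_pdivrMr; [nra|lra].
have h2 : pr (S `&` shell u) <= m%:R * (8 / 3 * W) + 4 / 3 * pr (S `&` W2).
  apply: (main (8 * u)) => //; first by apply/andP; split; lra.
  move=> x [xu x4u]; split.
    rewrite homothetic_homothety; last lra.
    apply: (homothetic_le r0 ballK) xu; first lra.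
    by rewrite ler_pdivlMr; [nra|lra].
  rewrite homothetic_homothety; last lra.
  move=> bad; apply: x4u; apply: (homothetic_le r0 ballK) bad.
    by rewrite divr_gt0; lra.
  by rewrite ler_pdivrMr; [nra|lra].
have : pr (S `&` W1) + pr (S `&` W2) <= pr (S `&` shell (4 * u)).
  rewrite -rprobU; [|exact: measurableI|exact: measurableI|].
    apply: rprob_le.
    - by apply: measurableU; exact: measurableI.
    - by apply: measurableI => //; exact: measurable_shell.
    have e16 : 1 - 4 * (4 * u) = 1 - 16 * u by lra.
    move=> x [[Sx [xa xb]]|[Sx [xa xb]]]; split => //; split; rewrite ?e16//.
      by move=> bad; apply: xb; apply: (homothetic_le r0 ballK) bad; lra.
    by apply: (homothetic_le r0 ballK) xa; lra.
  by apply/seteqP; split => // x [[_ [_ ?]] [_ [? _]]].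
have mW0 : 0 <= m%:R * W by rewrite mulr_ge0// ltW.
(* Half the sum of [h1] and [h2], with [8 / 3 <= 3]. *)
lra.
Qed.

End one_shell.
End radial.

Section radial_sum.
Context {R : realType} (n : nat) (K : convex_body R n).
Local Notation KK := (convex_body_set K).
Local Notation pr := (rprob (unif K)).
Hypothesis n0 : (0 < n)%N.
Variables (x0 : 'rV[R]_n) (r rho : R).
Hypothesis r0 : 0 < r.
Hypothesis ballK : forall w : 'rV[R]_n, `|w| <= r -> KK (x0 + w).
Hypothesis distK : forall x, KK x -> `|x - x0| <= n%:R * rho.
Variables (S : set 'rV[R]_n) (G : 'I_n -> set 'rV[R]_n).
Hypotheses (mS : measurable S) (mG : forall i, measurable (G i)).
Hypothesis sepS : line_separated K S G.

Local Notation H := (homothetic K x0).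

Let mH s : measurable (H s). Proof. exact: measurable_homothetic. Qed.

Let nR0 : 0 < n%:R :> R. Proof. by rewrite ltr0n. Qed.

(** The factor [(8 * n)^-1] makes the shells satisfy [32 * n * u <= 1] from [scale 1] on, which is
    also the depth where the inner part begins. *)
Definition scale (j : nat) : R := (8 * n%:R)^-1 / 4 ^+ j.

Let scale_gt0 j : 0 < scale j.
Proof. by rewrite /scale divr_gt0 ?exprn_gt0// invr_gt0 mulr_gt0. Qed.

Let scaleS j : scale j = 4 * scale j.+1.
Proof. by rewrite /scale exprS; field; rewrite !gt_eqF ?exprn_gt0. Qed.

Let scale_n j : n%:R * scale j = (8 * 4 ^+ j)^-1.
Proof. by rewrite /scale; field; rewrite !gt_eqF ?exprn_gt0. Qed.

Let scale_le j : n%:R * scale j <= 8^-1.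
Proof. by rewrite scale_n lef_pV2 ?posrE ?mulr_gt0 ?exprn_gt0// ler_pMr// exprn_ege1// ler1n. Qed.

Let scale_lt1 j : scale j <= 8^-1.
Proof.
apply: le_trans (scale_le j); rewrite ler_pMl//.
by rewrite ler1n.
Qed.

Let phi (A : set 'rV[R]_n) j := pr (A `&` H (1 - scale j)).

(** Because [scale j.+3] is below [scale j.+2 / 2] and [13 * scale j.+2] below [scale j], a wide
    shell meets only three consecutive shells. *)
Lemma rprob_wide_shell_le (A : set 'rV[R]_n) j : measurable A ->
  pr (A `&` wide_shell K x0 (scale j.+2)) <= phi A j.+3 - phi A j.
Proof.
move=> mA; rewrite lerBrDr /phi.
have := scale_gt0 j.+3; have := scaleS j; have := scaleS j.+1; have := scaleS j.+2.
have := scale_lt1 j; set u := scale j.+2 => uj e3 e2 e1 u3.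
rewrite -rprobU.
- apply: rprob_le.
  + apply: measurableU; apply: measurableI => //.
    exact: measurable_wide_shell.
  + exact: measurableI.
  move=> x [[Ax [xu _]]|[Ax xu]]; split => //; apply: (homothetic_le r0 ballK) xu; lra.
- by apply: measurableI => //; exact: measurable_wide_shell.
- exact: measurableI.
apply/seteqP; split => // x [[_ [_ nx]] [_ xj]]; apply: nx.
by apply: (homothetic_le r0 ballK) xj; lra.
Qed.

(* The potential [b k + 2 c k] grows by at most a multiple of the mass of the
   [G i] in a wide shell, and each point is in at most three of these shells. *)
Lemma radial_bound m : 16 * (n%:R * rho) <= m%:R * r ->
  pr S <= 3 * pr (S `&` H (1 - scale 1)) + 27 * m%:R * \sum_i pr (G i).
Proof.
move=> mr; set W := \sum_i pr (G i).
(* Three consecutive terms, so that [Phi k.+1 i - Phi k i] collapses to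
   [phi (G i) k.+3 - phi (G i) k], the bound for one wide shell. *)
pose Phi k i := phi (G i) k.+2 + phi (G i) k.+1 + phi (G i) k.
pose b k := phi S k.+1; pose c k := pr (S `&` shell K x0 (scale k.+1)).
have c0 k : 0 <= c k by exact: rprob_ge0.
(* The weight 2 closes the induction: [b k.+1 + 2 * c k.+1] is [b k + 3 * c k.+1], and
   [3 * (2 / 3) = 2]. *)
have step k : b k + 2 * c k <= 3 * b 0 + 9 * m%:R * \sum_i (Phi k i - Phi 0 i).
  elim: k => [|k IH].
    rewrite big1 => [|i _]; last by rewrite subrr.
    rewrite mulr0 addr0.
    suff : c 0 <= b 0 by lra.
    apply: rprob_le.
    + by apply: measurableI => //; exact: measurable_shell.
    + exact: measurableI.
    + by move=> x [? []].
  have bS : b k.+1 = b k + c k.+1.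
    rewrite /b /phi /c; rewrite (rprobDI _ (measurableI _ _ mS (mH _)) (mH (1 - scale k.+1))).
    congr (pr _ + pr _).
      apply/seteqP; split => x; first by move=> [[]].
      move=> [Sx xk]; split => //; split => //; apply: (homothetic_le r0 ballK) xk.
        by have := scale_lt1 k.+1; lra.
      by have := scaleS k.+1; have := scale_gt0 k.+2; lra.
    by rewrite /shell -scaleS setDE setDE setIA.
  have cS : c k.+1 <= 2 / 3 * c k + 3 * m%:R * \sum_i pr (G i `&` wide_shell K x0 (scale k.+2)).
    rewrite /c [in X in _ <= _ * X + _](scaleS k.+1).
    apply: (radial_shell n0 r0 ballK distK) => //.
    have := scale_le k.+2; have := scale_n k.+2; rewrite !exprS => ->.
    have := scaleS k.+1; have := scaleS k; have := scale_le k; have := scale_gt0 k.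
    nra.
  have WS : \sum_i pr (G i `&` wide_shell K x0 (scale k.+2)) <=
      \sum_i (Phi k.+1 i - Phi k i).
    apply: ler_sum => i _; apply: le_trans (rprob_wide_shell_le _ _) _ => //.
    by rewrite /Phi; lra.
  have -> : \sum_i (Phi k.+1 i - Phi 0 i) =
      \sum_i (Phi k.+1 i - Phi k i) + \sum_i (Phi k i - Phi 0 i).
    by rewrite -big_split; apply: eq_bigr => i _ /=; lra.
  have := ler_wpM2l (ler0n R m) WS.
  rewrite bS; lra.
have PhiW k : \sum_i (Phi k i - Phi 0 i) <= 3 * W.
  rewrite /W mulr_sumr; apply: ler_sum => i _; rewrite /Phi.
  have ph j : 0 <= phi (G i) j <= pr (G i).
    apply/andP; split; first exact: rprob_ge0.
    by apply: rprob_le => //; exact: measurableI.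
  move: (ph k) (ph k.+1) (ph k.+2) (ph 0) (ph 1) (ph 2).
  by move=> /andP[_ ?] /andP[_ ?] /andP[_ ?] /andP[? _] /andP[? _] /andP[? _]; lra.
apply/ler_addgt0Pr => e e0.
(* The layer outside the first shells has mass at most [n * scale k.+1], which tends to 0. *)
have [k ke] : exists k, n%:R * scale k.+1 <= e.
  exists (Num.truncn e^-1).
  rewrite scale_n -[leRHS]invrK lef_pV2 ?posrE ?invr_gt0 ?mulr_gt0 ?exprn_gt0//.
  apply: le_trans (ltW (truncnS_gt _)) _.
  rewrite -natrX -natrM ler_nat; apply: leq_trans (ltnW (ltn_expl _ _)) (leq_pmull _ _) => //.
have Sk : pr S <= b k + n%:R * scale k.+1.
  apply: (@le_trans _ _ (b k + pr (~` H (1 - scale k.+1)))).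
    apply: rprob_cover_le => //; [exact: measurableI|exact: measurableC|].
    by move=> x Sx; have [|] := pselect (H (1 - scale k.+1) x); [left|right].
  rewrite lerD2l; apply: (rprob_boundary_le r0 ballK) => //.
  by have := scale_lt1 k.+1; lra.
have b0E : b 0 = pr (S `&` H (1 - scale 1)) by [].
have final (p bk ns c' b0' mm Ph W' : R) : p <= bk + ns -> ns <= e -> 0 <= c' ->
    mm * Ph <= mm * (3 * W') -> bk + 2 * c' <= 3 * b0' + 9 * mm * Ph ->
    p <= 3 * b0' + 27 * mm * W' + e by move=> h1 h2 h3 h4 h5; lra.
rewrite -b0E; apply: final Sk ke (c0 k) (ler_wpM2l (ler0n R m) (PhiW k)) (step k).
Qed.

End radial_sum.

Lemma ln2_ge (R : realType) : 2^-1 <= ln 2 :> R.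
Proof.
have := @le_ln1Dx R (- 2^-1); rewrite ltrN2 invf_lt1// ltr1n => /(_ isT).
rewrite (_ : 1 + - 2^-1 = 2^-1); last by field.
by rewrite lnV ?posrE// lerN2.
Qed.

Lemma powR2_ge (R : realType) (t : R) : 0 <= t -> 1 + t / 2 <= 2 `^ t.
Proof.
move=> t0; rewrite /powR pnatr_eq0 /=; apply: le_trans (expR_ge1Dx _).
by rewrite lerD2l; apply: ler_wpM2l; last exact: ln2_ge.
Qed.

Section expansion.
Context {R : realType} (n : nat) (K : convex_body R n).
Local Notation KK := (convex_body_set K).
Local Notation pr := (rprob (unif K)).

(* The set [(1 - t) A + t C] lies in [C] and avoids [B]; as [pr C] is at least
   [2 pr A], its mass is at least [2^t pr A] by the Brunn-Minkowski inequality. *)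
Lemma rprob_expansion (b t : R) (A B C : set 'rV[R]_n) :
  0 < t -> t < 1 -> (forall x, KK x -> `|x| <= b) ->
  measurable A -> measurable B -> measurable C ->
  A `<=` C -> B `<=` C -> C `<=` KK -> A `&` B = set0 -> pr A <= pr B ->
  (forall x y, A x -> C y -> C ((1 - t) *: x + t *: y) /\ ~ B ((1 - t) *: x + t *: y)) ->
  t / 2 * pr A <= pr (C `\` (A `|` B)).
Proof.
move=> t0 t1 Kb mA mB mC AC BC CK AB prAB cvx.
have mAB : measurable (A `|` B) by exact: measurableU.
have mCB : measurable (C `\` B) by exact: measurableD.
have lE X : measurable X -> X `<=` KK -> lebesgue_rV n X = (pr X * vol K)%:E.
  by move=> mX XK; rewrite -lebesgue_rprob//; congr (lebesgue_rV n _); rewrite setIidl.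
have a0 := rprob_ge0 (unif K) A.
have [a0'|an0] := eqVneq (pr A) 0; first by rewrite a0' mulr0 rprob_ge0.
have {an0}a1 : 0 < pr A by rewrite lt_neqAle eq_sym an0.
have v0 := vol_gt0 K.
have := @brunn_minkowski R t t0 t1 n A C (C `\` B) b mA mC mCB.
rewrite !lE//; [|by move=> x [/CK]|exact: subset_trans AC CK].
rewrite /= lee_fin.
have bd x : (A `|` C `|` (C `\` B)) x -> `|x| <= b.
  by move=> [[/AC/CK|/CK]|[/CK + _]]; exact: Kb.
move=> /(_ bd cvx).
rewrite !powRM ?rprob_ge0 ?(ltW v0)// mulrACA -powRD; last by rewrite subrK oner_eq0.
rewrite subrK powRr1 ?(ltW v0)// ler_pM2r// => BM.
have cA : pr A + pr B <= pr C.
  rewrite -rprobU//; apply: rprob_le => //.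
  by move=> x [/AC|/BC].
have E : pr (C `\` B) = pr A + pr (C `\` (A `|` B)).
  rewrite -rprobU//; [|exact: measurableD|].
    congr (pr _); apply/seteqP; split => x.
      by move=> [Cx nBx]; have [|nA] := pselect (A x); [left|right; split => // -[]].
    move=> [Ax|[Cx nAB]]; split => //.
    - exact: AC.
    - by move=> Bx; have : (A `&` B) x by []; rewrite AB.
    - by move=> Bx; apply: nAB; right.
  by apply/seteqP; split => // x [Ax [_ nAB]]; apply: nAB; left.
have : pr A * 2 `^ t <= pr (C `\` B).
  apply: le_trans BM.
  have -> : pr A * 2 `^ t = pr A `^ (1 - t) * (2 * pr A) `^ t.
    rewrite powRM// mulrCA -powRD; last by rewrite subrK oner_eq0.
    by rewrite subrK powRr1// mulrC.
  apply: ler_wpM2l; first exact: powR_ge0.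
  apply: ge0_ler_powR; rewrite ?nnegrE ?mulr_ge0 ?rprob_ge0//; [exact: ltW|lra].
have := powR2_ge (ltW t0); rewrite E; nra.
Qed.

End expansion.

(** * Mass of a set in a moving cube *)

Section cube_average.
Context {R : realType} (n : nat).
Variables (S : set 'rV[R]_n) (mS : measurable S) (del : R).
Hypothesis del0 : 0 < del.

Definition cube_trace (x : 'rV[R]_n) : set 'rV[R]_n :=
  ball (0 : 'rV[R]_n) del `&` [set v | S (x + v)].

Definition cube_vol : R := (del *+ 2) ^+ n.

Definition cube_mass x : R := fine (lebesgue_rV n (cube_trace x)).

Lemma cube_vol_gt0 : 0 < cube_vol.
Proof. by rewrite exprn_gt0// pmulrn_lgt0. Qed.

Lemma measurable_shift (x : 'rV[R]_n) (A : set 'rV[R]_n) : measurable A ->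
  measurable [set v | A (x + v)].
Proof.
move=> mA; have -> : [set v | A (x + v)] =
    diag_affine (fun=> 1) (fun j => x 0 j) @^-1` A.
  have E v : diag_affine (fun=> 1) (fun j => x 0 j) v = x + v.
    by apply/rowP => j; rewrite !mxE mul1r addrC.
  by apply/seteqP; split => v /=; rewrite E.
exact: measurable_preimage_diag_affine.
Qed.

Lemma measurable_addv (A : set 'rV[R]_n) : measurable A ->
  measurable [set p : 'rV[R]_n * 'rV[R]_n | A (p.1 + p.2)].
Proof.
move=> mA; rewrite -[X in measurable X]setTI.
suff : measurable_fun setT (fun p : 'rV[R]_n * 'rV[R]_n => p.1 + p.2) by exact.
apply: measurable_fun_rVP => i; under eq_fun do rewrite mxE.
by apply: measurable_funD; apply: (measurableT_comp (measurable_coord i));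
  [exact: measurable_fst|exact: measurable_snd].
Qed.

Lemma measurable_cube_trace x : measurable (cube_trace x).
Proof. by apply: measurableI; [exact: ball_measurable_rV|exact: measurable_shift]. Qed.

Lemma cube_massE x : lebesgue_rV n (cube_trace x) = (cube_mass x)%:E.
Proof.
rewrite /cube_mass fineK// ge0_fin_numE//.
apply: (@le_lt_trans _ _ (lebesgue_rV n (ball (0 : 'rV[R]_n) del))).
  apply: measure_le; [exact: measurable_cube_trace|exact: ball_measurable_rV|].
  by move=> v [].
by rewrite lebesgue_rV_ball// ltry.
Qed.

Lemma measurable_cube_mass : measurable_fun setT cube_mass.
Proof.
pose Z := (setT `*` ball (0 : 'rV[R]_n) del) `&`
  [set p : 'rV[R]_n * 'rV[R]_n | S (p.1 + p.2)].
have mZ : measurable Z.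
  apply: measurableI; last exact: measurable_addv.
  by apply: measurableX => //; exact: ball_measurable_rV.
have -> : cube_mass = fine \o (lebesgue_rV n \o xsection Z).
  apply/funext => x; rewrite /cube_mass /=; congr (fine (lebesgue_rV n _)).
  apply/seteqP; split => v; rewrite /xsection /mkset in_setE /Z /cube_trace /=.
    by move=> [].
  by move=> [[]].
apply: measurableT_comp => //; exact: measurable_fun_xsection.
Qed.

(** Translated by [z - x], the part of the trace at [z] within radius [del - d] lies in the trace at
    [x]. What remains fits in the difference of two concentric cubes. *)
Lemma cube_mass_lip x z d : 0 <= d < del -> `|z - x| <= d ->
  cube_mass z <= cube_mass x + (cube_vol - ((del - d) *+ 2) ^+ n).
Proof.
move=> /andP[d0 dd] zx; have dd0 : 0 < del - d by rewrite subr_gt0.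
pose B1 := ball (0 : 'rV[R]_n) (del - d).
have mB1 : measurable B1 by exact: ball_measurable_rV.
have mB := ball_measurable_rV (0 : 'rV[R]_n) del0.
have sub : B1 `<=` ball (0 : 'rV[R]_n) del.
  by move=> v; apply: le_ball; lra.
have ringE : lebesgue_rV n (ball (0 : 'rV[R]_n) del `\` B1) =
    (cube_vol - ((del - d) *+ 2) ^+ n)%:E.
  have fin : (lebesgue_rV n (ball (0 : 'rV[R]_n)%R del) < +oo)%E.
    by rewrite lebesgue_rV_ball// ltry.
  transitivity (lebesgue_rV n (ball (0 : 'rV[R]_n)%R del) - lebesgue_rV n B1)%E.
    rewrite measureD//; congr (_ - lebesgue_rV n _)%E; exact/setIidr.
  by rewrite !lebesgue_rV_ball.
have msh := measurable_cube_trace x.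
rewrite -lee_fin EFinD -ringE -!cube_massE.
rewrite -(lebesgue_rV_translate (z - x) msh).
have mT : measurable [set v | cube_trace x (v + (z - x))].
  have -> : [set v | cube_trace x (v + (z - x))] = [set v | cube_trace x ((z - x) + v)].
    by apply/seteqP; split => v /=; rewrite addrC.
  exact: measurable_shift.
apply: (@le_trans _ _ (lebesgue_rV n ([set v | cube_trace x (v + (z - x))] `|`
   (ball (0 : 'rV[R]_n) del `\` B1)))); last first.
  by apply: measureU2 => //; exact: measurableD.
apply: measure_le; [exact: measurable_cube_trace|by apply: measurableU => //; exact: measurableD|].
move=> v [vB Sv]; have [vB1|] := pselect (B1 v); last by right.
left; split.
  move: vB1; rewrite /B1 -!ball_normE /ball_/= !sub0r !normrN => vB1.
  by apply: le_lt_trans (ler_normD _ _) _; lra.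
by rewrite /= addrCA [x + _]addrC subrK addrC.
Qed.

End cube_average.

(** * Isoperimetry in the inner part and in the whole body *)

Section isoperimetry.
Context {R : realType} (n : nat) (K : convex_body R n).
Local Notation KK := (convex_body_set K).
Local Notation pr := (rprob (unif K)).
Hypothesis n0 : (0 < n)%N.
Variables (x0 g : 'rV[R]_n) (r rho : R).
Hypotheses (r0 : 0 < r) (rho0 : 0 < rho).
Hypothesis ballK : forall w : 'rV[R]_n, `|w| <= r -> KK (x0 + w).
Hypothesis distK : forall x, KK x -> `|x - x0| <= n%:R * rho.

Local Notation H := (homothetic K x0).
(** The depth at which [radial_bound] stops. A point of [H (1 - tau)] can be moved by any vector of
    norm at most [del] within [K]. *)
Let tau : R := scale n 1.
Let del := tau * r.
Let B := cube_vol n del.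

Let nR0 : 0 < n%:R :> R. Proof. by rewrite ltr0n. Qed.
Let n1 : 1 <= n%:R :> R. Proof. by rewrite ler1n. Qed.

Let tauE : tau = (32 * n%:R)^-1.
Proof. by rewrite /tau /scale expr1; field; rewrite gt_eqF. Qed.

Let tau0 : 0 < tau. Proof. by rewrite tauE invr_gt0 mulr_gt0. Qed.

Let tau_lt1 : tau < 1.
Proof. by rewrite tauE invf_lt1 ?mulr_gt0//; have := n1; lra. Qed.

Let del0 : 0 < del. Proof. by rewrite mulr_gt0. Qed.

Let r_le : r <= n%:R * rho.
Proof.
have nE : `|const_mx r : 'rV[R]_n| = r by apply: rV_norm_const => //; exact: ltW.
have := distK (ballK (_ : `|const_mx r : 'rV[R]_n| <= r)).
by rewrite nE lexx [x0 + _]addrC addrK nE; apply.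
Qed.

(** The second condition bounds the diameter by [2 * rho], where the hypotheses on [K] alone would
    give a bound larger by a factor [n]. *)
Let core := H (1 - tau) `&` [set x | `|x - g| <= rho].

Lemma measurable_box (c : 'rV[R]_n) a : measurable [set x : 'rV[R]_n | `|x - c| <= a].
Proof.
have [a0|a0] := leP 0 a; last first.
  rewrite (_ : mkset _ = set0)//; apply/seteqP; split => // x /= xa.
  by have := le_lt_trans xa a0; rewrite normr_lt0.
have -> : [set x : 'rV[R]_n | `|x - c| <= a] =
    rV_box (fun i => `[c 0 i - a, c 0 i + a]%classic).
  apply/seteqP; split => x /= xa.
    move=> i; rewrite /= in_itv/= -ler_distl.
    by have := coord_ler_norm (x - c) i; rewrite !mxE => h; exact: le_trans h xa.
  apply: rV_norm_ler => // i; rewrite !mxE; have := xa i.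
  by rewrite /= in_itv/= -ler_distl.
by apply: measurable_rV_box => i; exact: measurable_itv.
Qed.

Lemma measurable_far (c : 'rV[R]_n) a : measurable [set x : 'rV[R]_n | a < `|x - c|].
Proof.
rewrite (_ : mkset _ = ~` [set x : 'rV[R]_n | `|x - c| <= a]).
  by apply: measurableC; exact: measurable_box.
by apply/seteqP; split => x /=; rewrite ltNge => /negP.
Qed.

Let mcore : measurable core.
Proof. by apply: measurableI; [exact: measurable_homothetic|exact: measurable_box]. Qed.

Let coreK : core `<=` KK.
Proof. by move=> x [xH _]; apply: (homothetic_sub r0 ballK) xH; have := tau_lt1; have := tau0; lra. Qed.

Let core_conv x y t : 0 <= t <= 1 -> core x -> core y -> core ((1 - t) *: x + t *: y).
Proof.
move=> t01 [xH xg] [yH yg]; split.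
  have := convex_body_conv t01 xH yH; rewrite /homothetic /=; congr KK.
  by apply/rowP => j; rewrite /homothety !mxE; ring.
rewrite /=; have -> : (1 - t) *: x + t *: y - g = (1 - t) *: (x - g) + t *: (y - g).
  by apply/rowP => j; rewrite !mxE; ring.
apply: le_trans (ler_normD _ _) _; rewrite !normrZ.
move: t01 => /andP[t0 t1]; rewrite !ger0_norm ?subr_ge0//.
by have := xg; have := yg; rewrite /= => yg' xg'; nra.
Qed.

Section one_set.
Variables (S : set 'rV[R]_n) (G : 'I_n -> set 'rV[R]_n).
Hypotheses (mS : measurable S) (mG : forall i, measurable (G i)).
Let W := \sum_i pr (G i).

(** A translation has Jacobian 1, and the core is deep enough for the coordinate path from [x] to
    [x + v]. *)
Lemma rprob_shift_separated v : line_separated K S G -> `|v| <= del ->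
  pr (core `&` [set x | S x /\ ~ S (x + v)]) <= 2 * W.
Proof.
move=> sepS vd.
have idE x : diag_affine (fun=> 1) (fun=> 0) x = x.
  by apply/rowP => j; rewrite !mxE mul1r addr0.
have shE x : diag_affine (fun=> 1) (fun j => v 0 j) x = x + v.
  by apply/rowP => j; rewrite !mxE mul1r.
have := @rprob_affine_separated R n K S G mS mG sepS (fun=> 1) (fun=> 0) (fun=> 1)
  (fun j => v 0 j) 1 core setT ltr01 (fun=> lexx 1) (fun=> lexx 1) mcore measurableT.
have -> : [set x | S (diag_affine (fun=> 1) (fun=> 0) x) /\
    ~ S (diag_affine (fun=> 1) (fun j => v 0 j) x)] = [set x | S x /\ ~ S (x + v)].
  by apply/seteqP; split => x /=; rewrite idE shE.
rewrite expr1n invr1 mulr1.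
under eq_bigr do rewrite setIT.
apply=> x k Kx [xH _] kn; split => //.
rewrite idE shE -[hybrid _ _ _](subrK x) addrC.
have -> : KK = H ((1 - tau) + tau) by rewrite subrK homothetic1.
apply: (homothetic_add ballK) => //; first by have := tau_lt1; lra.
by apply: le_trans (hybridB_norm _ _ _) _; rewrite addrC addKr.
Qed.

End one_set.

Section two_sets.
Variables (S : set 'rV[R]_n) (G : 'I_n -> set 'rV[R]_n).
Hypotheses (mS : measurable S) (mG : forall i, measurable (G i)).
Hypothesis sepS : line_separated K S G.
Let W := \sum_i pr (G i).
Let p := cube_mass S del.

Let W0 : 0 <= W. Proof. by apply: sumr_ge0 => i _; exact: rprob_ge0. Qed.

(* Pairs [(x, v)] such that the translation by [v] moves [x] across the boundary
   of [S]: Fubini over [v] bounds them by [W], Fubini over [x] from below by the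
   mass of [N]. *)
Let flips : set ('rV[R]_n * 'rV[R]_n) :=
  (core `*` ball (0 : 'rV[R]_n) del) `&`
  ([set q | S q.1] `&` [set q | ~ S (q.1 + q.2)] `|`
   [set q | ~ S q.1] `&` [set q | S (q.1 + q.2)]).

Let mflips : measurable flips.
Proof.
have m1 (A : set 'rV[R]_n) : measurable A ->
    measurable [set q : 'rV[R]_n * 'rV[R]_n | A q.1].
  move=> mA; rewrite -[X in measurable X]setTI.
  suff : measurable_fun setT (fst : 'rV[R]_n * 'rV[R]_n -> 'rV[R]_n) by exact.
  exact: measurable_fst.
have mC := measurableC mS.
apply: measurableI; first by apply: measurableX => //; exact: ball_measurable_rV.
by apply: measurableU; apply: measurableI;
  [exact: (m1 _ mS)|exact: (measurable_addv mC)|exact: (m1 _ mC)|exact: (measurable_addv mS)].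
Qed.

(** At these points at least a quarter of the cube is on the other side of the boundary of [S]. *)
Let N := core `&` ((S `&` [set x | p x <= 3 / 4 * B]) `|`
                   (~` S `&` [set x | B / 4 <= p x])).

Let B0 : 0 < B. Proof. exact: cube_vol_gt0. Qed.

Let mp : measurable_fun setT p. Proof. exact: measurable_cube_mass. Qed.

Let mN : measurable N.
Proof.
apply: measurableI => //; apply: measurableU; apply: measurableI => //.
- exact: measurable_ler_set mp (measurable_cst _).
- exact: measurableC.
- exact: measurable_ler_set (measurable_cst _) mp.
Qed.

Lemma rprob_mixed : pr N <= 16 * W.
Proof.
have mB := ball_measurable_rV (0 : 'rV[R]_n) del0.
have fub := integral_xsection_ysection (unif K) (lebesgue_rV n) mflips.
have up : (\int[lebesgue_rV n]_v unif K (ysection flips v) <= (4 * W * B)%:E)%E.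
  apply: (@le_trans _ _ (\int[lebesgue_rV n]_v (4 * W * \1_(ball (0 : 'rV[R]_n) del) v)%:E)%E).
    apply: ge0_le_integral => //.
    - exact: measurable_fun_ysection.
    - apply/measurable_EFinP; apply: measurable_funM => //; exact: measurable_indic.
    move=> v _; rewrite indicE; have [vB|vB] := boolP (v \in _); last first.
      rewrite (_ : ysection flips v = set0) ?measure0 ?mulr0//.
      apply/seteqP; split => // x; rewrite /ysection /mkset in_setE => -[[_ /= vb] _].
      by move/negP: vB; apply; rewrite in_setE.
    have vd : `|v| <= del.
      by move: vB; rewrite in_setE -ball_normE /ball_/= sub0r normrN => /ltW.
    have my : measurable (ysection flips v) by exact: measurable_ysection.
    rewrite mulr1 rprobE// lee_fin.
    pose U1 := core `&` [set x | S x /\ ~ S (x + v)].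
    pose U2 := core `&` [set x | (~` S) x /\ ~ (~` S) (x + v)].
    have mU (A : set 'rV[R]_n) : measurable A -> measurable (core `&` [set x | A x /\ ~ A (x + v)]).
      move=> mA; apply: measurableI => //.
      have -> : [set x | A x /\ ~ A (x + v)] = A `&` [set x | (~` A) (v + x)].
        by apply/seteqP; split => x /=; rewrite addrC.
      by apply: measurableI => //; apply: measurable_shift; exact: measurableC.
    have := rprob_shift_separated mS mG sepS vd.
    have := rprob_shift_separated (measurableC mS) mG (line_separatedC sepS) vd.
    have : pr (ysection flips v) <= pr U1 + pr U2.
      apply: rprob_cover_le => //; [exact: mU|exact: mU (measurableC mS)|].
      move=> x; rewrite /ysection /mkset in_setE => -[[/= xc _]] [[? ?]|[? ?]]; [left|right] => //.
      by split => //; split => //; exact.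
    by rewrite -/W -/U1 -/U2; lra.
  under eq_integral do rewrite EFinM.
  rewrite ge0_integralZl//; last 2 first.
  - by apply/measurable_EFinP; exact: measurable_indic.
  - by rewrite lee_fin mulr_ge0.
  by rewrite integral_indic// setIT [X in (_ * X)%E](lebesgue_rV_ball 0 del0).
have low : (((B / 4) * pr N)%:E <= \int[unif K]_x lebesgue_rV n (xsection flips x))%E.
  rewrite EFinM -rprobE// -[N in X in (X <= _)%E]setIT -integral_indic//.
  rewrite -ge0_integralZl//; last 2 first.
  - by apply/measurable_EFinP; exact: measurable_indic.
  - by rewrite lee_fin divr_ge0// ltW.
  apply: ge0_le_integral => //.
  - by move=> x _; rewrite -EFinM lee_fin mulr_ge0// divr_ge0// ltW.
  - apply: measurable_funeM; apply/measurable_EFinP; exact: measurable_indic.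
  - exact: measurable_fun_xsection.
  move=> x _; rewrite -EFinM indicE; have [|_] := boolP (x \in N); last first.
    by rewrite mulr0.
  rewrite in_setE mulr1 => -[xc] [[Sx px]|[nSx px]]; last first.
    apply: (@le_trans _ _ (p x)%:E); first by rewrite lee_fin.
    rewrite -(cube_massE mS del0); apply: measure_le.
    + exact: measurable_cube_trace.
    + exact: measurable_xsection.
    + by move=> v [vB Sv]; rewrite /xsection /mkset in_setE; split => //; right.
  apply: (@le_trans _ _ (lebesgue_rV n (ball (0 : 'rV[R]_n) del `\` cube_trace S del x))).
    have sub : cube_trace S del x `<=` ball (0 : 'rV[R]_n) del by move=> v [].
    have mt := measurable_cube_trace mS del0 x.
    have E : (lebesgue_rV n (ball (0 : 'rV[R]_n)%R del) =
        lebesgue_rV n (ball (0 : 'rV[R]_n)%R del `\` cube_trace S del x) +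
        lebesgue_rV n (cube_trace S del x))%E.
      rewrite [LHS](measureDI _ mB mt); congr (_ + lebesgue_rV n _)%E; exact/setIidr.
    move: E; rewrite (cube_massE mS del0) lebesgue_rV_ball//.
    case: (lebesgue_rV n (_ `\` _)) => [l| |]//.
      rewrite -EFinD => -[E]; rewrite lee_fin.
      have : B = l + p x by [].
      by move: px => /=; clearbody B p; move: (p x) => px; lra.
  apply: measure_le.
  + by apply: measurableD => //; exact: measurable_cube_trace.
  + exact: measurable_xsection.
  + move=> v [vB nSv]; rewrite /xsection /mkset in_setE; split => //; left; split => //=.
    by move=> Sv; apply: nSv.
(* Each [v] in the cube contributes at most [2 * W] for the crossings out of [S] and [2 * W] for
   those into it; each point of [N] has flips of volume at least [B / 4]. Hence
   [B / 4 * pr N <= 4 * W * B]. *)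
have := le_trans low (le_trans _ up); rewrite fub lexx => /(_ isT).
rewrite lee_fin; have := B0; nra.
Qed.

Let t := del / (8 * n%:R * rho).

Let t0 : 0 < t. Proof. by rewrite divr_gt0// !mulr_gt0. Qed.

Let t_le : t <= 256^-1.
Proof.
rewrite /t /del tauE ler_pdivrMr ?mulr_gt0// ler_pdivrMl ?mulr_gt0//.
have := r_le; have := n1; have := r0; have := rho0 => h1 h2 h3 h4; nra.
Qed.

(** The combination is within [2 * rho * t = del / (4 * n)] of [x], and by Bernoulli's inequality a
    cube shrunk by the factor [1 - (4 * n)^-1] keeps three quarters of its volume. This dictates
    [t]. *)
Let p_close x y : core x -> core y ->
  p ((1 - t) *: x + t *: y) <= p x + B / 4 /\ p x <= p ((1 - t) *: x + t *: y) + B / 4.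
Proof.
move=> [_ xg] [_ yg]; set z := _ + _.
pose d := del / (4 * n%:R).
have dd : 0 <= d < del.
  apply/andP; split; first by rewrite divr_ge0// ?mulr_ge0// ltW.
  by rewrite ltr_pdivrMr ?mulr_gt0// ltr_pMr//; have := n1; lra.
have zx : `|z - x| <= d.
  have -> : z - x = t *: ((y - g) - (x - g)).
    by apply/rowP => j; rewrite !mxE; ring.
  rewrite normrZ gtr0_norm//.
  apply: (@le_trans _ _ (t * (rho + rho))).
    apply: ler_wpM2l; first exact: ltW.
    by apply: le_trans (ler_normB _ _) _; exact: lerD.
  have -> : t * (rho + rho) = d; last by [].
  by rewrite /t /d; field; rewrite !gt_eqF.
have Bd : B - ((del - d) *+ 2) ^+ n <= B / 4.
  have -> : del - d = (1 - (4 * n%:R)^-1) * del.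
    by rewrite /d; field; rewrite gt_eqF.
  rewrite -mulrnAr exprMn -/(cube_vol n del) -/B.
  have : 1 - n%:R * (4 * n%:R)^-1 <= (1 - (4 * n%:R)^-1) ^+ n :> R.
    apply: bernoulli_le; rewrite invr_ge0 mulr_ge0//=.
    by rewrite invf_le1 ?mulr_gt0//; have := n1; lra.
  have -> : n%:R * (4 * n%:R)^-1 = 4^-1 :> R by field; rewrite gt_eqF.
  by have := B0; nra.
have h1 := cube_mass_lip mS del0 dd zx.
have h2 : p x <= p z + (B - ((del - d) *+ 2) ^+ n).
  by apply: cube_mass_lip => //; rewrite distrC.
split; first by apply: le_trans h1 _; rewrite lerD2l.
by apply: le_trans h2 _; rewrite lerD2l.
Qed.

(** Moving a point of [A] by the fraction [t] towards the core keeps [p] below [B / 2], hence out of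
    [A']; and symmetrically. The expansion estimate then bounds the smaller of the two by [2 / t]
    times the mass of [N]. *)
Lemma core_isoperimetry :
  pr (S `&` core) <= (16 + 32 / t) * W \/ pr (~` S `&` core) <= (16 + 32 / t) * W.
Proof.
pose A := core `&` [set x | p x < B / 4].
pose A' := core `&` [set x | 3 / 4 * B < p x].
have mA : measurable A.
  by apply: measurableI => //; exact: measurable_ltr_set mp (measurable_cst _).
have mA' : measurable A'.
  by apply: measurableI => //; exact: measurable_ltr_set (measurable_cst _) mp.
have mC := measurableC mS.
have SA' : pr (S `&` core) <= pr N + pr A'.
  apply: rprob_cover_le => //; first exact: measurableI.
  move=> x [Sx xc]; have [px|px] := leP (p x) (3 / 4 * B); last by right.
  by left; split => //; left.
have SA : pr (~` S `&` core) <= pr N + pr A.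
  apply: rprob_cover_le => //; first exact: measurableI.
  move=> x [Sx xc]; have [px|px] := leP (B / 4) (p x); last by right.
  by left; split => //; right.
have mD : measurable (core `\` (A `|` A')) by apply: measurableD => //; exact: measurableU.
have DN : pr (core `\` (A `|` A')) <= pr N.
  apply: rprob_le => // x [xc nA]; split => //.
  have pA : B / 4 <= p x by rewrite leNgt; apply/negP => h; apply: nA; left.
  have pA' : p x <= 3 / 4 * B by rewrite leNgt; apply/negP => h; apply: nA; right.
  by have [Sx|nSx] := pselect (S x); [left|right].
have NW := rprob_mixed.
have Kb x : KK x -> `|x| <= `|x0| + n%:R * rho.
  move=> Kx; rewrite -[x](subrK x0) addrC.
  by apply: le_trans (ler_normD _ _) _; rewrite lerD2l; exact: distK.
have t1 : t < 1 by have := t_le; lra.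
have t01 : 0 <= t <= 1 by rewrite !ltW.
have disj : A `&` A' = set0.
  apply/seteqP; split => // x [[_ /= h1] [_ /= h2]].
  by have := B0; move: h1 h2; clearbody B p; move: (p x) => px; lra.
have concl a : t / 2 * a <= 16 * W -> 16 * W + a <= (16 + 32 / t) * W.
  move=> h; have -> : (16 + 32 / t) * W = 16 * W + 32 * W / t by ring.
  by rewrite lerD2l ler_pdivlMr//; lra.
have [AA|/ltW AA] := leP (pr A) (pr A').
  right; apply: le_trans SA _; apply: le_trans (concl (pr A) _); first by rewrite lerD2r.
  apply: le_trans NW; apply: le_trans DN.
  apply: (rprob_expansion t0 t1 Kb) => //.
  - by move=> x [].
  - by move=> x [].
  move=> x y [xc /= px] yc; split; first exact: core_conv.
  move=> [_ /= pz]; have [h _] := p_close xc yc.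
  by have := B0; move: px pz h; clearbody B p; move: (p x) (p (_ + _)) => a b; lra.
left; apply: le_trans SA' _; apply: le_trans (concl (pr A') _); first by rewrite lerD2r.
apply: le_trans NW; apply: le_trans DN; rewrite setUC.
apply: (rprob_expansion t0 t1 Kb) => //.
- by move=> x [].
- by move=> x [].
- by rewrite setIC.
move=> x y [xc /= px] yc; split; first exact: core_conv.
move=> [_ /= pz]; have [_ h] := p_close xc yc.
by have := B0; move: px pz h; clearbody B p; move: (p x) (p (_ + _)) => a b; lra.
Qed.

(** [radial_bound] multiplies the estimate in the core and the far mass [s] by 3. With [m <= 17 * q]
    and [t^-1 = 256 * Q], the constant is [3 * (16 + 32 * 256) + 27 * 17 = 25083], below
    [200 * 150]. *)
Lemma isoperimetry (s : R) : pr [set x | rho < `|x - g|] <= s ->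
  pr S <= (200 * 150) * (n%:R ^+ 2 * rho / r) * W + 3 * s \/
  pr (~` S) <= (200 * 150) * (n%:R ^+ 2 * rho / r) * W + 3 * s.
Proof.
move=> Os; set Q := n%:R ^+ 2 * rho / r.
pose q := n%:R * rho / r.
have q1 : 1 <= q by rewrite ler_pdivlMr// mul1r; exact: r_le.
have qQ : q <= Q.
  rewrite /Q /q expr2 -!mulrA; apply: ler_peMl; last exact: n1.
  by rewrite !mulr_ge0// ?invr_ge0 ltW.
pose m := (Num.truncn (16 * q)).+1.
have mr : 16 * (n%:R * rho) <= m%:R * r.
  rewrite -ler_pdivrMr// -mulrA -/q; exact: ltW (truncnS_gt _).
have mq : m%:R <= 17 * q.
  rewrite /m -natr1; have : (Num.truncn (16 * q))%:R <= 16 * q.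
    by rewrite truncn_le// mulr_ge0//; lra.
  lra.
have tE : t^-1 = 256 * Q.
  by rewrite /t /del tauE /Q; field; rewrite !gt_eqF.
have mO := measurable_far g rho.
have mHt : measurable (H (1 - tau)) by exact: measurable_homothetic.
have fin X : measurable X -> line_separated K X G ->
    pr (X `&` core) <= (16 + 32 / t) * W ->
    pr X <= (200 * 150) * Q * W + 3 * s.
  move=> mX sX h.
  have h1 := radial_bound n0 r0 ballK distK mX mG sX mr.
  have h2 : pr (X `&` H (1 - scale n 1)) <= pr (X `&` core) + pr [set x | rho < `|x - g|].
    apply: rprob_cover_le => //; [exact: measurableI|exact: measurableI|].
    move=> x [Xx xH]; have [xg|xg] := leP `|x - g| rho; last by right.
    by left; split.
  have h3 : m%:R * W <= 17 * q * W by apply: ler_wpM2r.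
  have h4 : q * W <= Q * W by apply: ler_wpM2r.
  have h5 : W <= Q * W by rewrite ler_peMl//; lra.
  have h6 : 0 <= Q * W by apply: le_trans h5.
  move: h; rewrite tE => h; move: h1; rewrite -/W => h1.
  have h' : pr (X `&` core) <= 16 * W + 8192 * (Q * W).
    by apply: le_trans h _; rewrite le_eqVlt; apply/orP; left; apply/eqP; ring.
  have h3' : m%:R * W <= 17 * (q * W) by rewrite mulrA.
  have h1' : pr X <= 3 * pr (X `&` H (1 - scale n 1)) + 27 * (m%:R * W) by rewrite mulrA.
  have -> : (200 * 150) * Q * W = (200 * 150) * (Q * W) by rewrite mulrA.
  lra.
have [h|h] := core_isoperimetry; [left|right]; apply: fin => //.
- exact: measurableC.
- exact: line_separatedC.
Qed.

End two_sets.
End isoperimetry.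

(** * Densities and Dirichlet form of the chain *)

Section integral_density.
Import HBNNSimple.

(** The density is given on sets, hence on simple functions; monotone convergence extends the
    formula. *)
Lemma integral_density d (T : measurableType d) (R : realType)
    (pi mu : {measure set T -> \bar R}) (nu f : T -> R) :
  is_density pi mu nu -> measurable_fun setT f -> (forall x, 0 <= f x) ->
  (\int[mu]_x (f x)%:E = \int[pi]_x (f x * nu x)%:E)%E.
Proof.
move=> [mnu nu0 muE] mf f0.
have mfE : measurable_fun setT (EFin \o f) by exact/measurable_EFinP.
pose h := nnsfun_approx measurableT mfE.
have h0 k x : 0 <= h k x by exact: fun_ge0.
have hcvg x : (EFin \o h k) x @[k --> \oo] --> (f x)%:E.
  by apply: (cvg_nnsfun_approx measurableT mfE) => // y _; rewrite lee_fin.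
have hnd x a b : (a <= b)%N -> h a x <= h b x.
  by move=> ab; exact/lefP/nd_nnsfun_approx.
have hmeas k : measurable_fun setT (h k) by exact/measurable_funP.
transitivity (limn (fun k => \int[mu]_x (h k x)%:E)%E).
  rewrite -monotone_convergence//.
  - by apply: eq_integral => x _; apply/esym/cvg_lim => //; exact: hcvg.
  - by move=> k; exact/measurable_EFinP.
  - by move=> k x _; rewrite lee_fin.
  - by move=> x _ a b ab; rewrite lee_fin hnd.
transitivity (limn (fun k => \int[pi]_x (h k x * nu x)%:E)%E); last first.
  rewrite -monotone_convergence//.
  - apply: eq_integral => x _; apply/cvg_lim => //.
    under eq_fun do rewrite EFinM.
    by rewrite EFinM; apply: cvgeZr => //; exact: hcvg.
  - by move=> k; apply/measurable_EFinP; exact: measurable_funM.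
  - by move=> k x _; rewrite lee_fin mulr_ge0.
  - by move=> x _ a b ab; rewrite lee_fin ler_wpM2r// hnd.
congr (limn _); apply/funext => k.
have mi y : measurable (h k @^-1` [set y]) by exact: measurable_sfunP.
have pos y x : 0 <= y * \1_(h k @^-1` [set y]) x.
  rewrite indicE; have [|_] := boolP (x \in _); last by rewrite mulr0.
  by rewrite in_setE /= => <-; rewrite mulr1.
have mind y : measurable_fun setT (fun x => y * \1_(h k @^-1` [set y]) x).
  by apply: measurable_funM => //; exact: measurable_indic.
transitivity (\int[mu]_x (\sum_(y \in range (h k)) (y * \1_(h k @^-1` [set y]) x)%:E))%E.
  by apply: eq_integral => x _; rewrite fsumEFin//= -fimfunE.
transitivity (\int[pi]_x (\sum_(y \in range (h k)) (y * \1_(h k @^-1` [set y]) x * nu x)%:E))%E; last first.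
  apply: eq_integral => x _; rewrite fsumEFin//; congr EFin.
  by rewrite [in RHS](fimfunE (h k)) mulr_fsuml.
rewrite !ge0_integral_fsum//.
- apply: eq_fsbigr => y; rewrite in_setE => -[x _ hy].
  have y0 : 0 <= y by rewrite -hy.
  under eq_integral do rewrite EFinM.
  rewrite ge0_integralZl//; last by apply/measurable_EFinP; exact: measurable_indic.
  rewrite integral_indic// setIT muE//.
  rewrite integral_mkcond.
  rewrite -ge0_integralZl//; last 2 first.
  + apply/(measurable_restrictT _ (mi y)).
    have mE : measurable_fun setT (EFin \o nu) by exact/measurable_EFinP.
    exact: (measurable_funTS mE).
  + by move=> z _; apply: erestrict_ge0 => u _; rewrite lee_fin.
  apply: eq_integral => z _; rewrite patchE indicE.
  by case: ifPn => _; rewrite ?mulr1 ?mulr0 ?mul0r ?mule0.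
- by move=> y; apply/measurable_EFinP; apply: measurable_funM.
- by move=> y x _; rewrite lee_fin mulr_ge0.
- by move=> y; apply/measurable_EFinP.
- by move=> y x _; rewrite lee_fin.
Qed.

End integral_density.

Section bounded_functions.
Context d (T : measurableType d) (R : realType) (P : probability T R).

Definition bounded_mfun (f : T -> R) : Prop :=
  measurable_fun setT f /\ exists c, forall x, `|f x| <= c.

Lemma bounded_mfun_cst c : bounded_mfun (fun=> c).
Proof. by split => //; exists `|c|. Qed.

Lemma bounded_mfunD f g : bounded_mfun f -> bounded_mfun g ->
  bounded_mfun (fun x => f x + g x).
Proof.
move=> [mf [a fa]] [mg [b gb]]; split; first exact: measurable_funD.
by exists (a + b) => x; apply: le_trans (ler_normD _ _) _; exact: lerD.
Qed.

Lemma bounded_mfunM f g : bounded_mfun f -> bounded_mfun g ->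
  bounded_mfun (fun x => f x * g x).
Proof.
move=> [mf [a fa]] [mg [b gb]]; split; first exact: measurable_funM.
by exists (a * b) => x; rewrite normrM; exact: ler_pM.
Qed.

Lemma bounded_mfunB f g : bounded_mfun f -> bounded_mfun g ->
  bounded_mfun (fun x => f x - g x).
Proof.
move=> [mf [a fa]] [mg [b gb]]; split; first exact: measurable_funB.
by exists (a + b) => x; apply: le_trans (ler_normB _ _) _; exact: lerD.
Qed.

Lemma bounded_mfun_sqr f : bounded_mfun f -> bounded_mfun (fun x => f x ^+ 2).
Proof.
by move=> bf; have := bounded_mfunM bf bf; congr bounded_mfun; apply/funext => x; rewrite expr2.
Qed.

Lemma bounded_mfun_sum n (f : 'I_n -> T -> R) : (forall i, bounded_mfun (f i)) ->
  bounded_mfun (fun x => \sum_i f i x).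
Proof.
elim: n f => [|n IH] f bf.
  by under eq_fun do rewrite big_ord0; exact: bounded_mfun_cst.
by under eq_fun do rewrite big_ord_recl; apply: bounded_mfunD => //; exact: IH.
Qed.

Lemma bounded_mfun_indic A : measurable A -> bounded_mfun \1_A.
Proof.
move=> mA; split; first exact: measurable_indic.
by exists 1 => x; rewrite indicE ger0_norm// lern1 leq_b1.
Qed.

Lemma bounded_integrable f : bounded_mfun f -> P.-integrable setT (EFin \o f).
Proof.
move=> [mf [c fc]]; apply: measurable_bounded_integrable => //.
  by rewrite -ge0_fin_numE// fin_num_measure.
by exists c; split; [exact: num_real|move=> x cx y _; exact: le_trans (fc y) (ltW cx)].
Qed.

Local Notation Ex := (Rintegral P setT).

Lemma expectE f : bounded_mfun f -> (\int[P]_x (f x)%:E)%E = (Ex f)%:E.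
Proof.
by move=> bf; rewrite /Rintegral fineK//; apply: integrable_fin_num => //; exact: bounded_integrable.
Qed.

Lemma expectD f g : bounded_mfun f -> bounded_mfun g ->
  Ex (fun x => f x + g x) = Ex f + Ex g.
Proof. by move=> bf bg; rewrite RintegralD//; exact: bounded_integrable. Qed.

Lemma expectB f g : bounded_mfun f -> bounded_mfun g ->
  Ex (fun x => f x - g x) = Ex f - Ex g.
Proof. by move=> bf bg; rewrite RintegralB//; exact: bounded_integrable. Qed.

Lemma expectZ c f : bounded_mfun f -> Ex (fun x => c * f x) = c * Ex f.
Proof. by move=> bf; rewrite RintegralZl//; exact: bounded_integrable. Qed.

Lemma expect_cst c : Ex (fun=> c) = c.
Proof. by rewrite Rintegral_cst// -[X in fine X]/(P setT) probability_setT mulr1. Qed.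

Lemma expect_le f g : bounded_mfun f -> bounded_mfun g -> (forall x, f x <= g x) ->
  Ex f <= Ex g.
Proof. by move=> bf bg fg; apply: le_Rintegral => //; exact: bounded_integrable. Qed.

Lemma expect_sum n (f : 'I_n -> T -> R) : (forall i, bounded_mfun (f i)) ->
  Ex (fun x => \sum_i f i x) = \sum_i Ex (f i).
Proof.
elim: n f => [|n IH] f bf.
  by rewrite big_ord0; under eq_fun do rewrite big_ord0; rewrite expect_cst.
rewrite big_ord_recl; under eq_fun do rewrite big_ord_recl.
by rewrite expectD ?IH//; exact: bounded_mfun_sum.
Qed.

Lemma expect_indic A : measurable A -> Ex \1_A = rprob P A.
Proof. by move=> mA; rewrite /Rintegral integral_indic// setIT. Qed.

End bounded_functions.

(** * Averages over chords *)

Section fiber_average.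
Context {R : realType} (n : nat) (K : convex_body R n).
Local Notation KK := (convex_body_set K).
Local Notation mu := (@lebesgue_measure R).
Local Notation Ex := (Rintegral (unif K) setT).
Implicit Types (i : 'I_n) (f g : 'rV[R]_n -> R).

Definition fiber_integral i f (x : 'rV[R]_n) : R :=
  fine (\int[mu]_u (f (set_coord x i u) * \1_KK (set_coord x i u))%:E).

Definition fiber_length i : 'rV[R]_n -> R := fiber_integral i (fun=> 1).

(** Keeping [f x] on a chord of length 0 agrees with the Dirac mass in [unif_fiber]. *)
Definition fiber_average i f x : R :=
  if fiber_length i x == 0 then f x else fiber_integral i f x / fiber_length i x.

Lemma convex_body_bounded : exists2 b, 0 <= b & forall x, KK x -> `|x| <= b.
Proof.
have [N [_ KN]] := compact_bounded (@convex_body_compact _ _ K).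
have N0 : N < `|N| + 1 by rewrite (le_lt_trans (ler_norm _))// ltrDl.
by exists (`|N| + 1); [rewrite addr_ge0|move=> x /(KN _ N0)].
Qed.

Lemma set_coord_nth x i t : set_coord x i t 0 i = t :> R.
Proof. by rewrite mxE eqxx. Qed.

Lemma set_coord_set x i t u : set_coord (set_coord x i t) i u = set_coord x i u :> 'rV[R]_n.
Proof. by apply/rowP => j; rewrite !mxE; case: eqP. Qed.

Definition ge0_bounded c f : Prop :=
  measurable_fun setT f /\ forall x, 0 <= f x <= c.

Lemma ge0_boundedW c f : ge0_bounded c f -> bounded_mfun f.
Proof.
by move=> [mf fc]; split => //; exists c => x; have /andP[f0 fxc] := fc x; rewrite ger0_norm.
Qed.

Let on_body f x : R := f x * \1_KK x.

Let m_on_body f : measurable_fun setT f -> measurable_fun setT (on_body f).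
Proof.
move=> mf; apply: measurable_funM => //; apply: measurable_indic.
exact: measurable_convex_body.
Qed.

Let m_slice f i : measurable_fun setT f ->
  measurable_fun setT (fun q : 'rV[R]_n * measurableTypeR R =>
    (on_body f (set_coord q.1 i q.2))%:E).
Proof.
move=> mf; apply/measurable_EFinP; apply: (measurableT_comp (m_on_body mf)).
exact: measurable_set_coord2.
Qed.

Let on_body_ge0 c f x : ge0_bounded c f -> 0 <= on_body f x.
Proof. by move=> [_ /(_ x) /andP[f0 _]]; rewrite /on_body mulr_ge0. Qed.

Lemma fiber_integralE i c f x : ge0_bounded c f ->
  (\int[mu]_u (f (set_coord x i u) * \1_KK (set_coord x i u))%:E =
   (fiber_integral i f x)%:E)%E.
Proof.
move=> bf; have [mf fc] := bf; rewrite /fiber_integral fineK//.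
have [b b0 Kb] := convex_body_bounded.
have c0 : 0 <= c by have /andP[f0 f0c] := fc 0; exact: le_trans f0c.
rewrite ge0_fin_numE; last by apply: integral_ge0 => u _; rewrite lee_fin (on_body_ge0 _ bf).
pose h u := on_body f (set_coord x i u).
have mh : measurable_fun setT (h : measurableTypeR R -> R).
  have := measurableT_comp (m_slice i mf) (pair1_measurable x).
  by move=> /measurable_EFinP.
pose M := Num.max c b.
have th : tame (fun x : R => `|x|) M h.
  split=> // u; split.
    apply/andP; split; first exact: on_body_ge0 bf.
    rewrite /M le_max /h /on_body indicE; have /andP[_ fle] := fc (set_coord x i u).
    by case: (_ \in _); rewrite ?mulr1 ?fle ?mulr0 ?c0.
  rewrite /M gt_max => /andP[_ bu]; rewrite /h /on_body indicE memNset ?mulr0// => /Kb.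
  have := coord_ler_norm (set_coord x i u) i; rewrite set_coord_nth => ub xb.
  by have := lt_le_trans bu (le_trans ub xb); rewrite ltxx.
exact: le_lt_trans (integral_tame1_le th) (ltry _).
Qed.

Lemma ge0_bounded_cst1 : ge0_bounded 1 (fun=> 1 : R).
Proof. by split => // x; rewrite ler01 lexx. Qed.

Lemma fiber_integral_ge0 i c f x : ge0_bounded c f -> 0 <= fiber_integral i f x.
Proof.
by move=> bf; apply: fine_ge0; apply: integral_ge0 => u _; rewrite lee_fin (on_body_ge0 _ bf).
Qed.

Lemma fiber_length_ge0 i x : 0 <= fiber_length i x.
Proof. exact: fiber_integral_ge0 ge0_bounded_cst1. Qed.

Lemma measurable_fiber_integral i c f : ge0_bounded c f ->
  measurable_fun setT (fiber_integral i f).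
Proof.
move=> bf; have [mf _] := bf; apply: (measurableT_comp (fine_measurable _)) => //.
apply: (measurable_fun_fubini_tonelli_F (m2 := mu)
  (fun q : 'rV[R]_n * measurableTypeR R => (on_body f (set_coord q.1 i q.2))%:E)).
  exact: m_slice.
by move=> q; rewrite lee_fin (on_body_ge0 _ bf).
Qed.

Lemma measurable_fiber_length i : measurable_fun setT (fiber_length i).
Proof. exact: measurable_fiber_integral ge0_bounded_cst1. Qed.

Lemma fiber_integral_set i f x t : fiber_integral i f (set_coord x i t) = fiber_integral i f x.
Proof. by rewrite /fiber_integral; under eq_integral do rewrite set_coord_set. Qed.

Lemma fiber_length_set i x t : fiber_length i (set_coord x i t) = fiber_length i x.
Proof. exact: fiber_integral_set. Qed.

Lemma fiber_integral_le i c f x : ge0_bounded c f ->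
  fiber_integral i f x <= c * fiber_length i x.
Proof.
move=> bf; have [mf fc] := bf.
have c0 : 0 <= c by have /andP[f0 f0c] := fc 0; exact: le_trans f0c.
have m1 : measurable_fun [set: 'rV[R]_n] (fun=> 1 : R) by [].
have mh g : measurable_fun setT g ->
    measurable_fun setT (fun u : measurableTypeR R => (on_body g (set_coord x i u))%:E).
  by move=> mg; exact: measurableT_comp (m_slice i mg) (pair1_measurable x).
rewrite -lee_fin EFinM /fiber_length -(fiber_integralE _ _ bf) -(fiber_integralE _ _ ge0_bounded_cst1).
rewrite -ge0_integralZl//; last exact: mh m1.
apply: ge0_le_integral => //.
- by move=> u _; rewrite lee_fin (on_body_ge0 _ bf).
- exact: mh mf.
- by apply: measurable_funeM; exact: mh m1.
move=> u _; rewrite -EFinM lee_fin mulrA mulr1; apply: ler_wpM2r => //.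
by have /andP[] := fc (set_coord x i u).
Qed.

Lemma ge0_bounded_average i c f : ge0_bounded c f -> ge0_bounded c (fiber_average i f).
Proof.
move=> bf; have [mf fc] := bf; split.
  rewrite /fiber_average; apply: measurable_fun_ifT => //.
    apply: (measurable_fun_bool true); rewrite setTI.
    rewrite (_ : _ @^-1` _ = fiber_length i @^-1` [set 0]).
      by rewrite -[X in measurable X]setTI; exact: measurable_fiber_length.
    by apply/seteqP; split => x /= /eqP.
  apply: measurable_funM; first exact: measurable_fiber_integral bf.
  have -> : (fun x => (fiber_length i x)^-1) = (fun x => fiber_length i x `^ (-1)).
    by apply/funext => x; rewrite powR_inv1// fiber_length_ge0.
  by apply: (measurableT_comp (measurable_powR _)); exact: measurable_fiber_length.
move=> x; rewrite /fiber_average; case: ifPn => // l0.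
have {}l0 : 0 < fiber_length i x by rewrite lt_neqAle eq_sym l0 fiber_length_ge0.
by rewrite divr_ge0 ?(fiber_integral_ge0 _ _ bf) ?fiber_length_ge0//= ler_pdivrMr// fiber_integral_le.
Qed.

Lemma fiber_length_gt0 i x t : KK x -> KK (set_coord x i t) -> t != x 0 i ->
  0 < fiber_length i x.
Proof.
move=> Kx Kt tx.
pose a := Num.min t (x 0 i); pose b := Num.max t (x 0 i).
have ab : a < b by rewrite /a /b; case: (ltgtP t (x 0 i)) tx.
have seg u : a <= u <= b -> KK (set_coord x i u).
  move=> /andP[au ub].
  have key (y z : R) : y < z -> y <= u <= z -> KK (set_coord x i y) -> KK (set_coord x i z) ->
      KK (set_coord x i u).
    move=> yz /andP[yu uz] Ky Kz; have zy0 : 0 < z - y by rewrite subr_gt0.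
    have t01 : 0 <= (u - y) / (z - y) <= 1.
      apply/andP; split; first by rewrite divr_ge0 ?subr_ge0// ltW.
      by rewrite ler_pdivrMr// mul1r lerD2r.
    have := convex_body_conv t01 Ky Kz; congr KK; apply/rowP => j; rewrite !mxE.
    by case: eqP => _; field; rewrite gt_eqF.
  have Kx' : KK (set_coord x i (x 0 i)) by rewrite set_coord_id.
  move: au ub; rewrite /a /b.
  by case: (ltgtP t (x 0 i)) tx => // h _ au ub; [apply: (key t (x 0 i))|apply: (key (x 0 i) t)]; rewrite ?au ?ub.
rewrite -lte_fin /fiber_length -(fiber_integralE i x ge0_bounded_cst1).
apply: (@lt_le_trans _ _ (mu `[a, b]%classic)).
  by rewrite lebesgue_measure_itv/= lte_fin ab -EFinB lte_fin subr_gt0.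
have mab : measurable (`[a, b]%classic : set (measurableTypeR R)) by exact: measurable_itv.
rewrite -[X in mu X]setIT -integral_indic//.
have m1 : measurable_fun [set: 'rV[R]_n] (fun=> 1 : R) by [].
apply: ge0_le_integral => //.
- by apply/measurable_EFinP; exact: (measurable_indic mab).
- exact: measurableT_comp (m_slice i m1) (pair1_measurable x).
move=> u _; rewrite lee_fin mul1r indicE; have [|_] := boolP (u \in _); last exact: ler0n.
by rewrite in_setE /= in_itv/= => /seg Ku; rewrite indicE mem_set.
Qed.

Definition line_constant i (c : 'rV[R]_n -> R) :=
  forall x y, KK x -> KK y -> (forall j, j != i -> x 0 j = y 0 j) -> c x = c y.

(** By convexity, two distinct points of [K] on the line span a chord of positive length, so the
    convention for length 0 does not break constancy. *)
Lemma line_constant_average i f : line_constant i (fiber_average i f).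
Proof.
move=> x y Kx Ky xy.
have yE : y = set_coord x i (y 0 i).
  by apply/rowP => j; rewrite !mxE; case: eqP => [->|/eqP/xy].
have [e|ne] := eqVneq (y 0 i) (x 0 i); first by rewrite yE e set_coord_id.
have l0 : 0 < fiber_length i x.
  by apply: (@fiber_length_gt0 i x (y 0 i)) => //; rewrite -yE.
by rewrite yE /fiber_average fiber_length_set (gt_eqF l0) fiber_integral_set.
Qed.

Lemma fiber_averageM i c c' f h x : KK x -> ge0_bounded c f -> ge0_bounded c' h ->
  line_constant i h ->
  fiber_average i (fun y => f y * h y) x = fiber_average i f x * h x.
Proof.
move=> Kx bf bh lh; rewrite /fiber_average; case: ifPn => // l0.
have [mf fc] := bf; have [mh hc] := bh.
have bfh : ge0_bounded (c * c') (fun y => f y * h y).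
  split; first exact: measurable_funM.
  move=> y; have /andP[? ?] := fc y; have /andP[? ?] := hc y.
  by rewrite mulr_ge0//= ler_pM.
rewrite mulrAC; congr (_ / _); apply: EFin_inj.
rewrite mulrC EFinM -(fiber_integralE i x bfh) -(fiber_integralE i x bf).
rewrite -ge0_integralZl//.
- apply: eq_integral => u _; rewrite -EFinM; congr EFin.
  rewrite indicE; have [|_] := boolP (_ \in _); last by rewrite !mulr0.
  rewrite in_setE => Ku; rewrite !mulr1 mulrC; congr (_ * _).
  by apply: lh => // j ji; rewrite mxE (negbTE ji).
- exact: measurableT_comp (m_slice i mf) (pair1_measurable x).
- by move=> u _; rewrite lee_fin (on_body_ge0 _ bf).
- by have /andP[] := hc x.
Qed.

Lemma is_density_unif : is_density (lebesgue_rV n) (unif K) (fun x => (vol K)^-1 * \1_KK x).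
Proof.
split.
- by apply: measurable_funM => //; apply: measurable_indic; exact: measurable_convex_body.
- by move=> x; rewrite mulr_ge0// invr_ge0 ltW// vol_gt0.
move=> A mA; rewrite integral_mkcond.
transitivity (\int[lebesgue_rV n]_x ((vol K)^-1%:E * (\1_(A `&` KK) x)%:E))%E.
  rewrite ge0_integralZl//.
  - rewrite integral_indic// ?setIT; last by apply: measurableI => //; exact: measurable_convex_body.
    by rewrite [LHS]unifE muleC.
  - by apply/measurable_EFinP; apply: measurable_indic; apply: measurableI => //; exact: measurable_convex_body.
  - by rewrite lee_fin invr_ge0 ltW// vol_gt0.
apply: eq_integral => x _; rewrite patchE -EFinM !indicE in_setI.
by case: (x \in A); rewrite /= ?mulr0.
Qed.

Lemma integral_unif c f : ge0_bounded c f ->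
  (\int[unif K]_x (f x)%:E =
   (vol K)^-1%:E * \int[lebesgue_rV n]_x (f x * \1_KK x)%:E)%E.
Proof.
move=> bf; have [mf fc] := bf.
rewrite (integral_density is_density_unif mf); last by move=> x; have /andP[] := fc x.
rewrite -ge0_integralZl//.
- by apply: eq_integral => x _; rewrite -EFinM mulrCA.
- by apply/measurable_EFinP; exact: m_on_body.
- by move=> x _; rewrite lee_fin (on_body_ge0 _ bf).
- by rewrite lee_fin invr_ge0 ltW// vol_gt0.
Qed.

(* Swapping [x_i] with an independent uniform coordinate of the chord through
   [x] preserves the uniform measure on pairs of points of a common chord. *)
Lemma expect_average i c f : ge0_bounded c f ->
  Ex (fiber_average i f) = Ex f.
Proof.
move=> bf; have bF := ge0_bounded_average i bf; have [mf fc] := bf.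
rewrite /Rintegral (integral_unif bf) (integral_unif bF); congr (fine (_ * _)%E).
have f0 x : 0 <= f x by have /andP[] := fc x.
have lv0 x : 0 <= (fiber_length i x)^-1 by rewrite invr_ge0 fiber_length_ge0.
pose w x : R := if fiber_length i x == 0 then 0 else (fiber_length i x)^-1 * \1_KK x.
have w0 x : 0 <= w x by rewrite /w; case: ifP => // _; rewrite mulr_ge0.
have mK := measurable_convex_body K.
have ml0 : measurable [set x | fiber_length i x == 0].
  rewrite (_ : mkset _ = fiber_length i @^-1` [set 0]).
    by rewrite -[X in measurable X]setTI; exact: measurable_fiber_length.
  by apply/seteqP; split => x /= /eqP.
have mll : measurable_fun setT (fun x => fiber_length i x == 0).
  apply: (measurable_fun_bool true); rewrite setTI; move: ml0; congr measurable.
have mw : measurable_fun setT w.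
  apply: measurable_fun_ifT => //; apply: measurable_funM.
    have -> : (fun x => (fiber_length i x)^-1) = (fun x => fiber_length i x `^ (-1)).
      by apply/funext => x; rewrite powR_inv1// fiber_length_ge0.
    by apply: (measurableT_comp (measurable_powR _)); exact: measurable_fiber_length.
  exact: measurable_indic.
(* Integrated over [t], [F (t, x)] averages [f] over the chord of [x]; after the swap, it leaves
   [f x] inside [K], because [w] integrates to 1 over a chord of positive length. *)
pose F (q : measurableTypeR R * 'rV[R]_n) : \bar R :=
  (w q.2 * on_body f (set_coord q.2 i q.1))%:E.
have mF : measurable_fun setT F.
  apply/measurable_EFinP; apply: measurable_funM.
    by apply: (measurableT_comp mw); exact: measurable_snd.
  apply: (measurableT_comp (m_on_body mf)).
  apply: measurable_fun_rVP => j; under eq_fun do rewrite mxE.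
  case: (j == i); first exact: measurable_fst.
  by apply: (measurableT_comp (measurable_coord j)); exact: measurable_snd.
have F0 q : (0 <= F q)%E by rewrite lee_fin mulr_ge0// (on_body_ge0 _ bf).
pose Z0 := [set x : 'rV[R]_n | fiber_length i x == 0].
pose Z1 := [set x : 'rV[R]_n | fiber_length i x != 0].
(* The chords of length 0, where averaging changes nothing, contribute [z] to both sides. *)
pose z x : R := f x * \1_KK x * \1_Z0 x.
have mz : measurable_fun setT z.
  by apply: measurable_funM; [exact: m_on_body|exact: measurable_indic].
have z0 x : 0 <= z x by rewrite /z !mulr_ge0.
have slice_int (x : 'rV[R]_n) : (\int[mu]_t F (t, x) = (w x * fiber_integral i f x)%:E)%E.
  rewrite /F EFinM -(fiber_integralE i x bf) -ge0_integralZl//.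
  - exact: measurableT_comp (m_slice i mf) (pair1_measurable x).
  - by move=> u _; rewrite lee_fin (on_body_ge0 _ bf).
  - by rewrite lee_fin.
have slice_int' (x : 'rV[R]_n) : (\int[mu]_t F (x 0%R i, set_coord x i t) =
    (f x * \1_KK x * \1_Z1 x)%:E)%E.
  have [l0|l0] := eqVneq (fiber_length i x) 0.
    rewrite [\1_Z1 _]indicE memNset ?mulr0; last by rewrite /Z1/= l0 eqxx.
    by apply: integral0_eq => t _; rewrite /F /= /w fiber_length_set l0 eqxx mul0r.
  rewrite [\1_Z1 _]indicE mem_set//= mulr1.
  transitivity (\int[mu]_t ((f x * \1_KK x / fiber_length i x)%:E *
      (1 * \1_KK (set_coord x i t))%:E))%E.
    apply: eq_integral => t _; rewrite /F /= /w fiber_length_set (negbTE l0).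
    rewrite set_coord_set set_coord_id /on_body -EFinM; congr EFin.
    by rewrite mul1r mulrC mulrA.
  rewrite ge0_integralZl//.
  - by rewrite (fiber_integralE i x ge0_bounded_cst1) -EFinM divfK.
  - have m1 : measurable_fun [set: 'rV[R]_n] (fun=> 1 : R) by [].
    exact: measurableT_comp (m_slice i m1) (pair1_measurable x).
  - by rewrite lee_fin mulr_ge0// (on_body_ge0 _ bf).
transitivity (\int[lebesgue_rV n]_x (z x)%:E +
    \int[lebesgue_rV n]_x \int[mu]_t F (t, x))%E.
  rewrite -ge0_integralD//.
  - apply: eq_integral => x _; rewrite slice_int -EFinD; congr EFin.
    rewrite /z /fiber_average /w [\1_Z0 _]indicE; have [l0|l0] := eqVneq (fiber_length i x) 0.
      by rewrite mem_set ?mulr1 ?mul0r ?addr0// /Z0/= l0 eqxx.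
    rewrite memNset ?mulr0 ?add0r; last by rewrite /Z0/= (negbTE l0).
    by ring.
  - by move=> x _; rewrite lee_fin.
  - exact/measurable_EFinP.
  - by move=> x _; apply: integral_ge0.
  - exact: (measurable_fun_fubini_tonelli_G (m1 := mu) F).
rewrite (ge0_integral_swap_coord i mF F0) -ge0_integralD//.
- apply: eq_integral => x _.
  rewrite slice_int' -EFinD /z -mulrDr [\1_Z0 _]indicE [\1_Z1 _]indicE; congr EFin.
  have [l0|l0] := eqVneq (fiber_length i x) 0.
    rewrite mem_set ?memNset; [by rewrite addr0 mulr1|by rewrite /Z1/= l0 eqxx|by rewrite /Z0/= l0].
  rewrite memNset ?mem_set//; last by rewrite /Z0/= (negbTE l0).
  by rewrite add0r mulr1.
- by move=> x _; rewrite lee_fin.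
- exact/measurable_EFinP.
- by move=> x _; exact: integral_ge0.
- under eq_fun do rewrite slice_int'.
  apply/measurable_EFinP; apply: measurable_funM; first exact: m_on_body.
  apply: measurable_indic; have := measurableC ml0; congr measurable.
  by apply/seteqP; split => x /= /negP.
Qed.

End fiber_average.

Section char_density.
Context {R : realType} (n : nat) (K : convex_body R n).
Local Notation KK := (convex_body_set K).
Local Notation mu := (@lebesgue_measure R).
Local Notation Ex := (Rintegral (unif K) setT).
Local Notation avg := (fiber_average K).

Lemma ge0_bounded_indic (A : set 'rV[R]_n) : measurable A -> ge0_bounded 1 (\1_A : 'rV[R]_n -> R).
Proof.
move=> mA; split; first exact: measurable_indic.
by move=> x; rewrite indicE ler0n lern1 leq_b1.
Qed.

Lemma ge0_boundedM c c' (f g : 'rV[R]_n -> R) : ge0_bounded c f -> ge0_bounded c' g ->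
  ge0_bounded (c * c') (fun x => f x * g x).
Proof.
move=> [mf fc] [mg gc]; split; first exact: measurable_funM.
move=> x; have /andP[? ?] := fc x; have /andP[? ?] := gc x.
by rewrite mulr_ge0//= ler_pM.
Qed.

Lemma expect_eq_body c c' (f g : 'rV[R]_n -> R) : ge0_bounded c f -> ge0_bounded c' g ->
  (forall x, KK x -> f x = g x) -> Ex f = Ex g.
Proof.
move=> bf bg fg; rewrite /Rintegral (integral_unif K bf) (integral_unif K bg).
congr (fine (_ * _)%E); apply: eq_integral => x _; congr EFin.
rewrite indicE; have [|_] := boolP (x \in _); last by rewrite !mulr0.
by rewrite in_setE => /fg ->.
Qed.

(** [avg i] acts as the conditional expectation given the other coordinates: [avg i g] is constant
    on chords and comes out of the average. Symmetry follows. *)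
Lemma expect_averageM i c c' (f g : 'rV[R]_n -> R) : ge0_bounded c f -> ge0_bounded c' g ->
  Ex (fun x => f x * avg i g x) = Ex (fun x => avg i f x * avg i g x).
Proof.
move=> bf bg; have bA := ge0_bounded_average K i bg.
rewrite -(expect_average K i (ge0_boundedM bf bA)).
apply: expect_eq_body.
- by apply: ge0_bounded_average; exact: ge0_boundedM bf bA.
- by apply: ge0_boundedM; [exact: ge0_bounded_average bf|exact: bA].
move=> x Kx; apply: (fiber_averageM Kx bf bA).
exact: line_constant_average.
Qed.

Lemma expect_average_sym i c c' (f g : 'rV[R]_n -> R) : ge0_bounded c f -> ge0_bounded c' g ->
  Ex (fun x => f x * avg i g x) = Ex (fun x => avg i f x * g x).
Proof.
move=> bf bg; rewrite (expect_averageM i bf bg).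
have -> : (fun x => avg i f x * g x) = (fun x => g x * avg i f x).
  by apply/funext => x; rewrite mulrC.
rewrite (expect_averageM i bg bf); congr Ex; apply/funext => x.
by rewrite mulrC.
Qed.

Lemma unif_fiberE x i (A : set 'rV[R]_n) : measurable A ->
  unif_fiber K x i (set_coord x i @^-1` A) = (avg i (\1_A) x)%:E.
Proof.
move=> mA; have bA := ge0_bounded_indic mA.
have mpre (B : set 'rV[R]_n) : measurable B ->
    measurable (set_coord x i @^-1` B : set (measurableTypeR R)).
  by move=> mB; rewrite -[X in measurable X]setTI; exact: measurable_set_coord.
have mK := measurable_convex_body K.
have intE (B : set 'rV[R]_n) : measurable B ->
    mu (set_coord x i @^-1` B `&` fiber K x i) = (fiber_integral K i \1_B x)%:E.
  move=> mB; rewrite -(fiber_integralE K i x (ge0_bounded_indic mB)).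
  have -> : set_coord x i @^-1` B `&` fiber K x i = set_coord x i @^-1` (B `&` KK) by [].
  rewrite -[X in mu X]setIT -integral_indic//; last by apply: mpre; exact: measurableI.
  apply: eq_integral => u _; congr EFin.
  by rewrite !indicE -natrM mulnb -in_setI; congr (nat_of_bool _)%:R; apply/idP/idP; rewrite !in_setE.
have lenE : mu (setT `&` fiber K x i) = (fiber_length K i x)%:E.
  have := intE setT measurableT; rewrite preimage_setT => ->.
  by congr EFin; rewrite /fiber_length /fiber_integral; congr fine; apply: eq_integral => u _;
    rewrite [\1_setT _]indicE in_setT.
have -> : unif_fiber K x i (set_coord x i @^-1` A) =
    if (mu (setT `&` fiber K x i) == 0%E) || (mu (setT `&` fiber K x i) == +oo%E)
    then (\d_(x 0 i : measurableTypeR R) (set_coord x i @^-1` A))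
    else (mu (set_coord x i @^-1` A `&` fiber K x i) *
      (fine (mu (setT `&` fiber K x i)))^-1%:E)%E.
  exact: mnormalizeE.
rewrite lenE intE// orbF eqe /fiber_average; case: ifPn => _ /=; last by rewrite -EFinM.
rewrite diracE indicE; congr (_%:R%:E); congr nat_of_bool.
by apply/idP/idP; rewrite !in_setE /preimage /= set_coord_id.
Qed.

Definition density_step (nu : 'rV[R]_n -> R) (x : 'rV[R]_n) : R :=
  n%:R^-1 * \sum_i avg i nu x.

Lemma char_kernelE x (A : set 'rV[R]_n) : measurable A ->
  char_kernel K x A = (density_step \1_A x)%:E.
Proof.
move=> mA; transitivity ((n%:R^-1)%:E * \sum_i unif_fiber K x i (set_coord x i @^-1` A))%E => //.
under eq_bigr do rewrite unif_fiberE//.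
by rewrite sumEFin -EFinM.
Qed.

Lemma ge0_bounded_step c nu : (0 < n)%N -> ge0_bounded c nu ->
  ge0_bounded c (density_step nu).
Proof.
move=> n0 bnu; have nR : 0 < n%:R :> R by rewrite ltr0n.
have bA i := ge0_bounded_average K i bnu; split.
  apply: measurable_funM => //; apply: measurable_sum => i.
  by case: (bA i).
move=> x; rewrite /density_step; apply/andP; split.
  by rewrite mulr_ge0 ?invr_ge0// sumr_ge0// => i _; have [_ /(_ x)/andP[]] := bA i.
rewrite ler_pdivrMl// mulr_natl -[X in _ *+ X]card_ord -sumr_const.
by apply: ler_sum => i _; have [_ /(_ x)/andP[]] := bA i.
Qed.

Lemma expect_step_sym c c' (f g : 'rV[R]_n -> R) : ge0_bounded c f -> ge0_bounded c' g ->
  Ex (fun x => f x * density_step g x) = Ex (fun x => density_step f x * g x).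
Proof.
move=> bf bg.
have bb (h k : 'rV[R]_n -> R) : ge0_bounded c h -> ge0_bounded c' k -> bounded_mfun (fun x => h x * k x).
  by move=> bh bk; exact: (ge0_boundedW (ge0_boundedM bh bk)).
have -> : (fun x => f x * density_step g x) = (fun x => n%:R^-1 * \sum_i (f x * avg i g x)).
  by apply/funext => x; rewrite /density_step mulrCA mulr_sumr.
have -> : (fun x => density_step f x * g x) = (fun x => n%:R^-1 * \sum_i (avg i f x * g x)).
  by apply/funext => x; rewrite /density_step -mulrA mulr_suml.
have b1 i : bounded_mfun (fun x => f x * avg i g x).
  by apply: bb => //; exact: ge0_bounded_average.
have b2 i : bounded_mfun (fun x => avg i f x * g x).
  by apply: bb => //; exact: ge0_bounded_average.
rewrite !expectZ; [|exact: bounded_mfun_sum|exact: bounded_mfun_sum].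
rewrite !expect_sum//; congr (_ * _); apply: eq_bigr => i _.
exact: (expect_average_sym i bf bg).
Qed.

(** Reversibility: the kernel sends [\1_A] to [density_step \1_A], and symmetry moves the step onto
    the density. *)
Lemma is_density_step (m : {measure set 'rV[R]_n -> \bar R}) c nu : (0 < n)%N ->
  ge0_bounded c nu -> is_density (unif K) m nu ->
  is_density (unif K) (char_step K m) (density_step nu).
Proof.
move=> n0 bnu dnu; have [ms sb] := ge0_bounded_step n0 bnu; split => //.
  by move=> x; have /andP[] := sb x.
move=> A mA; have bA := ge0_bounded_indic mA.
have [msA sA] := ge0_bounded_step n0 bA.
transitivity (\int[m]_x (density_step \1_A x)%:E)%E.
  by apply: eq_integral => x _; exact: char_kernelE.
rewrite (integral_density dnu msA); last by move=> x; have /andP[] := sA x.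
have b1 := ge0_boundedW (ge0_boundedM (ge0_bounded_step n0 bA) bnu).
have b2 := ge0_boundedW (ge0_boundedM bA (ge0_bounded_step n0 bnu)).
rewrite (expectE _ b1) -(expect_step_sym bA bnu) -(expectE _ b2) [RHS]integral_mkcond.
apply: eq_integral => x _; rewrite patchE indicE.
by case: (x \in A); rewrite ?mul1r ?mul0r.
Qed.

Definition chi2 (nu : 'rV[R]_n -> R) : R := Ex (fun x => (nu x - 1) ^+ 2).

Definition dirichlet (nu : 'rV[R]_n -> R) : R :=
  \sum_i Ex (fun x => (nu x - avg i nu x) ^+ 2).

Let bsub (f g : 'rV[R]_n -> R) : bounded_mfun f -> bounded_mfun g ->
  bounded_mfun (fun x => (f x - g x) ^+ 2).
Proof. by move=> bf bg; apply: bounded_mfun_sqr; exact: bounded_mfunB. Qed.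

(** Pythagoras: [nu - avg i nu] is orthogonal to functions constant on chords, among them [avg i nu]
    and 1. *)
Lemma chi2_average i c nu : ge0_bounded c nu ->
  chi2 (avg i nu) = chi2 nu - Ex (fun x => (nu x - avg i nu x) ^+ 2).
Proof.
move=> bnu; have bA := ge0_bounded_average K i bnu.
set a := avg i nu in bA *.
have [fnu fa] := (ge0_boundedW bnu, ge0_boundedW bA).
have f1 := bounded_mfun_cst 'rV[R]_n (1 : R).
have fna := bounded_mfunM fnu fa; have faa := bounded_mfunM fa fa.
have cross : Ex (fun x => nu x * a x) = Ex (fun x => a x * a x).
  exact: (expect_averageM i bnu bnu).
have mean : Ex a = Ex nu by exact: (expect_average K i bnu).
have E1 : Ex (fun x => (nu x - 1) ^+ 2) = Ex (fun x => (nu x - a x) ^+ 2) +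
    (2 * Ex (fun x => nu x * a x) - Ex (fun x => a x * a x) - 2 * Ex nu + 1).
  have -> : (fun x => (nu x - 1) ^+ 2) = (fun x => (nu x - a x) ^+ 2 +
      (2 * (nu x * a x) - a x * a x - 2 * nu x + 1)).
    by apply/funext => x; ring.
  have g1 := bounded_mfunM (bounded_mfun_cst 'rV[R]_n (2 : R)) fna.
  have g2 := bounded_mfunM (bounded_mfun_cst 'rV[R]_n (2 : R)) fnu.
  have g3 := bounded_mfunB g1 faa; have g4 := bounded_mfunB g3 g2.
  rewrite expectD; [|exact: bsub|exact: bounded_mfunD].
  by rewrite (expectD _ g4 f1) (expectB _ g3 g2) (expectB _ g1 faa) !expectZ// expect_cst.
have E2 : Ex (fun x => (a x - 1) ^+ 2) = Ex (fun x => a x * a x) - 2 * Ex a + 1.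
  have -> : (fun x => (a x - 1) ^+ 2) = (fun x => a x * a x - 2 * a x + 1).
    by apply/funext => x; ring.
  have g2 := bounded_mfunM (bounded_mfun_cst 'rV[R]_n (2 : R)) fa.
  by rewrite (expectD _ (bounded_mfunB faa g2) f1) (expectB _ faa g2) !expectZ// expect_cst.
rewrite /chi2 E1 E2 cross mean; ring.
Qed.

Lemma sqr_mean_le (x : 'I_n -> R) : (0 < n)%N ->
  (n%:R^-1 * \sum_i x i) ^+ 2 <= n%:R^-1 * \sum_i x i ^+ 2.
Proof.
move=> n0; have nR : 0 < n%:R :> R by rewrite ltr0n.
set m := n%:R^-1 * _.
have mE : \sum_i x i = n%:R * m by rewrite /m mulVKf// gt_eqF.
have : 0 <= \sum_i (x i - m) ^+ 2 by apply: sumr_ge0 => i _; exact: sqr_ge0.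
have -> : \sum_i (x i - m) ^+ 2 = \sum_i x i ^+ 2 - n%:R * m ^+ 2.
  under eq_bigr do rewrite sqrrB -addrA.
  rewrite !big_split/= -mulr_natl.
  have -> : \sum_(i < n) - (x i * m *+ 2) = - (2 * m * \sum_i x i).
    by rewrite sumrN mulr_sumr; congr (- _); apply: eq_bigr => i _; ring.
  by rewrite mE sumr_const card_ord -mulr_natl; ring.
by rewrite subr_ge0 -ler_pdivlMl.
Qed.

(** Convexity of the square over the [n] directions, then [chi2_average] in each of them. *)
Lemma chi2_step c nu : (0 < n)%N -> ge0_bounded c nu ->
  chi2 (density_step nu) <= chi2 nu - n%:R^-1 * dirichlet nu.
Proof.
move=> n0 bnu; have nR : 0 < n%:R :> R by rewrite ltr0n.
have bA i := ge0_boundedW (ge0_bounded_average K i bnu).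
have f1 := bounded_mfun_cst 'rV[R]_n (1 : R).
have fn := bounded_mfun_cst 'rV[R]_n (n%:R^-1 : R).
have bsum : bounded_mfun (fun x => \sum_i (avg i nu x - 1) ^+ 2).
  by apply: bounded_mfun_sum => i; exact: bsub.
apply: (@le_trans _ _ (Ex (fun x => n%:R^-1 * \sum_i (avg i nu x - 1) ^+ 2))).
  apply: expect_le.
  - by apply: bsub => //; apply: ge0_boundedW (ge0_bounded_step n0 bnu).
  - exact: bounded_mfunM.
  move=> x; apply: le_trans (sqr_mean_le _ n0); rewrite le_eqVlt; apply/orP; left.
  apply/eqP; congr (_ ^+ 2); rewrite /density_step sumrB sumr_const card_ord mulrBr.
  by rewrite mulVf// gt_eqF.
rewrite expectZ// expect_sum; last by move=> i; exact: bsub.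
under eq_bigr do rewrite -/(chi2 _) (chi2_average _ bnu).
by rewrite sumrB sumr_const card_ord mulrBr -[chi2 nu *+ n]mulr_natl mulKf ?gt_eqF.
Qed.

End char_density.

(** * Cheeger's inequality *)

Section median.
Context {R : realType} d (T : measurableType d) (P : probability T R).
Local Notation pr := (rprob P).

Lemma rprob_bigcup_le (F : nat -> set T) (a : R) :
  (forall k, measurable (F k)) -> (forall j k, (j <= k)%N -> F j `<=` F k) ->
  (forall k, pr (F k) <= a) -> pr (\bigcup_k F k) <= a.
Proof.
move=> mF ndF Fa.
have mU : measurable (\bigcup_k F k) by exact: bigcup_measurable.
rewrite -lee_fin -rprobE//.
have cv : (P \o F) k @[k --> \oo] --> P (\bigcup_k F k).
  by apply: nondecreasing_cvg_mu => // j k jk; apply/subsetPset; exact: ndF.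
rewrite -(cvg_lim (@ereal_hausdorff R) cv); apply: lime_le.
  by apply/cvg_ex; exists (P (\bigcup_k F k)).
by apply: nearW => k /=; rewrite rprobE// lee_fin.
Qed.

(** The median is the least level exceeded with probability at most [1 / 2]. Both strict
    inequalities describe increasing unions, so the bounds pass to the limit. *)
Lemma exists_median (f : T -> R) (M : R) : measurable_fun setT f ->
  (forall x, 0 <= f x <= M) ->
  exists m, [/\ 0 <= m <= M, pr [set x | m < f x] <= 2^-1 & pr [set x | f x < m] <= 2^-1].
Proof.
move=> mf f01.
have mgt c : measurable [set x | c < f x] by exact: measurable_ltr_set (measurable_cst _) mf.
have mlt c : measurable [set x | f x < c] by exact: measurable_ltr_set mf (measurable_cst _).
pose E := [set c : R | pr [set x | c < f x] <= 2^-1].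
have EM : E M.
  rewrite /E/= (_ : [set x | M < f x] = set0) ?/rprob ?measure0 ?invr_ge0//.
  apply/seteqP; split => // x /= Mf; have /andP[_] := f01 x.
  by rewrite leNgt Mf.
have Elb : lbound E 0.
  move=> c Ec; rewrite leNgt; apply/negP => c0.
  have : pr [set x | c < f x] <= 2^-1 := Ec.
  rewrite (_ : [set x | c < f x] = setT).
    by rewrite rprobT leNgt invf_lt1// ltr1n.
  by apply/seteqP; split => // x _ /=; have /andP[f0 _] := f01 x; exact: lt_le_trans f0.
have iE : has_inf E by split; [exists M|exists 0].
pose m := inf E.
exists m; split.
- apply/andP; split; first by apply: lb_le_inf => //; exists M.
  by apply: ge_inf => //; exists 0.
- have -> : [set x | m < f x] = \bigcup_k [set x | m + k.+1%:R^-1 < f x].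
    apply/seteqP; split => x /=.
      move=> mx; have fm0 : 0 < f x - m by rewrite subr_gt0.
      have [k _ kf] := near_infty_natSinv_lt (PosNum fm0).
      by exists k => //=; rewrite -ltrBrDl; apply: kf => /=.
    by move=> [k _ /=]; apply: lt_trans; rewrite ltrDl invr_gt0.
  apply: rprob_bigcup_le => //.
    move=> j k jk x /=; apply: le_lt_trans; rewrite lerD2l.
    by rewrite lef_pV2 ?posrE// ler_nat ltnS.
  move=> k; have k0 : 0 < k.+1%:R^-1 :> R by rewrite invr_gt0.
  have [c Ec cm] := inf_adherent k0 iE.
  by apply: le_trans Ec; apply: rprob_le => // x /=; apply: lt_trans.
- have -> : [set x | f x < m] = \bigcup_k [set x | f x < m - k.+1%:R^-1].
    apply/seteqP; split => x /=.
      move=> mx; have fm0 : 0 < m - f x by rewrite subr_gt0.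
      have [k _ kf] := near_infty_natSinv_lt (PosNum fm0).
      by exists k => //=; rewrite ltrBrDr -ltrBrDl; apply: kf => /=.
    by move=> [k _ /=] h; apply: lt_trans h _; rewrite ltrBlDr ltrDl invr_gt0.
  apply: rprob_bigcup_le => //.
    move=> j k jk x /=; move/lt_le_trans; apply; rewrite lerD2l lerN2.
    by rewrite lef_pV2 ?posrE// ler_nat ltnS.
  move=> k; set c := m - _.
  have nE : ~ E c.
    move=> Ec; have lbE : has_lbound E by exists 0.
    have : m <= c by exact: ge_inf lbE _ Ec.
    by rewrite /c lerBrDr gerDl leNgt invr_gt0 ltr0n.
  have : pr [set x | f x < c] + pr [set x | c < f x] <= 1.
    rewrite -rprobU//; first by apply: rprob_le1; exact: measurableU.
    by apply/seteqP; split => // x [/= h1 h2]; have := lt_trans h1 h2; rewrite ltxx.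
  move: nE; rewrite /E /= => /negP; rewrite -ltNge; lra.
Qed.

End median.

Section cheeger.
Context {R : realType} (n : nat) (K : convex_body R n).
Hypothesis n0 : (0 < n)%N.
Local Notation KK := (convex_body_set K).
Local Notation mu := (@lebesgue_measure R).
Local Notation pr := (rprob (unif K)).
Local Notation Ex := (Rintegral (unif K) setT).
Local Notation avg := (fiber_average K).

(* [A] is the inverse of a conductance and [s] the measure of the exceptional
   sets, as in the [s]-conductance of a Markov chain. *)
Definition isoperimetric (A s : R) : Prop :=
  forall (S : set 'rV[R]_n) (G : 'I_n -> set 'rV[R]_n), measurable S ->
    (forall i, measurable (G i)) -> line_separated K S G ->
    pr S <= A * (\sum_i pr (G i)) + s \/ pr (~` S) <= A * (\sum_i pr (G i)) + s.

Variables (A s M : R).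
Hypotheses (A1 : 1 <= A) (s0 : 0 <= s) (M0 : 0 < M).
Hypothesis isoA : isoperimetric A s.

Let nR : 0 < n%:R :> R. Proof. by rewrite ltr0n. Qed.

Let A0 : 0 < A. Proof. exact: lt_le_trans A1. Qed.

Lemma ge0_bounded_sqr (f : 'rV[R]_n -> R) : ge0_bounded M f ->
  ge0_bounded (M ^+ 2) (fun x => f x ^+ 2).
Proof.
by move=> bf; have := ge0_boundedM bf bf; rewrite -expr2; congr ge0_bounded; apply/funext => x; rewrite expr2.
Qed.

(* As [c i] is constant along the direction [e_i], the sets where exactly one of
   [h^2] and [c i ^2] exceeds a level separate the level set of [h^2]; integrate
   over the level. *)
Lemma one_sided_cheeger (h : 'rV[R]_n -> R) (c e : 'I_n -> 'rV[R]_n -> R) :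
  ge0_bounded M h -> (forall i, ge0_bounded M (c i)) ->
  (forall i, line_constant K i (c i)) ->
  (forall i, bounded_mfun (e i)) -> (forall i x, `|h x - c i x| <= `|e i x|) ->
  pr [set x | 0 < h x] <= 2^-1 ->
  Ex (fun x => h x ^+ 2) <=
    2 * A * (1 + 2 * n%:R * A) * (\sum_i Ex (fun x => e i x ^+ 2)) + 2 * s * M ^+ 2.
Proof.
move=> bh bc lc be hce half.
pose h2 x := h x ^+ 2; pose c2 i x := c i x ^+ 2.
have bh2 : ge0_bounded (M ^+ 2) h2 by exact: ge0_bounded_sqr.
have bc2 i : ge0_bounded (M ^+ 2) (c2 i) by exact: ge0_bounded_sqr.
have [mh2 h2M] := bh2.
have mc2 i : measurable_fun setT (c2 i) by case: (bc2 i).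
have [mh hM] := bh.
pose S l := [set x | l < h2 x].
pose G l i := [set x | (c2 i x <= l) && (l < h2 x)] `|` [set x | (h2 x <= l) && (l < c2 i x)].
have mS l : measurable (S l) by exact: measurable_ltr_set (measurable_cst _) mh2.
have mG l i : measurable (G l i).
  have mm (u v : 'rV[R]_n -> R) : measurable_fun setT u -> measurable_fun setT v ->
      measurable [set x | (u x <= l) && (l < v x)].
    move=> mu_ mv; rewrite (_ : mkset _ = [set x | u x <= l] `&` [set x | l < v x]).
      by apply: measurableI; [exact: measurable_ler_set mu_ (measurable_cst _)|
        exact: measurable_ltr_set (measurable_cst _) mv].
    by apply/seteqP; split => x /=; [move/andP|move=> ?; apply/andP].
  by apply: measurableU; exact: mm.
have sep l : line_separated K (S l) (G l).
  move=> i x y Kx Ky xy Sx nSy; have ce : c2 i x = c2 i y by rewrite /c2 (lc i x y).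
  have [cl|cl] := leP (c2 i x) l; first by left; left => /=; rewrite cl.
  right; right => /=; rewrite -ce cl andbT leNgt; exact/negP.
have step l : 0 <= l -> pr (S l) <= A * (\sum_i pr (G l i)) + s.
  move=> l0; have Sl : pr (S l) <= 2^-1.
    apply: le_trans half; apply: rprob_le => //.
      exact: measurable_ltr_set (measurable_cst _) mh.
    move=> x /= lh; have /andP[hx0 _] := hM x; rewrite lt_neqAle hx0 andbT.
    apply/negP => /eqP hx; move: lh; rewrite /S /= /h2 -hx expr0n /=.
    by rewrite ltNge l0.
  (* If the complement is the small side, it still has mass at least [1 / 2], hence at least that of
     [S l]. *)
  have [//|h'] := isoA (mS l) (mG l) (sep l).
  apply: le_trans h'; apply: (le_trans Sl).
  have : pr (S l `|` ~` S l) = 1 by rewrite setUv rprobT.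
  by rewrite rprobU ?setICr//; [move: Sl; lra|exact: measurableC].
(* No level above [M ^ 2] is exceeded, so integrating the error [s] over the levels costs
   [s * M ^ 2]. *)
pose D := `[0, M ^+ 2[%classic : set (measurableTypeR R).
have mD : measurable D by exact: measurable_itv.
have M20 : 0 < M ^+ 2 by rewrite exprn_gt0.
have muD : mu D = (M ^+ 2)%:E by rewrite /D lebesgue_measure_itv/= lte_fin M20 sube0.
have mlev (Z : measurableTypeR R -> set 'rV[R]_n) :
    measurable [set q : 'rV[R]_n * measurableTypeR R | Z q.2 q.1] ->
    measurable_fun setT (fun l => unif K (Z l)).
  move=> mZ; rewrite (_ : (fun l => _) = unif K \o ysection [set q : 'rV[R]_n * measurableTypeR R | Z q.2 q.1]).
    exact: measurable_fun_ysection.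
  apply/funext => l /=; congr (unif K _); apply/seteqP.
  by split => x; rewrite /ysection /mkset in_setE.
have mlt (u : 'rV[R]_n -> R) : measurable_fun setT u ->
    measurable [set q : 'rV[R]_n * measurableTypeR R | q.2 < u q.1].
  move=> mu_; apply: measurable_ltr_set; first exact: measurable_snd.
  by apply: (measurableT_comp mu_); exact: measurable_fst.
have mle (u : 'rV[R]_n -> R) : measurable_fun setT u ->
    measurable [set q : 'rV[R]_n * measurableTypeR R | u q.1 <= q.2].
  move=> mu_; apply: measurable_ler_set; last exact: measurable_snd.
  by apply: (measurableT_comp mu_); exact: measurable_fst.
have mSl : measurable_fun setT (fun l => unif K (S l)).
  by apply: (mlev S); exact: mlt.
have mGl i : measurable_fun setT (fun l => unif K (G l i)).
  apply: (mlev (G^~ i)).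
  rewrite (_ : mkset _ = ([set q | c2 i q.1 <= q.2] `&` [set q | q.2 < h2 q.1]) `|`
      ([set q | h2 q.1 <= q.2] `&` [set q | q.2 < c2 i q.1])).
    by apply: measurableU; apply: measurableI; [exact: mle|exact: mlt|exact: mle|exact: mlt].
  by apply/seteqP; split => q /=; (case=> [/andP[? ?]|/andP[? ?]] || case=> [[a b]|[a b]]);
    [left|right|left|right] => //=; apply/andP.
have int0 : (\int[unif K]_x (h2 x)%:E <= (A * (\sum_i Ex (fun x => `|h2 x - c2 i x|)) + s * M ^+ 2)%:E)%E.
  have bdist i : bounded_mfun (fun x => `|h2 x - c2 i x|).
    have [mb [b bb]] := bounded_mfunB (ge0_boundedW bh2) (ge0_boundedW (bc2 i)).
    split; first exact: measurableT_comp.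
    by exists b => x; rewrite normr_id.
  rewrite (layer_cake (unif K) mh2); last by move=> x; have /andP[] := h2M x.
  apply: (@le_trans _ _ (\int[mu]_l (A%:E * (\sum_i unif K (G l i)) + s%:E * (\1_D l)%:E))%E).
    rewrite integral_mkcond; apply: ge0_le_integral => //.
    - by move=> l _; apply: erestrict_ge0.
    - apply/(measurable_restrictT _ (measurable_itv _)).
      exact: (measurable_funTS mSl).
    - apply: emeasurable_funD; apply: measurable_funeM.
        by apply: emeasurable_sum => i; exact: mGl.
      by apply/measurable_EFinP; exact: measurable_indic.
    move=> l _; rewrite patchE; case: ifPn => [|_]; last first.
      by rewrite adde_ge0// mule_ge0 ?lee_fin ?sume_ge0 ?(ltW A0).
    rewrite in_setE /= in_itv/= andbT => l0.
    have [lM|lM] := ltP l (M ^+ 2); last first.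
      rewrite (_ : mkset _ = set0) ?measure0.
        by rewrite adde_ge0// mule_ge0 ?lee_fin ?sume_ge0 ?(ltW A0).
      apply/seteqP; split => // x; rewrite /= ltNge => /negP; apply.
      by have /andP[_ h2x] := h2M x; exact: le_trans lM.
    rewrite indicE mem_set; last by rewrite /D/= in_itv/= l0.
    have -> : (\sum_i unif K (G l i) = (\sum_i pr (G l i))%:E)%E.
      by rewrite -sumEFin; apply: eq_bigr => i _; exact: rprobE.
    rewrite mule1 -EFinM -EFinD.
    apply: (@le_trans _ _ (pr (S l))%:E); last by rewrite lee_fin; exact: step.
    by rewrite -rprobE.
  rewrite ge0_integralD//.
  - rewrite ge0_integralZl//.
    + rewrite ge0_integral_sum//.
      rewrite ge0_integralZl//; last by apply/measurable_EFinP; exact: measurable_indic.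
      rewrite integral_indic// setIT [X in (_ + _ * X <= _)%E]muD -EFinM EFinD [(A * _)%:E]EFinM -sumEFin leeD2r// lee_pmul2l//=.
      apply: lee_sum => i _; rewrite -(expectE _ (bdist i)).
      by rewrite (integral_dist_level (unif K) mh2 (mc2 i)).
    + by apply: emeasurable_sum => i; exact: mGl.
    + by move=> l _; exact: sume_ge0.
    + by rewrite lee_fin ltW.
  - by move=> l _; rewrite mule_ge0 ?lee_fin ?sume_ge0 ?(ltW A0).
  - by apply: measurable_funeM; apply: emeasurable_sum => i; exact: mGl.
  - by move=> l _; rewrite mule_ge0 ?lee_fin.
  - by apply: measurable_funeM; apply/measurable_EFinP; exact: measurable_indic.
have fh2 := ge0_boundedW bh2.
move: int0; rewrite (expectE _ fh2) lee_fin => int0.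
(* With this value, [A * n * beta = 1 / 2]: half of [Ex h2] is absorbed by the left-hand side. *)
pose beta := (2 * n%:R * A)^-1.
have beta0 : 0 < beta by rewrite invr_gt0 !mulr_gt0.
have fe i : bounded_mfun (fun x => e i x ^+ 2) by exact: bounded_mfun_sqr.
have dist i : Ex (fun x => `|h2 x - c2 i x|) <=
    beta * Ex h2 + (1 + beta^-1) * Ex (fun x => e i x ^+ 2).
  have f1 := bounded_mfunM (bounded_mfun_cst 'rV[R]_n beta) fh2.
  have f2 := bounded_mfunM (bounded_mfun_cst 'rV[R]_n (1 + beta^-1)) (fe i).
  rewrite -(expectZ _ _ fh2) -(expectZ _ _ (fe i)) -expectD//.
  apply: expect_le.
  - have [mb [b bb]] := bounded_mfunB fh2 (ge0_boundedW (bc2 i)).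
    split; first exact: measurableT_comp.
    by exists b => x; rewrite normr_id.
  - exact: bounded_mfunD.
  move=> x; rewrite /h2 /c2 subr_sqr normrM.
  have /andP[hx0 _] := hM x; have [_ /(_ x)/andP[cx0 _]] := bc i.
  have := hce i x; set d := `|h x - c i x| => dle.
  have d0 : 0 <= d by exact: normr_ge0.
  have hc : `|h x + c i x| <= 2 * h x + d.
    rewrite ger0_norm ?addr_ge0//.
    have : c i x - h x <= d by rewrite /d distrC; exact: ler_norm.
    lra.
  have de : d ^+ 2 <= e i x ^+ 2 by rewrite -[leRHS]real_normK ?num_real// lerXn2r ?nnegrE.
  apply: (@le_trans _ _ (d * (2 * h x + d))); first exact: ler_wpM2l.
  apply: (@le_trans _ _ (beta * h x ^+ 2 + (1 + beta^-1) * d ^+ 2)).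
    (* AM-GM: [2 d h <= beta h^2 + d^2 / beta] *)
    have : 0 <= beta * (h x - d / beta) ^+ 2 by rewrite mulr_ge0 ?sqr_ge0// ltW.
    have -> : beta * (h x - d / beta) ^+ 2 = beta * h x ^+ 2 - 2 * d * h x + beta^-1 * d ^+ 2.
      by field; rewrite gt_eqF.
    lra.
  by rewrite lerD2l ler_wpM2l// addr_ge0// invr_ge0 ltW.
have sumd : \sum_i Ex (fun x => `|h2 x - c2 i x|) <=
    n%:R * beta * Ex h2 + (1 + beta^-1) * \sum_i Ex (fun x => e i x ^+ 2).
  apply: le_trans (ler_sum _ (fun i _ => dist i)) _.
  by rewrite big_split /= sumr_const card_ord -mulr_sumr -mulrA mulr_natl.
have AB : A * (n%:R * beta) = 2^-1 by rewrite /beta; field; rewrite !gt_eqF.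
have Bi : beta^-1 = 2 * n%:R * A by rewrite invrK.
have := ler_wpM2l (ltW A0) sumd; rewrite mulrDr mulrA AB Bi => h'.
move: int0 h'; rewrite -/(Ex h2).
set X := Ex h2; set Y := \sum_i Ex (fun x => `|_|); set Z := \sum_i _.
rewrite -[X in _ -> _ -> X <= _]/X => i0 i1; lra.
Qed.

(** Above and below a median, [pos nu] and [neg nu] are each positive with probability at most
    [1 / 2]. Taking positive parts is 1-Lipschitz, so [nu - avg i nu] controls both. *)
Lemma cheeger (nu : 'rV[R]_n -> R) : ge0_bounded M nu -> Ex nu = 1 ->
  chi2 K nu <= 4 * A * (1 + 2 * n%:R * A) * dirichlet K nu + 4 * s * M ^+ 2.
Proof.
move=> bnu nu1; have [mnu nuM] := bnu.
have [m [/andP[m0 mM] half1 half2]] := exists_median (unif K) mnu nuM.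
have bA i := ge0_bounded_average K i bnu.
have fnu := ge0_boundedW bnu; have fA i := ge0_boundedW (bA i).
pose pos u (x : 'rV[R]_n) : R := Num.max 0 (u x - m).
pose neg u (x : 'rV[R]_n) : R := Num.max 0 (m - u x).
have bpos u : ge0_bounded M u -> ge0_bounded M (pos u).
  move=> [mu_ uM]; split.
    by apply: measurable_maxr => //; exact: measurable_funB.
  move=> x; have /andP[u0 ux] := uM x; rewrite /pos le_max lexx /= ge_max (ltW M0)/=; lra.
have bneg u : ge0_bounded M u -> ge0_bounded M (neg u).
  move=> [mu_ uM]; split.
    by apply: measurable_maxr => //; exact: measurable_funB.
  move=> x; have /andP[u0 ux] := uM x; rewrite /neg le_max lexx /= ge_max (ltW M0)/=; lra.
have lip (a b : R) : `|Num.max 0 a - Num.max 0 b| <= `|a - b|.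
  rewrite ler_norml; have := ler_norm (a - b); have := ler_norm (b - a); rewrite distrC.
  by case: (leP 0 a) => ?; case: (leP 0 b) => ? ? ?; apply/andP; split; lra.
have half1' : pr [set x | 0 < pos nu x] <= 2^-1.
  rewrite (_ : mkset _ = [set x | m < nu x])//.
  by apply/seteqP; split => x /=; rewrite /pos lt_max ltxx /= subr_gt0.
have half2' : pr [set x | 0 < neg nu x] <= 2^-1.
  rewrite (_ : mkset _ = [set x | nu x < m])//.
  by apply/seteqP; split => x /=; rewrite /neg lt_max ltxx /= subr_gt0.
have be i := bounded_mfunB fnu (fA i).
have lA i : line_constant K i (avg i nu) by exact: line_constant_average.
have P1 := @one_sided_cheeger (pos nu) (fun i => pos (avg i nu))
  (fun i x => nu x - avg i nu x) (bpos _ bnu) (fun i => bpos _ (bA i))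
  (fun i x y Kx Ky xy => congr1 (fun a => Num.max 0 (a - m)) (lA i x y Kx Ky xy)) be.
have P2 := @one_sided_cheeger (neg nu) (fun i => neg (avg i nu))
  (fun i x => nu x - avg i nu x) (bneg _ bnu) (fun i => bneg _ (bA i))
  (fun i x y Kx Ky xy => congr1 (fun a => Num.max 0 (m - a)) (lA i x y Kx Ky xy)) be.
have {}P1 := P1 (fun i x => _) half1'; have {}P2 := P2 (fun i x => _) half2'.
have e1 : forall i x, `|pos nu x - pos (avg i nu) x| <= `|nu x - avg i nu x|.
  by move=> i x; apply: le_trans (lip _ _) _; rewrite opprB addrA subrK.
have e2 : forall i x, `|neg nu x - neg (avg i nu) x| <= `|nu x - avg i nu x|.
  by move=> i x; apply: le_trans (lip _ _) _; rewrite opprB addrC addrA subrK distrC.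
have {}P1 := P1 e1; have {}P2 := P2 e2.
have fm := bounded_mfun_cst 'rV[R]_n m.
have f1 := bounded_mfun_cst 'rV[R]_n (1 : R).
have split2 : Ex (fun x => (nu x - m) ^+ 2) =
    Ex (fun x => pos nu x ^+ 2) + Ex (fun x => neg nu x ^+ 2).
  rewrite -expectD; [|by apply: bounded_mfun_sqr; exact: ge0_boundedW (bpos _ bnu)|
    by apply: bounded_mfun_sqr; exact: ge0_boundedW (bneg _ bnu)].
  congr Ex; apply/funext => x; rewrite /pos /neg.
  case: (leP 0 (nu x - m)) => h1; case: (leP 0 (m - nu x)) => h2.
  - have -> : nu x = m by lra.
    ring.
  - ring.
  - ring.
  - by exfalso; lra.
(* The mean, here 1, minimizes the mean square deviation. *)
have var : chi2 K nu <= Ex (fun x => (nu x - m) ^+ 2).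
  have g1 : bounded_mfun (fun x => (nu x - 1) ^+ 2).
    by apply: bounded_mfun_sqr; exact: bounded_mfunB.
  have g2 := bounded_mfunM (bounded_mfun_cst 'rV[R]_n (2 * (1 - m))) (bounded_mfunB fnu f1).
  have g3 := bounded_mfun_cst 'rV[R]_n ((1 - m) ^+ 2).
  have -> : (fun x => (nu x - m) ^+ 2) =
      (fun x => (nu x - 1) ^+ 2 + 2 * (1 - m) * (nu x - 1) + (1 - m) ^+ 2).
    by apply/funext => x; ring.
  rewrite (expectD _ (bounded_mfunD g1 g2) g3) (expectD _ g1 g2).
  rewrite (expectZ _ _ (bounded_mfunB fnu f1)) (expectB _ fnu f1) !expect_cst nu1.
  by rewrite subrr mulr0 addr0 lerDl sqr_ge0.
apply: le_trans var _; rewrite split2 /dirichlet; lra.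
Qed.

End cheeger.

(** * Mixing times *)

Section mixing.
Context {R : realType} (n : nat) (K : convex_body R n).
Hypothesis n0 : (0 < n)%N.
Local Notation KK := (convex_body_set K).
Local Notation pr := (rprob (unif K)).
Local Notation Ex := (Rintegral (unif K) setT).

Let nR : 0 < n%:R :> R. Proof. by rewrite ltr0n. Qed.

Lemma expect_density (m : probability 'rV[R]_n R) c nu : ge0_bounded c nu ->
  is_density (unif K) m nu -> Ex nu = 1.
Proof.
move=> bnu [_ _ /(_ setT measurableT)]; rewrite (expectE _ (ge0_boundedW bnu)).
move=> mE; have : (Ex nu)%:E = 1%E by rewrite -mE; exact: probability_setT.
by case.
Qed.

Lemma expect_step c nu : ge0_bounded c nu -> Ex (density_step K nu) = Ex nu.
Proof.
move=> bnu; have bA i := ge0_boundedW (ge0_bounded_average K i bnu).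
rewrite /density_step expectZ; last exact: bounded_mfun_sum.
rewrite expect_sum//; under eq_bigr do rewrite (expect_average K _ bnu).
by rewrite sumr_const card_ord -[Ex nu *+ n]mulr_natl mulKf// gt_eqF.
Qed.

(** From [nu ^ 2 <= c * nu], which makes the bound linear in [c]. *)
Lemma chi2_le c nu : ge0_bounded c nu -> Ex nu = 1 -> chi2 K nu <= c - 1.
Proof.
move=> bnu nu1; have [_ nuc] := bnu.
have fnu := ge0_boundedW bnu; have f1 := bounded_mfun_cst 'rV[R]_n (1 : R).
have g1 := bounded_mfunM (bounded_mfun_cst 'rV[R]_n (c - 2)) fnu.
apply: (@le_trans _ _ (Ex (fun x => (c - 2) * nu x + 1))).
  apply: expect_le.
  - by apply: bounded_mfun_sqr; exact: bounded_mfunB.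
  - exact: bounded_mfunD.
  by move=> x; have /andP[a b] := nuc x; nra.
by rewrite (expectD _ g1 f1) (expectZ _ _ fnu) expect_cst nu1; lra.
Qed.

Lemma L2_closeP (mu0 : probability 'rV[R]_n R) eps t c nu : 0 < eps ->
  ge0_bounded c nu -> is_density (unif K) (char_law K mu0 t) nu ->
  chi2 K nu < eps ^+ 2 -> L2_close K mu0 eps t.
Proof.
move=> e0 bnu dnu lt; exists nu => //; have [mnu nuc] := bnu.
have mK := measurable_convex_body K.
have sq (f : 'rV[R]_n -> R) : bounded_mfun f -> exists b, ge0_bounded b (fun x => f x ^+ 2).
  move=> bf; have [msq [b bb]] := bounded_mfun_sqr bf; exists b; split => // x.
  by rewrite sqr_ge0 (le_trans (ler_norm _) (bb x)).
have f1 := bounded_mfun_cst 'rV[R]_n (1 : R).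
have fK := bounded_mfun_indic R mK.
have [b1 B1] := sq _ (bounded_mfunB (ge0_boundedW bnu) f1).
have [b2 B2] := sq _ (bounded_mfunB (ge0_boundedW bnu) fK).
have E : Ex (fun x => (nu x - \1_KK x) ^+ 2) = chi2 K nu.
  apply: (expect_eq_body B2 B1) => x Kx.
  by rewrite indicE mem_set.
rewrite unlock.
have -> : (\int[unif K]_x (`|(EFin \o (nu \- \1_KK)%R) x| `^ 2) =
    (chi2 K nu)%:E)%E.
  rewrite -E -(expectE _ (ge0_boundedW B2)); apply: eq_integral => x _ /=.
  by rewrite powR_mulrn// real_normK// num_real.
rewrite poweR_EFin lte_fin.
have v0 : 0 <= chi2 K nu by apply: Rintegral_ge0 => x _; exact: sqr_ge0.
by rewrite powR12_sqrt// -(ger0_norm (ltW e0)) -sqrtr_sqr ltr_sqrt// exprn_gt0.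
Qed.

(** The bound on [nu] holds only almost everywhere, and a null set may contain a whole chord.
    Truncation gives a pointwise bound and a density of the same measure. *)
Lemma truncated_density (m : {measure set 'rV[R]_n -> \bar R}) nu M :
  is_density (unif K) m nu -> ('N[unif K]_+oo[EFin \o nu] < M%:E)%E -> 0 <= M ->
  ge0_bounded M (fun x => Num.min (nu x) M) /\
  is_density (unif K) m (fun x => Num.min (nu x) M).
Proof.
move=> [mnu nu0 mE] NM M0.
have mm : measurable_fun setT (fun x => Num.min (nu x) M).
  by apply: measurable_minr.
have m0 x : 0 <= Num.min (nu x) M by rewrite le_min nu0.
split; first by split => // x; rewrite m0 ge_min lexx orbT.
split => // A mA; rewrite mE//.
have ae : {ae unif K, forall x, nu x <= M}.
  have P0 : (0 < unif K setT)%E by rewrite (@probability_setT _ _ _ (unif K)).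
  move: NM; rewrite unlock P0 => /ltW /ess_supP; apply: filterS => x /=.
  by rewrite lee_fin; apply: le_trans; exact: ler_norm.
apply: ge0_ae_eq_integral => //.
- by apply: measurable_funTS; exact/measurable_EFinP.
- by apply: measurable_funTS; exact/measurable_EFinP.
- by move=> x _; rewrite lee_fin.
- by move=> x _; rewrite lee_fin.
by apply: filterS ae => x h _; rewrite min_l.
Qed.

Section run.
Variables (mu0 : probability 'rV[R]_n R) (nu : 'rV[R]_n -> R) (M : R).
Hypotheses (bnu : ge0_bounded M nu) (dnu : is_density (unif K) mu0 nu).

Definition density_at t := iter t (density_step K) nu.

Lemma ge0_bounded_at t : ge0_bounded M (density_at t).
Proof. by elim: t => [//|t IH]; exact: ge0_bounded_step. Qed.

Lemma expect_at t : Ex (density_at t) = 1.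
Proof.
elim: t => [|t IH]; first exact: expect_density bnu dnu.
by rewrite /= (expect_step (ge0_bounded_at t)).
Qed.

Lemma is_density_at t : is_density (unif K) (char_law K mu0 t) (density_at t).
Proof.
elim: t => [//|t IH]; exact: (is_density_step n0 (ge0_bounded_at t) IH).
Qed.

Lemma initial_ge1 : 1 <= M.
Proof.
rewrite -(expect_at 0) -[leRHS](expect_cst (unif K)).
apply: expect_le; [exact: ge0_boundedW bnu|exact: bounded_mfun_cst|].
by move=> x; have [_ /(_ x)/andP[]] := bnu.
Qed.

Lemma dirichlet_ge0 f : 0 <= dirichlet K f.
Proof. by apply: sumr_ge0 => i _; apply: Rintegral_ge0 => x _; exact: sqr_ge0. Qed.

Lemma chi2_at_le t : chi2 K (density_at t) <= M - 1.
Proof. exact: chi2_le (ge0_bounded_at t) (expect_at t). Qed.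

(** The excess over [4 * s * M ^ 2] decays geometrically. As [4 * A * (1 + 2 * n * A) <= 12 * n * A
    ^ 2], a step removes [D / n], at least the fraction [(12 * (n * A) ^ 2)^-1] of the excess. *)
Lemma chi2_decay A s t : 1 <= A -> 0 <= s -> isoperimetric K A s ->
  chi2 K (density_at t) <= 4 * s * M ^+ 2 +
    (1 - (12 * (n%:R * A) ^+ 2)^-1) ^+ t * (M - 1).
Proof.
move=> A1 s0 iso; have M1 := initial_ge1.
have A0 : 0 < A by exact: lt_le_trans A1.
have nA1 : 1 <= n%:R * A by rewrite mulr_ege1// ler1n.
set lam := _^-1; set V := fun t => chi2 K (density_at t).
have lam01 : 0 <= lam <= 1.
  rewrite invr_ge0 mulr_ge0 ?sqr_ge0//= invf_le1; last by rewrite mulr_gt0// exprn_gt0// mulr_gt0.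
  by have := exprn_ege1 2 nA1; lra.
have s4 : 0 <= 4 * s * M ^+ 2 by apply: mulr_ge0; [exact: mulr_ge0|exact: sqr_ge0].
have main : V t - 4 * s * M ^+ 2 <= (1 - lam) ^+ t * (M - 1).
  elim: t => [|t IH].
    by rewrite expr0 mul1r; apply: le_trans (chi2_at_le 0); rewrite gerBl.
  rewrite [_ ^+ t.+1]exprS -[leRHS]mulrA; apply: le_trans (ler_wpM2l _ IH); last first.
    by rewrite subr_ge0; case/andP: lam01.
  have step := chi2_step K n0 (ge0_bounded_at t).
  have M0 : 0 < M by exact: lt_le_trans M1.
  have ch := cheeger n0 A1 s0 M0 iso (ge0_bounded_at t) (expect_at t).
  have D0 := dirichlet_ge0 (density_at t).
  set D := dirichlet K (density_at t) in step ch D0.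
  have VD : lam * (V t - 4 * s * M ^+ 2) <= n%:R^-1 * D.
    have bd : 4 * A * (1 + 2 * n%:R * A) <= 12 * n%:R * A ^+ 2.
      have : A <= n%:R * A ^+ 2 by rewrite expr2 mulrA; apply: ler_peMl => //; exact: ltW.
      nra.
    have h : V t - 4 * s * M ^+ 2 <= 12 * n%:R * A ^+ 2 * D.
      by rewrite lerBlDr; apply: le_trans ch _; rewrite lerD2r; exact: ler_wpM2r.
    apply: le_trans (ler_wpM2l (_ : 0 <= lam) h) _; first by case/andP: lam01.
    rewrite le_eqVlt; apply/orP; left; apply/eqP; rewrite /lam.
    by field; rewrite !gt_eqF.
  have : V t.+1 <= V t - n%:R^-1 * D by exact: step.
  move: VD; clear; move: (n%:R^-1 * D) (V t.+1) (V t) => a b c; lra.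
by rewrite -lerBlDl.
Qed.

End run.

(** [M - 1 <= (M / 2) ^ 2 < eps ^ 2]. This settles the range where [ln (M / eps)] has no positive
    lower bound. *)
Lemma mixing_trivial (mu0 : probability 'rV[R]_n R) nu0 M eps :
  is_density (unif K) mu0 nu0 -> ('N[unif K]_+oo[EFin \o nu0] < M%:E)%E ->
  0 < eps -> M < 2 * eps -> mixed_after K mu0 eps 0.
Proof.
move=> dnu NM e0 Me t _.
have M0 : 0 <= M by rewrite -lee_fin; apply: le_trans (ltW NM); exact: Lnorm_ge0.
have [bnu dnu'] := truncated_density dnu NM M0.
apply: (L2_closeP e0 (ge0_bounded_at bnu t) (is_density_at bnu dnu' t)).
apply: le_lt_trans (chi2_at_le bnu dnu' t) _.
have := sqr_ge0 (M - 2); nra.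
Qed.

Lemma mixing_isoperimetric (mu0 : probability 'rV[R]_n R) nu0 M eps A s :
  is_density (unif K) mu0 nu0 -> ('N[unif K]_+oo[EFin \o nu0] < M%:E)%E ->
  0 < eps -> 2 * eps <= M -> 1 <= A -> 0 <= s -> 8 * s * M ^+ 2 <= eps ^+ 2 ->
  isoperimetric K A s ->
  exists2 T : nat, mixed_after K mu0 eps T &
    T%:R <= 60 * (n%:R * A) ^+ 2 * ln (M / eps).
Proof.
move=> dnu NM e0 eM A1 s0 sM iso.
have M0 : 0 < M by lra.
have [bnu dnu'] := truncated_density dnu NM (ltW M0).
have M1 := initial_ge1 bnu dnu'.
pose L := ln (M / eps); pose B := 12 * (n%:R * A) ^+ 2.
have q2 : 2 <= M / eps by rewrite ler_pdivlMr.
have q0 : 0 < M / eps by lra.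
have L2 : 2^-1 <= L by apply: le_trans (ln2_ge R) _; rewrite ler_ln ?posrE.
have A0 : 0 < A by exact: lt_le_trans A1.
have nA1 : 1 <= n%:R * A by rewrite mulr_ege1// ler1n.
have B1 : 12 <= B by have := exprn_ege1 2 nA1; rewrite /B; lra.
have B0 : 0 < B by lra.
(* After [3 * L * B] steps the decay factor is at most [(eps / M) ^ 3], which times [M] is at most
   [eps ^ 2 / 2]; the term with [s] takes the other half. Rounding up is absorbed by passing from 3
   to 5, and [5 * 12 = 60]. *)
exists (Num.truncn (3 * L * B)).+1; last first.
  rewrite -natr1; have : (Num.truncn (3 * L * B))%:R <= 3 * L * B.
    by rewrite truncn_le// !mulr_ge0//; lra.
  rewrite (_ : 60 * (n%:R * A) ^+ 2 * ln (M / eps) = 5 * (L * B)); last first.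
    by rewrite /L /B; ring.
  have LB : 6 <= L * B by rewrite (_ : 6 = 2^-1 * 12) ?ler_pM//; field.
  by rewrite -mulrA; move: LB; move: (L * B) ((Num.truncn _)%:R) => u v; lra.
move=> t tT.
apply: (L2_closeP e0 (ge0_bounded_at bnu t) (is_density_at bnu dnu' t)).
apply: le_lt_trans (chi2_decay bnu dnu' t A1 s0 iso) _.
have tL : 3 * L * B <= t%:R.
  by apply: le_trans (ltW (truncnS_gt _)) _; rewrite ler_nat.
have lt : (1 - B^-1) ^+ t <= expR (- (3 * L)).
  apply: (@le_trans _ _ (expR (- B^-1) ^+ t)).
    apply: lerXn2r; rewrite ?nnegrE ?expR_ge0//; last exact: expR_ge1Dx.
    by rewrite subr_ge0 invf_le1//; lra.
  by rewrite -expRM_natl ler_expR mulrN lerN2 ler_pdivlMr.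
have e3 : expR (- (3 * L)) = (eps / M) ^+ 3.
  by rewrite -mulrN expRM_natl expRN /L lnK ?posrE// invf_div.
have em : (eps / M) <= 2^-1 by rewrite ler_pdivrMr//; lra.
have em0 : 0 < eps / M by rewrite divr_gt0.
have fin : (eps / M) ^+ 3 * M <= eps ^+ 2 / 2.
  have -> : (eps / M) ^+ 3 * M = (eps / M) * (eps ^+ 2 / M) by field; rewrite gt_eqF.
  have E0 : 0 <= eps ^+ 2 / M by rewrite divr_ge0 ?sqr_ge0// ltW.
  have E1 : eps ^+ 2 / M <= eps ^+ 2 by rewrite ler_pdivrMr// ler_peMr// sqr_ge0.
  by rewrite [leRHS]mulrC ler_pM// ltW.
have lt2 : (1 - B^-1) ^+ t * (M - 1) < (eps / M) ^+ 3 * M.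
  apply: (@le_lt_trans _ _ ((eps / M) ^+ 3 * (M - 1))).
    by rewrite -e3; apply: ler_wpM2r => //; rewrite subr_ge0.
  by rewrite ltr_pM2l ?exprn_gt0// gtrBl.
rewrite -/B; lra.
Qed.

End mixing.

Lemma markov_expect d (T : measurableType d) (R : realType) (P : probability T R)
  (f : T -> R) a : bounded_mfun f -> (forall x, 0 <= f x) ->
  a * rprob P [set x | a < f x] <= Rintegral P setT f.
Proof.
move=> bf f0; have mA := measurable_ltr_set (measurable_cst a) bf.1.
have bA := bounded_mfun_indic R mA.
rewrite -(expect_indic P mA) -(expectZ _ _ bA); apply: expect_le => //.
  exact: bounded_mfunM (bounded_mfun_cst T a) bA.
move=> x; rewrite indicE; case: (boolP (x \in _)) => [|_]; last by rewrite mulr0.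
by rewrite in_setE /= mulr1 => /ltW.
Qed.

(** * Second moment and distance from the centroid *)

Section second_moment.
Context {R : realType} (n : nat) (K : convex_body R n).
Hypothesis n0 : (0 < n)%N.
Local Notation KK := (convex_body_set K).
Local Notation pr := (rprob (unif K)).
Local Notation Ex := (Rintegral (unif K) setT).
Local Notation g := (centroid K).
Local Notation R2 := (mean_sqr_dist_centroid K).

Let nR : 0 < n%:R :> R. Proof. by rewrite ltr0n. Qed.

Definition sqr_dist (x : 'rV[R]_n) : R := \sum_(i < n) (x 0 i - g 0 i) ^+ 2.

(** Cut off outside [K] to be bounded; its expectation under [unif K] stays the same. *)
Definition sqr_dist_in (x : 'rV[R]_n) : R := sqr_dist x * \1_KK x.

Lemma sqr_dist_ge0 x : 0 <= sqr_dist x.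
Proof. by apply: sumr_ge0 => i _; exact: sqr_ge0. Qed.

Lemma measurable_sqr_dist : measurable_fun setT sqr_dist.
Proof.
apply: measurable_sum => i; apply: measurable_funX.
by apply: measurable_funB; [exact: measurable_coord|exact: measurable_cst].
Qed.

Lemma coord_le_sqr_dist a x i : 0 <= a -> sqr_dist x <= a ^+ 2 ->
  `|x 0 i - g 0 i| <= a.
Proof.
move=> a0 xa; rewrite -(ger0_norm a0) -ler_sqr ?nnegrE// !real_normK ?num_real//.
apply: le_trans xa; rewrite /sqr_dist (bigD1 i)//= lerDl.
by apply: sumr_ge0 => j _; exact: sqr_ge0.
Qed.

Lemma ge0_bounded_sqr_dist_in : exists c, ge0_bounded c sqr_dist_in.
Proof.
have [b b0 Kb] := convex_body_bounded K.
have c0 : 0 <= n%:R * (b + `|g|) ^+ 2 by rewrite mulr_ge0// sqr_ge0.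
exists (n%:R * (b + `|g|) ^+ 2); split.
  apply: measurable_funM; first exact: measurable_sqr_dist.
  exact: measurable_indic (measurable_convex_body K).
move=> x; rewrite /sqr_dist_in indicE; case: (boolP (x \in _)); last by rewrite mulr0 lexx.
rewrite in_setE => /Kb xb; rewrite mulr1 sqr_dist_ge0 /=.
apply: (@le_trans _ _ (\sum_(i < n) (b + `|g|) ^+ 2)).
  apply: ler_sum => i _; rewrite -real_normK ?num_real// lerXn2r ?nnegrE ?addr_ge0//.
  apply: le_trans (ler_normB _ _) _; apply: lerD; last exact: coord_ler_norm.
  by apply: le_trans xb; exact: coord_ler_norm.
by rewrite sumr_const card_ord mulr_natl.
Qed.

Lemma bounded_sqr_dist_in : bounded_mfun sqr_dist_in.
Proof. by have [c /ge0_boundedW] := ge0_bounded_sqr_dist_in. Qed.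

Lemma sqr_dist_in_ge0 x : 0 <= sqr_dist_in x.
Proof. by rewrite /sqr_dist_in mulr_ge0// sqr_dist_ge0. Qed.

Lemma expect_sqr_dist_in : Ex sqr_dist_in = R2.
Proof.
rewrite /mean_sqr_dist_centroid /Rintegral; congr fine.
have dK := is_density_unif K; have [c [mq _]] := ge0_bounded_sqr_dist_in.
rewrite (integral_density dK mq sqr_dist_in_ge0).
rewrite (integral_density dK measurable_sqr_dist sqr_dist_ge0).
apply: eq_integral => x _; rewrite /sqr_dist_in indicE.
by case: (x \in KK); rewrite ?mulr1 ?mulr0.
Qed.

Lemma mean_sqr_dist_ge0 : 0 <= R2.
Proof. by rewrite -expect_sqr_dist_in; apply: Rintegral_ge0 => x _; exact: sqr_dist_in_ge0. Qed.

Lemma rprob_far_le a : 0 < a -> pr [set x | a < sqr_dist_in x] <= R2 / a.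
Proof.
move=> a0; rewrite ler_pdivlMr// mulrC -expect_sqr_dist_in.
exact: markov_expect bounded_sqr_dist_in sqr_dist_in_ge0.
Qed.

(* Shrink [K] towards [c] by the factor [1 - 1/(2n)], which loses at most half
   of its volume: some point [y] of [K] and its image are then both near the
   centroid, and [y - c] is [2n] times their difference. *)
Lemma body_near_centroid t c : 0 < t -> 4 * R2 <= t ^+ 2 -> KK c ->
  forall i, `|c 0 i - g 0 i| <= 5 * n%:R * t.
Proof.
move=> t0 Rt Kc i.
pose u : R := (2 * n%:R)^-1; have n1 : 1 <= n%:R :> R by rewrite ler1n.
have u0 : 0 < u by rewrite invr_gt0 mulr_gt0.
have nu : n%:R * u = 2^-1 by rewrite /u; field; rewrite gt_eqF.
have u1 : u <= 2^-1 by rewrite -nu ler_peMl// ltW.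
have s0 : 0 < 1 - u by lra.
have sn : 2^-1 <= (1 - u) ^+ n.
  have := @bernoulli_le R n u; rewrite nu => h.
  by apply: le_trans (h _); [lra|apply/andP; split; lra].
pose B := [set x | t ^+ 2 < sqr_dist_in x].
pose phi := diag_affine (fun=> 1 - u) (fun j => ((1 - (1 - u)) *: c) 0 j).
have phiE x : phi x = homothety c (1 - u) x by rewrite homothetyE.
have phiK x : KK x -> KK (phi x).
  move=> Kx; have u01 : 0 <= 1 - u <= 1 by apply/andP; split; lra.
  have := convex_body_conv u01 Kc Kx; congr KK.
  by rewrite phiE; apply/rowP => j; rewrite /homothety !mxE; ring.
have mB : measurable B.
  exact: measurable_ltr_set (measurable_cst _) bounded_sqr_dist_in.1.
have mB' : measurable (phi @^-1` B) by exact: measurable_preimage_diag_affine.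
have pB : pr B <= 4^-1.
  apply: le_trans (rprob_far_le _) _; first exact: exprn_gt0.
  by rewrite ler_pdivrMr ?exprn_gt0//; lra.
have pB' : pr (phi @^-1` B) <= 2^-1.
  rewrite -[X in pr X]setTI.
  apply: le_trans (rprob_affine_le s0 _ measurableT mB _) _ => //.
    by move=> x _; exact: phiK.
  apply: (@le_trans _ _ (2 * 4^-1)); last lra.
  apply: ler_pM => //; first by rewrite invr_ge0 exprn_ge0// ltW.
    exact: rprob_ge0.
  by rewrite invf_ple ?posrE ?exprn_gt0.
(* The two bad sets have masses at most [1 / 4] and [1 / 2], so they do not cover [K]. *)
have [y [Ky yB yB']] : exists y, [/\ KK y, ~ B y & ~ B (phi y)].
  apply: contrapT => no.
  have mK := measurable_convex_body K; have mU := measurableU _ _ mB mB'.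
  have : pr KK <= pr (B `|` phi @^-1` B).
    apply: rprob_le => // y Ky; apply: contrapT => /not_orP[yB yB'].
    by apply: no; exists y.
  rewrite rprob_convex_body; have := rprobU_le (unif K) mB mB'; lra.
have near (z : 'rV[R]_n) : KK z -> ~ B z -> `|z 0 i - g 0 i| <= t.
  move=> Kz /negP; rewrite -leNgt /sqr_dist_in indicE mem_set// mulr1 => zt.
  by apply: coord_le_sqr_dist => //; exact: ltW.
have ny := near _ Ky yB; have nz := near _ (phiK _ Ky) yB'.
(* Both deviations are at most [t], whence [t + 2 * n * (2 * t) <= 5 * n * t]. *)
have E : c 0 i - g 0 i =
    (y 0 i - g 0 i) - 2 * n%:R * ((y 0 i - g 0 i) - (phi y 0 i - g 0 i)).
  by rewrite phiE /homothety !mxE /u; field; rewrite gt_eqF.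
rewrite E; apply: le_trans (ler_normB _ _) _.
rewrite normrM (ger0_norm (_ : 0 <= 2 * n%:R)); last by rewrite mulr_ge0.
have h := le_trans (ler_normB _ _) (lerD ny nz).
have n2 : 0 <= 2 * n%:R :> R by rewrite mulr_ge0.
have := ler_wpM2l n2 h; have := ler_wpM2r (ltW t0) n1; lra.
Qed.

End second_moment.

Section mixing_times.
Context {R : realType} (n : nat) (K : convex_body R n).
Hypothesis n0 : (0 < n)%N.
Local Notation KK := (convex_body_set K).
Local Notation pr := (rprob (unif K)).

Variables (mu0 : probability 'rV[R]_n R) (nu0 : 'rV[R]_n -> R) (M eps : R).
Hypotheses (dnu0 : is_density (unif K) mu0 nu0)
  (nu0M : ('N[unif K]_+oo[EFin \o nu0] < M%:E)%E) (e0 : 0 < eps).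

Let nR : 0 < n%:R :> R. Proof. by rewrite ltr0n. Qed.
Let n1 : 1 <= n%:R :> R. Proof. by rewrite ler1n. Qed.

Lemma mixing_time (x0 g : 'rV[R]_n) r rho s : 0 < r -> 0 < rho ->
  (forall w : 'rV[R]_n, `|w| <= r -> KK (x0 + w)) ->
  (forall x : 'rV[R]_n, KK x -> `|x - x0| <= n%:R * rho) ->
  0 <= s -> pr [set x | rho < `|x - g|] <= s -> 24 * s * M ^+ 2 <= eps ^+ 2 ->
  2 * eps <= M ->
  exists2 T : nat, mixed_after K mu0 eps T &
    T%:R <= 60 * (n%:R * (200 * 150 * (n%:R ^+ 2 * rho / r))) ^+ 2 * ln (M / eps).
Proof.
move=> r0 rho0 ballK distK s0 far sM eM.
have r_rho : r <= n%:R * rho.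
  pose w : 'rV[R]_n := const_mx r.
  have wr : `|w| = r by apply: rV_norm_const => //; exact: ltW.
  by have := distK _ (ballK w _); rewrite addrAC subrr add0r wr lexx; apply.
have A1 : 1 <= 200 * 150 * (n%:R ^+ 2 * rho / r).
  have a1 : 1 <= n%:R * rho / r by rewrite ler_pdivlMr// mul1r.
  have a2 : 1 <= n%:R * (n%:R * rho / r) by rewrite mulr_ege1.
  have -> : n%:R ^+ 2 * rho / r = n%:R * (n%:R * rho / r) by ring.
  lra.
apply: (mixing_isoperimetric n0 dnu0 nu0M e0 eM A1 (s := 3 * s)).
- by rewrite mulr_ge0.
- by apply: le_trans sM; rewrite mulrA; apply: ler_wpM2r; [exact: sqr_ge0|lra].
by move=> S G mS mG sep; exact: (isoperimetry n0 r0 rho0 ballK distK mS mG sep far).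
Qed.

Lemma le_max0_ln (x y : R) : 0 < x -> x <= y -> ln x <= Num.max 0 (ln y).
Proof.
by move=> x0 xy; rewrite le_max ler_ln ?posrE ?xy ?orbT// (lt_le_trans x0).
Qed.

Lemma mixing_time_warm : (exists c : 'rV[R]_n, euclidean_ball c 1 `<=` KK) ->
  exists2 T : nat, mixed_after K mu0 eps T &
    T%:R <= 60 * (200 * 150 * 20) ^+ 2 *
      (M ^+ 2 * mean_sqr_dist_centroid K * n%:R ^+ 8 / eps ^+ 2 *
       Num.max 0 (ln (2 * M / eps))).
Proof.
move=> [x0 ballK]; set R2 := mean_sqr_dist_centroid K.
have R2_ge0 : 0 <= R2 by exact: mean_sqr_dist_ge0.
have B0 : 0 <= M ^+ 2 * R2 * n%:R ^+ 8 / eps ^+ 2.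
  apply: divr_ge0; last exact: sqr_ge0.
  by apply: mulr_ge0; [apply: mulr_ge0; [exact: sqr_ge0|]|exact: exprn_ge0].
case: (ltP M (2 * eps)) => [Me|eM].
  exists 0%N; first exact: mixing_trivial dnu0 nu0M e0 Me.
  apply: mulr_ge0; first by apply: mulr_ge0; [|exact: sqr_ge0].
  apply: mulr_ge0; last by rewrite le_max lexx.
  exact: B0.
have ball_inf (w : 'rV[R]_n) : `|w| <= n%:R^-1 -> KK (x0 + w).
  move=> wn; apply: ballK; rewrite /euclidean_ball/= -[leRHS]sqrtr1.
  apply: ler_wsqrtr; apply: (@le_trans _ _ (\sum_(i < n) n%:R^-1)); last first.
    by rewrite sumr_const card_ord -[_ *+ n]mulr_natl divff// gt_eqF.
  apply: ler_sum => i _; rewrite mxE addrAC subrr add0r -real_normK ?num_real//.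
  have wi := le_trans (coord_ler_norm w i) wn.
  have n1' : n%:R^-1 <= 1 :> R by rewrite invf_le1.
  rewrite expr2; apply: le_trans (ler_pM _ _ wi (le_trans wi n1')) _ => //.
  by rewrite mulr1.
have Kx0 : KK x0.
  by have := ball_inf 0; rewrite addr0; apply; rewrite normr0 invr_ge0 ltW.
have near t x i : 0 < t -> 4 * R2 <= t ^+ 2 -> KK x ->
    `|x 0 i - x0 0 i| <= 10 * n%:R * t.
  move=> t0 Rt Kx.
  have h1 := body_near_centroid n0 t0 Rt Kx i.
  have h2 := body_near_centroid n0 t0 Rt Kx0 i.
  have -> : x 0 i - x0 0 i = (x 0 i - centroid K 0 i) - (x0 0 i - centroid K 0 i) by ring.
  by apply: le_trans (ler_normB _ _) _; apply: le_trans (lerD h1 h2) _; lra.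
have R2_gt0 : 0 < R2.
  rewrite lt_neqAle R2_ge0 andbT eq_sym; apply/eqP => R2_0.
  (* If [R2] were 0, any positive [t] would be allowed in [near]; this one confines [K] to distance
     [1 / (2 * n)] from [x0], against the cube of radius [1 / n]. *)
  pose t : R := (20 * n%:R ^+ 2)^-1.
  have t0 : 0 < t by rewrite invr_gt0 mulr_gt0// exprn_gt0.
  have := near t (x0 + const_mx n%:R^-1) (Ordinal n0) t0.
  rewrite R2_0 mulr0 sqr_ge0 => /(_ isT).
  rewrite !mxE addrAC subrr add0r ger0_norm; last by rewrite invr_ge0 ltW.
  have -> : 10 * n%:R * t = n%:R^-1 / 2 by rewrite /t; field; rewrite gt_eqF.
  have : 0 < n%:R^-1 :> R by rewrite invr_gt0.
  move=> ni h; suff : n%:R^-1 <= n%:R^-1 / 2 :> R by lra.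
  apply: h; apply: ball_inf.
  by rewrite rV_norm_const// ltW.
pose sigma := Num.sqrt R2.
have sigma0 : 0 < sigma by rewrite sqrtr_gt0.
have sigma2 : sigma ^+ 2 = R2 by rewrite sqr_sqrtr.
have M0 : 0 < M by have := e0; lra.
have q2 : 2 <= M / eps by rewrite ler_pdivlMr.
(* [near] with [t = 2 * sigma] places [K] within [n * (20 * sigma)] of [x0], and the factor
   [M / eps] makes the far mass at most [(eps / M) ^ 2 / 400], below what [mixing_time] allows. *)
pose rho := 20 * sigma * (M / eps).
have rho_ge : 20 * sigma <= rho.
  by rewrite /rho ler_peMr// ?mulr_ge0// ?ltW//; lra.
have rho0 : 0 < rho by apply: lt_le_trans rho_ge; rewrite mulr_gt0.
have dist x : KK x -> `|x - x0| <= n%:R * rho.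
  move=> Kx; apply: rV_norm_ler => [|i]; first by rewrite mulr_ge0// ltW.
  rewrite !mxE; apply: le_trans (near (2 * sigma) x i _ _ Kx) _.
  - by rewrite mulr_gt0.
  - by rewrite exprMn sigma2; lra.
  rewrite (_ : 10 * n%:R * (2 * sigma) = n%:R * (20 * sigma)); last by ring.
  exact: ler_wpM2l (ltW nR) _ _ rho_ge.
have rr0 : 0 < rho ^+ 2 by rewrite exprn_gt0.
have far : pr [set x | rho < `|x - centroid K|] <= R2 / rho ^+ 2.
  apply: le_trans (rprob_far_le _ rr0).
  have mA := measurable_far (centroid K) rho.
  rewrite -(rprob_setI_body K mA); apply: rprob_le.
  - by apply: measurableI => //; exact: measurable_convex_body.
  - exact: measurable_ltr_set (measurable_cst _) (bounded_sqr_dist_in K).1.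
  move=> x [/= xr Kx]; rewrite /sqr_dist_in indicE mem_set// mulr1 ltNge.
  apply/negP => qx; move: xr; rewrite ltNge => /negP; apply.
  apply: rV_norm_ler => [|i]; first exact: ltW.
  by rewrite 2!mxE; apply: coord_le_sqr_dist => //; exact: ltW.
have ni0 : 0 < n%:R^-1 :> R by rewrite invr_gt0.
have [||T mix TB] := mixing_time ni0 rho0 ball_inf dist _ far _ eM.
- by rewrite divr_ge0// ltW.
- have -> : 24 * (R2 / rho ^+ 2) * M ^+ 2 = 24 / 20 ^+ 2 * eps ^+ 2.
    rewrite /rho -sigma2; have : 20 != 0 :> R by rewrite pnatr_eq0.
    move: (20 : R) (24 : R) => a b a0.
    by field; rewrite a0 !gt_eqF.
  by rewrite ler_piMl ?sqr_ge0// ler_pdivrMr ?exprn_gt0// mul1r; lra.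
exists T => //; apply: le_trans TB _.
have -> : 60 * (n%:R * (200 * 150 * (n%:R ^+ 2 * rho / n%:R^-1))) ^+ 2 =
    60 * (200 * 150 * 20) ^+ 2 * (M ^+ 2 * R2 * n%:R ^+ 8 / eps ^+ 2).
  rewrite /rho -sigma2 invrK.
  move: (200 * 150 : R) (20 : R) (60 : R) => a b c.
  by field; rewrite gt_eqF.
rewrite [leRHS]mulrA; apply: ler_wpM2l.
  exact: mulr_ge0.
apply: le_max0_ln; first by rewrite divr_gt0.
by rewrite -mulrA; lra.
Qed.

Lemma mixing_time_cold r Rad : 0 < r -> 0 < Rad ->
  [set r *: x | x in B_infty] `<=` KK -> KK `<=` [set Rad *: x | x in B_infty] ->
  exists2 T : nat, mixed_after K mu0 eps T &
    T%:R <= 60 * (200 * 150) ^+ 2 *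
      (n%:R ^+ 8 / (r / Rad) ^+ 2 * Num.max 0 (ln (M / eps))).
Proof.
move=> r0 Rad0 rK KR.
have C0 : 0 <= 60 * (200 * 150) ^+ 2 :> R by apply: mulr_ge0; [|exact: sqr_ge0].
have q0 : 0 < (r / Rad) ^+ 2 by rewrite exprn_gt0// divr_gt0.
have B0 : 0 <= n%:R ^+ 8 / (r / Rad) ^+ 2.
  by apply: divr_ge0; [exact: exprn_ge0|exact: ltW].
case: (ltP M (2 * eps)) => [Me|eM].
  exists 0%N; first exact: mixing_trivial dnu0 nu0M e0 Me.
  by rewrite mulr_ge0// mulr_ge0// le_max lexx.
have ballK (w : 'rV[R]_n) : `|w| <= r -> KK (0 + w).
  move=> wr; rewrite add0r; apply: rK; exists (r^-1 *: w); last first.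
    by rewrite scalerA divff ?scale1r// gt_eqF.
  move=> i; rewrite mxE normrM ger0_norm; last by rewrite invr_ge0 ltW.
  by rewrite mulrC ler_pdivrMr// mul1r; apply: le_trans wr; exact: coord_ler_norm.
have distK x : KK x -> `|x - 0| <= Rad.
  move=> /KR[y yB <-]; rewrite subr0; apply: rV_norm_ler => [|i]; first exact: ltW.
  by rewrite mxE normrM (ger0_norm (ltW Rad0)) ler_piMr// ltW.
have distK' x : KK x -> `|x - 0| <= n%:R * Rad.
  by move=> /distK/le_trans; apply; rewrite ler_peMl// ltW.
have mA := measurable_far (0 : 'rV[R]_n) Rad.
have far : pr [set x : 'rV[R]_n | Rad < `|x - 0|] <= 0.
  rewrite -(rprob_setI_body K mA) (_ : _ `&` _ = set0) ?/rprob ?measure0//.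
  by apply/seteqP; split => // x [/= + /distK]; rewrite ltNge => /negP.
have [|T mix TB] := mixing_time r0 Rad0 ballK distK' (lexx 0) far _ eM.
  by rewrite mulr0 mul0r sqr_ge0.
exists T => //; apply: le_trans TB _.
have M0 : 0 < M by have := e0; lra.
rewrite [leRHS]mulrA; apply: ler_pM.
- by apply: mulr_ge0; [|exact: sqr_ge0].
- by apply: ln_ge0; rewrite ler_pdivlMr// mul1r; lra.
(* Here [r] is not scaled down with [n], and the power obtained is [n ^ 6]. *)
- have -> : 60 * (n%:R * (200 * 150 * (n%:R ^+ 2 * Rad / r))) ^+ 2 =
      60 * (200 * 150) ^+ 2 * (n%:R ^+ 6 / (r / Rad) ^+ 2).
    move: (200 * 150 : R) (60 : R) => a b.
    by field; rewrite !gt_eqF.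
  apply: ler_wpM2l => //; apply: ler_wpM2r; first by rewrite invr_ge0 ltW.
  exact: ler_weXn2l.
by apply: le_max0_ln => //; rewrite divr_gt0.
Qed.

End mixing_times.

Theorem corollary1p3 (R : realType) :
  (exists2 C : R, 0 < C &
    forall (n : nat) (K : convex_body R n) (mu0 : probability 'rV[R]_n R)
      (nu0 : 'rV[R]_n -> R) (M eps : R),
      (0 < n)%N ->
      (exists c : 'rV[R]_n, euclidean_ball c 1 `<=` K) ->
      is_density (unif K) mu0 nu0 ->
      ('N[unif K]_+oo[EFin \o nu0] < M%:E)%E ->
      0 < eps ->
      exists2 T : nat, mixed_after K mu0 eps T &
        T%:R <= C * (M ^+ 2 * mean_sqr_dist_centroid K * n%:R ^+ 8 / eps ^+ 2
                     * Num.max 0 (ln (2 * M / eps))))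
  /\
  (exists2 C : R, 0 < C &
    forall (n : nat) (K : convex_body R n) (r Rad : R)
      (mu0 : probability 'rV[R]_n R) (nu0 : 'rV[R]_n -> R) (M eps : R),
      (0 < n)%N ->
      0 < r -> 0 < Rad ->
      [set r *: x | x in B_infty] `<=` K ->
      K `<=` [set Rad *: x | x in B_infty] ->
      is_density (unif K) mu0 nu0 ->
      ('N[unif K]_+oo[EFin \o nu0] < M%:E)%E ->
      0 < eps ->
      exists2 T : nat, mixed_after K mu0 eps T &
        T%:R <= C * (n%:R ^+ 8 / (r / Rad) ^+ 2 * Num.max 0 (ln (M / eps)))).
Proof.
split.
  exists (60 * (200 * 150 * 20) ^+ 2).
    by rewrite mulr_gt0// exprn_gt0// !mulr_gt0.
  by move=> n K mu0 nu0 M eps n0 ball dnu NM e0; have := mixing_time_warm n0 dnu NM e0 ball.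
exists (60 * (200 * 150) ^+ 2).
  by rewrite mulr_gt0// exprn_gt0// mulr_gt0.
move=> n K r Rad mu0 nu0 M eps n0 r0 Rad0 rK KR dnu NM e0.
by have := mixing_time_cold n0 dnu NM e0 r0 Rad0 rK KR.
Qed.
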